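(* For each of the 17 two-dimensional crystallographic groups $\mathcal G$ (p1, p2, pm, pg, pmm, pmg, pgg, p4, p4m, p4g, cm, cmm, p3, p31m, p3m1, p6, p6m, in the explicit realizations listed in the context) and for any integer dilation $d\ge 2$, there exists a set $W\subset\mathbb R^2$ that is a single wavelet set for $\mathcal G$ and dilation by $d$.
   Context: Let $\mathcal O_2$ be the $2$-dimensional orthogonal group. Elements $[x,L]$ of $\mathbb R^2\rtimes\mathcal O_2$ ($x\in\mathbb R^2$, $L\in\mathcal O_2$) act on $\mathbb R^2$ by $[x,L]\cdot z=L(x+z)$ and on $L^2(\mathbb R^2)$ by $([x,L]\cdot f)(z)=f(L^{-1}z-x)$; multiplication is $[x,L]\cdot[y,M]=[M^{-1}x+y,LM]$. Notation: $I$ is the identity matrix; $\tau_v=[v,I]$ is translation by $v$; $\rho_n$ is counterclockwise rotation by $2\pi/n$, identified with $[0,\rho_n]$; $\sigma_v$ is reflection in the line through the origin determined by $v$, identified with $[0,\sigma_v]$. The groups with lattice $\mathbb Z^2$ are generated by $\tau_{(1,0)},\tau_{(0,1)}$ together with: p1: nothing further; p2: $\rho_2$; pm: $\sigma_{(0,1)}$; pg: $[(0,\frac12),\sigma_{(0,1)}]$; pmm: $\rho_2,\sigma_{(0,1)}$; pmg: $\rho_2,[(0,\frac12),\sigma_{(0,1)}]$; pgg: $\rho_2,[(\frac12,\frac12),\sigma_{(0,1)}]$; p4: $\rho_4$; p4m: $\rho_4,\sigma_{(1,1)}$; p4g: $\rho_4,[(\frac12,\frac12),\sigma_{(1,1)}]$;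 cm: $\sigma_{(1,1)}$; cmm: $\rho_2,\sigma_{(1,1)}$. The groups with hexagonal lattice are generated by $\tau_{(1,0)},\tau_{(\frac12,\frac{\sqrt3}2)}$ together with: p3: $\rho_3$; p31m: $\rho_3,\sigma_{(1,0)}$; p3m1: $\rho_3,\sigma_{(0,1)}$; p6: $\rho_6$; p6m: $\rho_6,\sigma_{(\frac{\sqrt3}2,\frac12)}$. The dilation operator is $(\delta_d f)(z)=d\,f(dz)$ on $L^2(\mathbb R^2)$. The Fourier transform is $(\mathcal Ff)(\xi)=\int_{\mathbb R^2}f(z)e^{-2\pi i\langle z,\xi\rangle}dz$, with inverse $\mathcal F^{-1}$, and $\mathbf 1_W$ is the characteristic function of $W$. A set $W\subset\mathbb R^2$ is a (single) wavelet set for $\mathcal G$ and dilation by $d$ if, with $\psi=\mathcal F^{-1}(\mathbf 1_W)$, the family $\{\delta_d^{\,j}(\gamma\cdot\psi):j\in\mathbb Z,\ \gamma\in\mathcal G\}$ is an orthonormal basis of $L^2(\mathbb R^2)$.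
   Formalization: For the five groups with hexagonal lattice (p3, p31m, p3m1, p6, p6m), ψ is taken as (√3/2)^{1/2}·F^{-1}(1_W) rather than F^{-1}(1_W), since without this factor lattice translates of ψ can never be orthonormal; for the 12 groups with lattice Z² ψ is as stated. *)

(* Defs.v *)
From HB Require Import structures.
From mathcomp Require Import all_boot all_order all_algebra.
From mathcomp Require Import ring.
From mathcomp Require Import complex.
From mathcomp Require Import all_classical all_reals all_analysis.

Set Implicit Arguments.
Unset Strict Implicit.
Unset Printing Implicit Defensive.

Import Order.TTheory GRing.Theory Num.Theory.
Import numFieldNormedType.Exports.
Local Open Scope classical_set_scope.
Local Open Scope ring_scope.
Local Open Scope complex_scope.

Section OrthogonalGroup.
Variable R : realType.

Definition orthogonal_mx (L : 'M[R]_2) : bool := L^T *m L == 1%:M.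

Record O2 := OrthMx { O2_mx :> 'M[R]_2; O2P : orthogonal_mx O2_mx }.

HB.instance Definition _ := [isSub for O2_mx].
HB.instance Definition _ := [Choice of O2 by <:].

Lemma O2_tr (L : O2) : L^T *m L = 1%:M.
Proof. exact/eqP/O2P. Qed.

Lemma O2_unit (L : O2) : O2_mx L \in unitmx.
Proof. by have /mulmx1_unit[] := O2_tr L. Qed.

Lemma O2_invmx (L : O2) : invmx L = L^T.
Proof. by rewrite -[LHS]mul1mx -(O2_tr L) mulmxK ?O2_unit. Qed.

Lemma orthogonal_one : orthogonal_mx 1%:M.
Proof. by rewrite /orthogonal_mx trmx1 mulmx1. Qed.

Lemma orthogonal_mul (L M : O2) : orthogonal_mx (L *m M).
Proof.
by rewrite /orthogonal_mx trmx_mul -mulmxA (mulmxA L^T) O2_tr mul1mx O2_tr.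
Qed.

Lemma orthogonal_inv (L : O2) : orthogonal_mx (invmx L).
Proof. by rewrite /orthogonal_mx O2_invmx trmxK -O2_invmx mulmxV ?O2_unit. Qed.

Definition O2_one : O2 := OrthMx orthogonal_one.
Definition O2_mul (L M : O2) : O2 := OrthMx (orthogonal_mul L M).
Definition O2_inv (L : O2) : O2 := OrthMx (orthogonal_inv L).

Definition rotation_mx (n : nat) : 'M[R]_2 :=
  let t := 2 * pi / n%:R in
  \matrix_(i, j) (if i == j then cos t else if i == 0 then - sin t else sin t).

Lemma orthogonal_rotation n : orthogonal_mx (rotation_mx n).
Proof.
apply/eqP/matrixP => i j; rewrite !mxE !big_ord_recl big_ord0 !mxE /= addr0.
set t := 2 * pi / n%:R; have cs := cos2Dsin2 t.
case: i => [[|[|//]] hi]; case: j => [[|[|//]] hj]; rewrite /= -?expr2 ?sqrrN.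
- exact: cs.
- by rewrite mulrN addrC mulrC subrr.
- by rewrite mulNr mulrC addrC subrr.
- by rewrite addrC.
Qed.

Definition dot (z w : R * R) : R := z.1 * w.1 + z.2 * w.2.

Definition coord (z : R * R) (i : 'I_2) : R := if i == 0 then z.1 else z.2.

(* The matrix of z |-> 2 <z, v> / <v, v> v - z; only meant for v != 0, although
   the junk value -1%:M at v = 0 is orthogonal too. *)
Definition reflection_mx (v : R * R) : 'M[R]_2 :=
  \matrix_(i, j) (2 * coord v i * coord v j / dot v v - (i == j)%:R).

Lemma orthogonal_reflection v : orthogonal_mx (reflection_mx v).
Proof.
apply/eqP/matrixP => i j; rewrite !mxE !big_ord_recl big_ord0 !mxE /= addr0.
case: v => a b; rewrite /dot /coord /=.
have [/eqP|n0] := eqVneq (a * a + b * b) 0.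
  rewrite paddr_eq0 -?expr2 ?sqr_ge0 // !sqrf_eq0 => /andP[/eqP -> /eqP ->].
  by case: i => [[|[|//]] hi]; case: j => [[|[|//]] hj];
     rewrite /= ?(mulr0, mul0r, add0r, subr0, mulrNN, mulr1, addr0, oppr0).
by case: i => [[|[|//]] hi]; case: j => [[|[|//]] hj] /=; field.
Qed.

Definition rho n : O2 := OrthMx (orthogonal_rotation n).
Definition sigma v : O2 := OrthMx (orthogonal_reflection v).

Definition mx_point (L : 'M[R]_2) (z : R * R) : R * R :=
  (L 0 0 * z.1 + L 0 1 * z.2, L 1 0 * z.1 + L 1 1 * z.2).

Lemma mx_pointM (L M : 'M[R]_2) z :
  mx_point (L *m M) z = mx_point L (mx_point M z).
Proof.
rewrite /mx_point !mxE !big_ord_recl !big_ord0 /=.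
have -> : lift ord0 ord0 = 1 :> 'I_2 by exact/val_inj.
by congr pair; ring.
Qed.

Lemma mx_point1 z : mx_point 1%:M z = z.
Proof. by case: z => a b; rewrite /mx_point !mxE /=; congr pair; ring. Qed.

Lemma mx_pointD (L : 'M[R]_2) z w :
  mx_point L (z + w) = mx_point L z + mx_point L w.
Proof. by congr pair; rewrite /=; ring. Qed.

Lemma mx_pointN (L : 'M[R]_2) z : mx_point L (- z) = - mx_point L z.
Proof. by congr pair; rewrite /=; ring. Qed.

End OrthogonalGroup.

(* Motion x L is the element [x, L] of the semidirect product of R^2 and O_2. *)
Record motion (R : realType) := Motion { trans : R * R; lin : O2 R }.

Section MotionGroup.
Variable R : realType.
Implicit Types g h : motion R.

Definition motion_pair g := (trans g, lin g).
Definition pair_motion (p : (R * R) * O2 R) := Motion p.1 p.2.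
Lemma motion_pairK : cancel motion_pair pair_motion.
Proof. by case. Qed.
HB.instance Definition _ := Choice.copy (motion R) (can_type motion_pairK).

Definition motion_one : motion R := Motion 0 (O2_one R).
Definition motion_mul g h : motion R :=
  Motion (mx_point (invmx (lin h)) (trans g) + trans h) (O2_mul (lin g) (lin h)).
Definition motion_inv g : motion R :=
  Motion (- mx_point (lin g) (trans g)) (O2_inv (lin g)).

Lemma motion_mulA : associative motion_mul.
Proof.
move=> [x L] [y M] [z N]; congr Motion => /=; last first.
  by apply/val_inj; rewrite /= mulmxA.
rewrite mx_pointD -mx_pointM addrA; congr (mx_point _ _ + _ + _).
by rewrite !O2_invmx -trmx_mul -(O2_invmx (O2_mul _ _)).
Qed.

Lemma motion_mul1 : left_id motion_one motion_mul.
Proof.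
move=> [x L]; congr Motion => /=; last by apply/val_inj; rewrite /= mul1mx.
by rewrite /mx_point /= !mulr0 addr0; case: x => a b; congr pair; rewrite /= add0r.
Qed.

Lemma motion_mulr1 : right_id motion_one motion_mul.
Proof.
move=> [x L]; congr Motion => /=; last by apply/val_inj; rewrite /= mulmx1.
by rewrite invmx1 mx_point1 addr0.
Qed.

Lemma motion_mulV : left_inverse motion_one motion_inv motion_mul.
Proof.
move=> [x L]; congr Motion => /=.
  by rewrite mx_pointN -mx_pointM mulVmx ?O2_unit // mx_point1 addNr.
by apply/val_inj; rewrite /= mulVmx ?O2_unit.
Qed.

Lemma motion_mulrV : right_inverse motion_one motion_inv motion_mul.
Proof.
move=> [x L]; congr Motion => /=.
  by rewrite invmxK addrN.
by apply/val_inj; rewrite /= mulmxV ?O2_unit.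
Qed.

HB.instance Definition _ := isGroup.Build (motion R)
  motion_mulA motion_mul1 motion_mulr1 motion_mulV motion_mulrV.

Definition act_point g (z : R * R) : R * R := mx_point (lin g) (trans g + z).

Definition act_fun g (f : R * R -> R[i]) : R * R -> R[i] :=
  fun z => f (mx_point (invmx (lin g)) z - trans g).

Lemma act_pointM g h z : act_point (g * h)%g z = act_point g (act_point h z).
Proof.
case: g h => [x L] [y M]; rewrite /act_point /= mx_pointM; congr mx_point.
by rewrite -addrA !mx_pointD -mx_pointM mulmxV ?O2_unit // mx_point1.
Qed.

Lemma act_funE g f z : act_fun g f z = f (act_point g^-1%g z).
Proof.
case: g => [x L]; rewrite /act_fun /act_point /=; congr f.
by rewrite mx_pointD mx_pointN -mx_pointM mulVmx ?O2_unit // mx_point1 addrC.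
Qed.

End MotionGroup.

Inductive generated (G : groupType) (S : set G) : set G :=
| generated_gen g : S g -> generated S g
| generated_one : generated S 1%g
| generated_mul g h : generated S g -> generated S h -> generated S (g * h)%g
| generated_inv g : generated S g -> generated S g^-1%g.

Inductive wallpaper :=
  p1 | p2 | pm | pg | pmm | pmg | pgg | p4 | p4m | p4g | cm | cmm
| p3 | p31m | p3m1 | p6 | p6m.

Section WallpaperGroups.
Variable R : realType.

Definition is_hexagonal (w : wallpaper) : bool :=
  match w with p3 | p31m | p3m1 | p6 | p6m => true | _ => false end.

Definition lattice_basis (w : wallpaper) : (R * R) * (R * R) :=
  ((1, 0), if is_hexagonal w then (2^-1, Num.sqrt 3 / 2) else (0, 1)).

Definition covolume (w : wallpaper) : R :=
  let: (u, v) := lattice_basis w in `|u.1 * v.2 - u.2 * v.1|.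

Definition translation (v : R * R) : motion R := Motion v (O2_one R).
Definition linear_motion (L : O2 R) : motion R := Motion 0 L.

Definition extra_generators (w : wallpaper) : set (motion R) :=
  let rot n := linear_motion (rho R n) in
  let refl v := linear_motion (sigma v) in
  match w with
  | p1 => set0
  | p2 => [set rot 2%N]
  | pm => [set refl (0, 1)]
  | pg => [set Motion (0, 2^-1) (sigma (0, 1))]
  | pmm => [set rot 2%N; refl (0, 1)]
  | pmg => [set rot 2%N; Motion (0, 2^-1) (sigma (0, 1))]
  | pgg => [set rot 2%N; Motion (2^-1, 2^-1) (sigma (0, 1))]
  | p4 => [set rot 4%N]
  | p4m => [set rot 4%N; refl (1, 1)]
  | p4g => [set rot 4%N; Motion (2^-1, 2^-1) (sigma (1, 1))]
  | cm => [set refl (1, 1)]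
  | cmm => [set rot 2%N; refl (1, 1)]
  | p3 => [set rot 3%N]
  | p31m => [set rot 3%N; refl (1, 0)]
  | p3m1 => [set rot 3%N; refl (0, 1)]
  | p6 => [set rot 6%N]
  | p6m => [set rot 6%N; refl (Num.sqrt 3 / 2, 2^-1)]
  end.

Definition wallpaper_group (w : wallpaper) : set (motion R) :=
  let: (u, v) := lattice_basis w in
  generated ([set translation u; translation v] `|` extra_generators w).

Lemma covolume_square w : ~~ is_hexagonal w -> covolume w = 1.
Proof.
by rewrite /covolume /lattice_basis => /negbTE -> /=; rewrite mulr1 mul0r subr0 normr1.
Qed.

Lemma covolume_hexagonal w : is_hexagonal w -> covolume w = Num.sqrt 3 / 2.
Proof.
rewrite /covolume /lattice_basis => -> /=; rewrite mul1r mul0r subr0.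
by rewrite ger0_norm // divr_ge0 ?sqrtr_ge0.
Qed.

End WallpaperGroups.

Section L2.
Variable R : realType.
Local Notation mR := (measurableTypeR R).
Implicit Types f g : R * R -> R[i].

(* Lebesgue measure on the Borel sets of the plane. *)
Definition area : set (mR * mR) -> \bar R :=
  (@lebesgue_measure R \x @lebesgue_measure R)%E.

HB.instance Definition _ := Measure.on area.

Definition cintegral f : R[i] :=
  (\int[area]_z complex.Re (f z)) +i* (\int[area]_z complex.Im (f z)).

Definition norm2 f : \bar R :=
  Lnorm area 2%:E (fun z => (ComplexField.Normc.normc (f z))%:E).

(* Functions are not quotiented by almost everywhere equality: every notion
   below is invariant under modification on a null set. *)
Definition in_L2 f : Prop :=
  [/\ measurable_fun (setT : set (mR * mR)) (fun z => complex.Re (f z)),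
      measurable_fun (setT : set (mR * mR)) (fun z => complex.Im (f z)) &
      (norm2 f < +oo)%E].

Definition inner f g : R[i] := cintegral (fun z => f z * (g z)^*).

(* The family (e i), indexed by i in D, is an orthonormal basis of L^2(R^2):
   it is orthonormal and its finite linear combinations are dense. *)
Definition orthonormal_basis (I : eqType) (D : set I) (e : I -> R * R -> R[i]) :
    Prop :=
  [/\ (forall i, D i -> in_L2 (e i)),
      (forall i j, D i -> D j -> inner (e i) (e j) = (i == j)%:R) &
      forall f, in_L2 f -> forall eps : R, 0 < eps ->
        exists s : seq I, exists c : I -> R[i],
          (forall i, i \in s -> D i) /\
          (norm2 (fun z => f z - \sum_(i <- s) c i * e i z)%R < eps%:E)%E].

(* On integrable functions; the L^2 inverse Fourier transform is given by the
   same integral on L^1 `&` L^2. *)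
Definition inverse_fourier f : R * R -> R[i] :=
  fun z => cintegral (fun xi =>
    f xi * (cos (2 * pi * dot z xi) +i* sin (2 * pi * dot z xi))).

Definition dilation (a : R) f : R * R -> R[i] := fun z => a%:C * f (a *: z).

Lemma dilation1 f : dilation 1 f = f.
Proof. by apply/funext => z; rewrite /dilation scale1r mul1r. Qed.

Lemma dilationM a b f : dilation a (dilation b f) = dilation (a * b) f.
Proof.
apply/funext => z; rewrite /dilation scalerA mulrA -rmorphM /=.
by rewrite (mulrC b a).
Qed.

End L2.

Section WaveletSets.
Variable R : realType.
Local Notation mR := (measurableTypeR R).

(* The L^2 norm of F^-1(1_W) is the square root of the area of W.  For the
   lattice Z^2 the factor below is 1 and this is F^-1(1_W).  Orthonormality of
   the translates of c F^-1(1_W) by a lattice of covolume V makes c^2 / V times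
   the (integer-valued) periodization of 1_W equal to 1, so for the hexagonal
   lattice, where V = sqrt 3 / 2, it is impossible with c = 1; the factor
   c = sqrt V is the one for which W tiles the plane by the dual lattice. *)
Definition wavelet (w : wallpaper) (W : set (R * R)) : R * R -> R[i] :=
  fun z => (Num.sqrt (covolume R w))%:C *
           inverse_fourier (fun xi => (\1_W xi : R)%:C) z.

Lemma wavelet_square w W : ~~ is_hexagonal w ->
  wavelet w W = inverse_fourier (fun xi => (\1_W xi : R)%:C).
Proof.
by move=> sq; apply/funext => z; rewrite /wavelet covolume_square // sqrtr1 mul1r.
Qed.

(* Measurability and finite area express that 1_W is in L^2(R^2). The j-th power
   of the dilation by d is the dilation by d ^ j, by [dilation1] and
   [dilationM]. *)
Definition wavelet_set (w : wallpaper) (d : nat) (W : set (R * R)) : Prop :=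
  [/\ measurable (W : set (mR * mR)),
      (area W < +oo)%E &
      orthonormal_basis
        [set jg : int * motion R | wallpaper_group w jg.2]
        (fun jg => dilation (d%:R ^ jg.1) (act_fun jg.2 (wavelet w W)))].

End WaveletSets.

(* Main.v *)
From HB Require Import structures.
From mathcomp Require Import all_boot all_order all_algebra.
From mathcomp Require Import ring lra zify complex.
From mathcomp Require Import all_classical all_reals all_analysis measurable_realfun.
Require Import Defs.

Set Implicit Arguments.
Unset Strict Implicit.
Unset Printing Implicit Defensive.

Import Order.TTheory GRing.Theory Num.Theory.
Import numFieldNormedType.Exports.
Local Open Scope classical_set_scope.
Local Open Scope ring_scope.
Local Open Scope complex_scope.

(** A wavelet system consists of the functions obtained from [wavelet w W] by
    the motions of the group and the dilations by the powers of [d]. On the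
    Fourier side, the element at scale a = d^j of the motion [x, L] is supported
    on a L (W) and is there a multiple of a character, and the translations of
    the group act on a fixed a L (W) by the characters of the lattice. The
    system is therefore an orthonormal basis as soon as two conditions hold:
    W tiles the plane by translations of the dual lattice, so that the
    characters form an orthogonal basis on each piece, and the pieces a L (W),
    for j in Z and L in the point group, tile the plane up to a null set.

    Such a W is found as follows. The translations of a wallpaper group form
    exactly the given lattice ([wallpaper_translation]) and its point group is
    finite ([finite_point_group]). Hence the Dirichlet region of a generic point
    for the point group is an open cone whose images under the point group are
    disjoint and cover almost everything ([dirichlet_disjoint],
    [dirichlet_cover]). Inside a cone, a small annulus tiles by dilations and
    packs by translations, while a unit cell far from the origin tiles by
    translations and packs by dilations; a Cantor-Bernstein argument merges them
    into a set that tiles in both ways ([wavelet_tile]). Coordinates dual to the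
    lattice basis reduce the translations to Z^2.

    The analysis is done from first principles. The exponentials with integer
    frequencies are complete on every Borel set that is a packing for Z^2
    ([trig_dense]): the limits of bounded trigonometric polynomials form an
    algebra closed under bounded pointwise limits, hence contain the indicator
    functions of periodic Borel sets. With their orthogonality this gives the
    Parseval identity on tiles ([parseval]), and integrating that identity over
    the unit square gives the Plancherel identity ([plancherel]). The inverse
    Fourier transform is then an isometry with dense range on bounded functions
    of bounded support, and it suffices to show that the spectra of the system
    are orthonormal ([inner_wavelet_spectrum]) and total ([approx_spectrum]). *)

(** * Complex functions on the plane and their squared L^2 norm *)

Section ComplexFunctions.
Variable R : realType.
Local Notation mR := (measurableTypeR R).
Local Notation C := R[i].
Local Notation Re := complex.Re.
Local Notation Im := complex.Im.
Implicit Types (f g h : R * R -> C).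

Lemma cReD (x y : C) : Re (x + y) = Re x + Re y. Proof. by case: x; case: y. Qed.
Lemma cImD (x y : C) : Im (x + y) = Im x + Im y. Proof. by case: x; case: y. Qed.
Lemma cReN (x : C) : Re (- x) = - Re x. Proof. by case: x. Qed.
Lemma cImN (x : C) : Im (- x) = - Im x. Proof. by case: x. Qed.
Lemma cReM (x y : C) : Re (x * y) = Re x * Re y - Im x * Im y.
Proof. by case: x; case: y. Qed.
Lemma cImM (x y : C) : Im (x * y) = Re x * Im y + Im x * Re y.
Proof. by case: x; case: y. Qed.
Lemma cReJ (x : C) : Re x^* = Re x. Proof. by case: x. Qed.
Lemma cImJ (x : C) : Im x^* = - Im x. Proof. by case: x. Qed.
Lemma Cext (x y : C) : Re x = Re y -> Im x = Im y -> x = y.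
Proof. by case: x y => [a b] [c d] /= -> ->. Qed.

Definition csq (x : C) : R := Re x ^+ 2 + Im x ^+ 2.

Lemma csq_ge0 x : 0 <= csq x. Proof. by rewrite addr_ge0 ?sqr_ge0. Qed.
Lemma csq0 : csq 0 = 0. Proof. by rewrite /csq /= expr0n addr0. Qed.
Lemma csqM x y : csq (x * y) = csq x * csq y.
Proof. by case: x y => [a b] [c d]; rewrite /csq /=; ring. Qed.
Lemma csqN x : csq (- x) = csq x.
Proof. by case: x => a b; rewrite /csq /= !sqrrN. Qed.
Lemma csqJ x : csq x^* = csq x.
Proof. by case: x => a b; rewrite /csq /= sqrrN. Qed.
Lemma csq_real (a : R) : csq a%:C = a ^+ 2.
Proof. by rewrite /csq /= expr0n addr0. Qed.
Lemma csqE x : (csq x)%:C = x * x^*.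
Proof. by case: x => a b; apply: Cext; rewrite /csq /=; ring. Qed.
Lemma csqD_le x y : csq (x + y) <= 2 * csq x + 2 * csq y.
Proof.
case: x y => [a b] [c d]; rewrite /csq /=.
have := sqr_ge0 (a - c); have := sqr_ge0 (b - d); nra.
Qed.
Lemma normc_sqr (x : C) : ComplexField.Normc.normc x ^+ 2 = csq x.
Proof. by case: x => a b; rewrite /= sqr_sqrtr // addr_ge0 ?sqr_ge0. Qed.
Lemma Re_le_csq (x : C) : `|Re x| <= 1 + csq x.
Proof.
rewrite /csq; have := sqr_ge0 (Im x); have := sqr_ge0 (`|Re x| - 1).
rewrite -(real_normK (num_real (Re x))); have := normr_ge0 (Re x); nra.
Qed.
Lemma Im_le_csq (x : C) : `|Im x| <= 1 + csq x.
Proof.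
rewrite /csq; have := sqr_ge0 (Re x); have := sqr_ge0 (`|Im x| - 1).
rewrite -(real_normK (num_real (Im x))); have := normr_ge0 (Im x); nra.
Qed.

Definition cmeas f : Prop :=
  measurable_fun (setT : set (mR * mR)) (fun z => Re (f z)) /\
  measurable_fun (setT : set (mR * mR)) (fun z => Im (f z)).

Lemma cmeasD f g : cmeas f -> cmeas g -> cmeas (fun z => f z + g z).
Proof.
move=> [f1 f2] [g1 g2]; split.
  by under eq_fun do rewrite cReD; exact: measurable_funD.
by under eq_fun do rewrite cImD; exact: measurable_funD.
Qed.

Lemma cmeasN f : cmeas f -> cmeas (fun z => - f z).
Proof.
move=> [f1 f2]; split.
  by under eq_fun do rewrite cReN; exact: measurable_funN.
by under eq_fun do rewrite cImN; exact: measurable_funN.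
Qed.

Lemma cmeasB f g : cmeas f -> cmeas g -> cmeas (fun z => f z - g z).
Proof. by move=> mf mg; apply: cmeasD => //; exact: cmeasN. Qed.

Lemma cmeasM f g : cmeas f -> cmeas g -> cmeas (fun z => f z * g z).
Proof.
move=> [f1 f2] [g1 g2]; split.
  by under eq_fun do rewrite cReM; apply: measurable_funB; exact: measurable_funM.
by under eq_fun do rewrite cImM; apply: measurable_funD; exact: measurable_funM.
Qed.

Lemma cmeasJ f : cmeas f -> cmeas (fun z => (f z)^*).
Proof.
move=> [f1 f2]; split.
  by under eq_fun do rewrite cReJ.
by under eq_fun do rewrite cImJ; exact: measurable_funN.
Qed.

Lemma cmeas_cst c : cmeas (fun=> c). Proof. by split; exact: measurable_cst. Qed.

Lemma cmeas_real (u : R * R -> R) :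
  measurable_fun (setT : set (mR * mR)) u -> cmeas (fun z => (u z)%:C).
Proof. by move=> mu; split => //=; exact: measurable_cst. Qed.

Lemma cmeas_indic (A : set (R * R)) : measurable (A : set (mR * mR)) ->
  cmeas (fun z => (\1_A z : R)%:C).
Proof. by move=> mA; apply: cmeas_real; exact: measurable_indic. Qed.

Lemma cmeas_sum (I : Type) (s : seq I) (F : I -> R * R -> C) :
  (forall i, cmeas (F i)) -> cmeas (fun z => \sum_(i <- s) F i z).
Proof.
move=> mF; elim: s => [|i s IH].
  by under eq_fun do rewrite big_nil; exact: cmeas_cst.
by under eq_fun do rewrite big_cons; exact: cmeasD.
Qed.

Lemma cmeas_comp f (T : R * R -> R * R) :
  measurable_fun (setT : set (mR * mR)) (T : mR * mR -> mR * mR) ->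
  cmeas f -> cmeas (fun z => f (T z)).
Proof. move=> mT [f1 f2]; split.
  exact: (measurableT_comp f1 mT).
exact: (measurableT_comp f2 mT). Qed.

Lemma measurable_csq f : cmeas f ->
  measurable_fun (setT : set (mR * mR)) (fun z => csq (f z)).
Proof.
by move=> [f1 f2]; apply: measurable_funD; exact: measurable_funX.
Qed.

Lemma measurable_csqE f : cmeas f ->
  measurable_fun (setT : set (mR * mR)) (fun z => (csq (f z))%:E).
Proof. by move=> /measurable_csq ?; exact/measurable_EFinP. Qed.

(** The squared L^2 norm, as an extended real, so that it makes sense before
    [f] is known to be in L^2; working with squares keeps roots out of all
    estimates. *)
Definition sq f : \bar R := (\int[@area R]_z (csq (f z))%:E)%E.
Lemma sq_ge0 f : (0 <= sq f)%E.
Proof. by apply: integral_ge0 => z _; rewrite lee_fin csq_ge0. Qed.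

Lemma norm2E f : norm2 f = (sq f `^ 2^-1)%E.
Proof.
rewrite /norm2 unlock; congr (_ `^ _)%E; apply: eq_integral => z _.
rewrite abse_EFin poweR_EFin powR_mulrn ?normr_ge0 //.
by rewrite real_normK ?num_real // normc_sqr.
Qed.

Lemma norm2_lt f (eps : R) : 0 < eps -> (sq f < (eps ^+ 2)%:E)%E ->
  (norm2 f < eps%:E)%E.
Proof.
move=> e0; have := sq_ge0 f; rewrite norm2E; case: (sq f) => [r||] //.
rewrite lee_fin lte_fin poweR_EFin lte_fin => r0 re.
by rewrite powR12_sqrt // -(ltr_pXn2r (n:=2)) ?nnegrE ?sqrtr_ge0 ?ltW // sqr_sqrtr.
Qed.

Lemma in_L2P f : in_L2 f <-> cmeas f /\ (sq f < +oo)%E.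
Proof.
split=> [[f1 f2 fn]|[[f1 f2] fn]].
  split=> //; move: fn; rewrite norm2E => /lty_poweRy -> //.
by split=> //; rewrite norm2E poweR_lty.
Qed.

Lemma le_sq f g : cmeas f -> cmeas g -> (forall z, csq (f z) <= csq (g z)) ->
  (sq f <= sq g)%E.
Proof.
move=> mf mg fg; apply: ge0_le_integral => //.
- by move=> z _; rewrite lee_fin csq_ge0.
- exact: measurable_csqE.
- exact: measurable_csqE.
- by move=> z _; rewrite lee_fin.
Qed.

Lemma sqZ c f : cmeas f -> sq (fun z => c * f z) = ((csq c)%:E * sq f)%E.
Proof.
move=> mf; rewrite /sq; under eq_integral do rewrite csqM EFinM.
rewrite ge0_integralZl //; last by rewrite lee_fin csq_ge0.
- exact: measurable_csqE.
- by move=> z _; rewrite lee_fin csq_ge0.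
Qed.

(** The crude factor 2 makes this a pointwise inequality; it replaces the
    triangle inequality of the norm. *)
Lemma sqD_le f g : cmeas f -> cmeas g ->
  (sq (fun z => f z + g z)%R <= 2%:E * sq f + 2%:E * sq g)%E.
Proof.
move=> mf mg; have s2 h : cmeas h -> (2%:E * sq h)%E = (\int[@area R]_z (2 * csq (h z))%:E)%E.
  move=> mh; rewrite /sq -ge0_integralZl //.
  - exact: measurable_csqE.
  - by move=> z _; rewrite lee_fin csq_ge0.
have m2 h : cmeas h -> measurable_fun (setT : set (mR * mR)) (fun z => (2 * csq (h z))%:E).
  move=> /measurable_csq mh; apply/measurable_EFinP.
  by apply: measurable_funM => //; exact: measurable_cst.
have p2 h z : (0 <= (2 * csq (h z))%:E)%E by rewrite lee_fin mulr_ge0 ?csq_ge0.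
rewrite !s2 // -ge0_integralD //; try exact: m2.
apply: ge0_le_integral => //.
- by move=> z _; rewrite lee_fin csq_ge0.
- exact: (measurable_csqE (cmeasD mf mg)).
- by apply: emeasurable_funD; exact: m2.
- by move=> z _; rewrite -EFinD lee_fin csqD_le.
Qed.

End ComplexFunctions.

(** * The inner product *)

Section InnerProduct.
Variable R : realType.
Local Notation C := R[i].
Local Notation Re := complex.Re.
Local Notation Im := complex.Im.
Local Notation area := (@area R).
Implicit Types (f g h : R * R -> C).

Lemma cJM (x y : C) : (x * y)^* = x^* * y^*. Proof. exact: rmorphM. Qed.

Definition cintegrable f : Prop :=
  area.-integrable setT (EFin \o (fun z => Re (f z))) /\
  area.-integrable setT (EFin \o (fun z => Im (f z))).

Lemma cintegralD f g : cintegrable f -> cintegrable g ->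
  cintegral (fun z => f z + g z) = cintegral f + cintegral g.
Proof.
move=> [f1 f2] [g1 g2]; apply: Cext; rewrite ?cReD ?cImD /=.
  rewrite -RintegralD //; apply: eq_Rintegral => z _; exact: cReD.
rewrite -RintegralD //; apply: eq_Rintegral => z _; exact: cImD.
Qed.

Lemma cintegralZ c f : cintegrable f ->
  cintegral (fun z => c * f z) = c * cintegral f.
Proof.
move=> [f1 f2].
have iZ (a : R) (u : R * R -> R) : area.-integrable setT (EFin \o u) ->
    area.-integrable setT (EFin \o (fun z => a * u z)).
  by move=> iu; exact: eq_integrable (integrableZl measurableT a iu).
apply: Cext; rewrite ?cReM ?cImM /=.
  rewrite -!RintegralZl // -RintegralB //; try exact: iZ.
  apply: eq_Rintegral => z _; exact: cReM.
rewrite -!RintegralZl // -RintegralD //; try exact: iZ.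
apply: eq_Rintegral => z _; exact: cImM.
Qed.

Lemma cintegralJ f : cintegral (fun z => (f z)^*) = (cintegral f)^*.
Proof.
apply: Cext; rewrite ?cReJ ?cImJ /=.
  by apply: eq_Rintegral => z _; exact: cReJ.
rewrite /Rintegral; under eq_integral do rewrite cImJ EFinN.
rewrite integralE [in RHS]integralE funeposN funenegN.
by do 2 case: (integral _ _ _) => [?||] //=; rewrite ?oppr0 // opprB.
Qed.

Lemma eq_cintegral f g : f =1 g -> cintegral f = cintegral g.
Proof. by move=> /funext ->. Qed.

(** The integrand is bounded pointwise by the sum of the squared moduli. *)
Lemma cintegrable_mul f g : in_L2 f -> in_L2 g -> cintegrable (fun z => f z * g z).
Proof.
move=> /in_L2P[mf sf] /in_L2P[mg sg].
have [m1 m2] := cmeasM mf mg.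
have ib : area.-integrable setT (EFin \o (fun z => csq (f z) + csq (g z))).
  have i1 h : cmeas h -> (sq h < +oo)%E -> area.-integrable setT (EFin \o (fun z => csq (h z))).
    move=> mh sh; apply/integrableP; split; first exact: measurable_csqE.
    rewrite (_ : integral _ _ _ = sq h) //; apply: eq_integral => z _ /=.
    by rewrite ger0_norm ?csq_ge0.
  exact: eq_integrable (integrableD measurableT (i1 _ mf sf) (i1 _ mg sg)).
have s0 z : 0 <= csq (f z) + csq (g z) by exact: addr_ge0 (csq_ge0 _) (csq_ge0 _).
split.
  apply: le_integrable ib => //; first exact/measurable_EFinP.
  move=> z _ /=; rewrite lee_fin (ger0_norm (s0 z)).
  case: (f z) (g z) => [a b] [c d]; rewrite /csq /= ler_norml.
  have := sqr_ge0 (a - c); have := sqr_ge0 (a + c).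
  have := sqr_ge0 (b - d); have := sqr_ge0 (b + d).
  by move=> *; apply/andP; split; nra.
apply: le_integrable ib => //; first exact/measurable_EFinP.
move=> z _ /=; rewrite lee_fin (ger0_norm (s0 z)).
case: (f z) (g z) => [a b] [c d]; rewrite /csq /= ler_norml.
have := sqr_ge0 (a - d); have := sqr_ge0 (a + d).
have := sqr_ge0 (b - c); have := sqr_ge0 (b + c).
by move=> *; apply/andP; split; nra.
Qed.

Lemma in_L2J f : in_L2 f -> in_L2 (fun z => (f z)^*).
Proof.
move=> /in_L2P[mf sf]; apply/in_L2P; split; first exact: cmeasJ.
by rewrite /sq; under eq_integral do rewrite csqJ.
Qed.

Lemma in_L2D f g : in_L2 f -> in_L2 g -> in_L2 (fun z => f z + g z).
Proof.
move=> /in_L2P[mf sf] /in_L2P[mg sg]; apply/in_L2P; split; first exact: cmeasD.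
by apply: le_lt_trans (sqD_le mf mg) _; rewrite lte_add_pinfty // lte_mul_pinfty.
Qed.

Lemma in_L2Z c f : in_L2 f -> in_L2 (fun z => c * f z).
Proof.
move=> /in_L2P[mf sf]; apply/in_L2P; split.
  by apply: cmeasM => //; exact: cmeas_cst.
by rewrite sqZ // lte_mul_pinfty // lee_fin csq_ge0.
Qed.

Lemma in_L2N f : in_L2 f -> in_L2 (fun z => - f z).
Proof.
by move=> /(in_L2Z (-1)); congr in_L2; apply/funext => z; rewrite mulN1r.
Qed.

Lemma in_L2B f g : in_L2 f -> in_L2 g -> in_L2 (fun z => f z - g z).
Proof. by move=> lf lg; apply: in_L2D => //; exact: in_L2N. Qed.

Lemma in_L2_0 : in_L2 (fun=> 0 : C).
Proof.
apply/in_L2P; split; first exact: cmeas_cst.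
by rewrite /sq; under eq_integral do rewrite csq0; rewrite integral0.
Qed.

Lemma in_L2_sum (I : eqType) (s : seq I) (F : I -> R * R -> C) :
  (forall i, i \in s -> in_L2 (F i)) -> in_L2 (fun z => \sum_(i <- s) F i z).
Proof.
elim: s => [|i s IH] lF; first by under eq_fun do rewrite big_nil; exact: in_L2_0.
under eq_fun do rewrite big_cons; apply: in_L2D; first exact/lF/mem_head.
by apply: IH => j js; apply: lF; rewrite inE js orbT.
Qed.

Lemma cintegrable_inner f g : in_L2 f -> in_L2 g ->
  cintegrable (fun z => f z * (g z)^*).
Proof. by move=> lf lg; apply: cintegrable_mul => //; exact: in_L2J. Qed.

Lemma innerDl f g h : in_L2 f -> in_L2 g -> in_L2 h ->
  inner (fun z => f z + g z) h = inner f h + inner g h.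
Proof.
move=> lf lg lh; rewrite /inner -cintegralD //; try exact: cintegrable_inner.
by apply: eq_cintegral => z; rewrite mulrDl.
Qed.

Lemma innerZl c f g : in_L2 f -> in_L2 g ->
  inner (fun z => c * f z) g = c * inner f g.
Proof.
move=> lf lg; rewrite /inner -cintegralZ //; last exact: cintegrable_inner.
by apply: eq_cintegral => z; rewrite mulrA.
Qed.

Lemma innerC f g : inner g f = (inner f g)^*.
Proof.
rewrite /inner -cintegralJ; apply: eq_cintegral => z.
by rewrite cJM conjCK mulrC.
Qed.

Lemma innerNl f g : in_L2 f -> in_L2 g -> inner (fun z => - f z) g = - inner f g.
Proof.
move=> lf lg; rewrite -[RHS]mulN1r -innerZl //; congr inner.
by apply/funext => z; rewrite mulN1r.
Qed.

Lemma innerZr c f g : in_L2 f -> in_L2 g ->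
  inner f (fun z => c * g z) = c^* * inner f g.
Proof. by move=> lf lg; rewrite innerC innerZl // cJM (innerC g f). Qed.

Lemma inner0l f : inner (fun=> 0) f = 0.
Proof.
by apply: Cext; rewrite /= /Rintegral; under eq_integral do rewrite mul0r /=;
  rewrite integral0.
Qed.

Lemma inner_suml (I : eqType) (s : seq I) (F : I -> R * R -> C) g : in_L2 g ->
  (forall i, i \in s -> in_L2 (F i)) ->
  inner (fun z => \sum_(i <- s) F i z) g = \sum_(i <- s) inner (F i) g.
Proof.
move=> lg; elim: s => [|i s IH] lF.
  by rewrite big_nil -[RHS](inner0l g); congr inner; apply/funext => z; rewrite big_nil.
have lFs j : j \in s -> in_L2 (F j) by move=> js; apply: lF; rewrite inE js orbT.
rewrite big_cons -IH // -innerDl //; last 2 first.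
- exact/lF/mem_head.
- exact: in_L2_sum.
by congr inner; apply/funext => z; rewrite big_cons.
Qed.

(** The squared norm as a real number, for functions of L^2; it agrees with
    [sq] and computes with inner products. *)
Definition n2 f : R := Re (inner f f).

Lemma sqE f : in_L2 f -> sq f = (n2 f)%:E.
Proof.
move=> /in_L2P[mf sf]; rewrite /n2 /inner /= /Rintegral fineK; last first.
  rewrite (_ : integral _ _ _ = sq f) ?ge0_fin_numE ?sq_ge0 //.
  by apply: eq_integral => z _; rewrite -csqE.
by apply: eq_integral => z _; rewrite -csqE.
Qed.

Lemma n2_ge0 f : in_L2 f -> 0 <= n2 f.
Proof. by move=> lf; rewrite -lee_fin -sqE // sq_ge0. Qed.

Lemma inner_self f : inner f f = (n2 f)%:C.
Proof.
apply: Cext => //=; rewrite /Rintegral.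
by under eq_integral do rewrite -csqE; rewrite integral0.
Qed.

Lemma n2B f g : in_L2 f -> in_L2 g ->
  n2 (fun z => f z - g z) = n2 f + n2 g - 2 * Re (inner f g).
Proof.
move=> lf lg; have lg' := in_L2N lg; have lfg := in_L2B lf lg.
rewrite {1}/n2 innerDl // innerNl // (innerC (fun z => f z - g z) f)
  (innerC (fun z => f z - g z) g) !innerDl // !innerNl //.
rewrite (innerC f g) /n2 !(cReD, cReN, cReJ, cImD, cImN, cImJ); ring.
Qed.

Lemma n2D f g : in_L2 f -> in_L2 g ->
  n2 (fun z => f z + g z) = n2 f + n2 g + 2 * Re (inner f g).
Proof.
move=> lf lg; have lg' := in_L2N lg.
have -> : (fun z => f z + g z) = (fun z => f z - (- g z)).
  by apply/funext => z; rewrite opprK.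
rewrite n2B // (innerC (fun z => - g z)) innerNl // {2}/n2 innerNl //.
rewrite (innerC (fun z => - g z) g) innerNl // (innerC f g) /n2.
rewrite !(cReN, cReJ); ring.
Qed.

End InnerProduct.

(** * Areas under linear maps *)

Section ChangeOfVariables.
Variable R : realType.
Local Notation mR := (measurableTypeR R).
Local Notation area := (@area R).
Local Notation leb := (@lebesgue_measure R).

Lemma measurable_affine (a t : R) :
  measurable_fun (setT : set mR) (fun x => a * x + t : mR).
Proof.
by apply: measurable_funD => //; apply: measurable_funM => //; exact: measurable_cst.
Qed.

Lemma lebesgue_affine (a t : R) (S : set R) : 0 < a -> measurable (S : set mR) ->
  leb ((fun x => a * x + t) @^-1` S) = ((a^-1)%:E * leb S)%E.
Proof.
move=> a0 mS; have mT := measurable_affine a t.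
have a1 : 0 <= a by exact: ltW.
pose k : {nonneg R} := NngNum a1.
pose m : {measure set mR -> \bar R} :=
  mscale k (pushforward leb (fun x => a * x + t : mR)).
have e : leb S = m mT S.
  apply: lebesgue_measure_unique => //= _ [[b c]] _ <-.
  rewrite /mscale /= /pushforward.
  rewrite (_ : _ @^-1` _ = `](b - t) / a, (c - t) / a]%classic); last first.
    apply/seteqP; split=> x /=; rewrite !in_itv /= => /andP[];
      rewrite ?ltr_pdivrMr ?ler_pdivlMr // => h1 h2; apply/andP; split;
      move: h1 h2; rewrite (mulrC a); lra.
  rewrite !lebesgue_measure_itv /= !lte_fin ltr_pM2r ?invr_gt0 // ltrD2r.
  case: ifP => _; last by rewrite mule0.
  by rewrite -!EFinB -EFinM; congr EFin; field; lra.
by rewrite e /= /mscale /= muleA -EFinM mulVf ?gt_eqF // mul1e.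
Qed.

Definition lin4 (a b c d : R) (z : R * R) : R * R :=
  (a * z.1 + b * z.2, c * z.1 + d * z.2).

Lemma measurable_lin4 a b c d :
  measurable_fun (setT : set (mR * mR)) (lin4 a b c d : mR * mR -> mR * mR).
Proof.
apply: measurable_fun_pair => /=; apply: measurable_funD;
 apply: measurable_funM => //; exact: measurable_cst.
Qed.

Lemma measurable_lin4_preimage a b c d (S : set (R * R)) :
  measurable (S : set (mR * mR)) ->
  measurable ((lin4 a b c d @^-1` S) : set (mR * mR)).
Proof. by move=> mS; rewrite -[X in measurable X]setTI; exact: measurable_lin4. Qed.

(** A linear map divides areas by its determinant under inverse image; stated
    for a matrix at a time so that it can be transported along products of
    matrices. *)
Definition area_scaling (a b c d : R) : Prop := forall S : set (R * R),
  measurable (S : set (mR * mR)) ->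
  area (lin4 a b c d @^-1` S) = ((`|a * d - b * c|^-1)%:E * area S)%E.

Lemma area_scaling_mul a b c d a' b' c' d' : area_scaling a b c d -> area_scaling a' b' c' d' ->
  area_scaling (a * a' + b * c') (a * b' + b * d') (c * a' + d * c') (c * b' + d * d').
Proof.
move=> g g' S mS.
rewrite (_ : _ @^-1` S = lin4 a' b' c' d' @^-1` (lin4 a b c d @^-1` S)); last first.
  apply/seteqP; split=> z; rewrite /lin4 /=; move: z => [x y] /=;
  by congr S; congr pair; ring.
rewrite g'; last exact: measurable_lin4_preimage.
rewrite g // muleA -EFinM -invfM -normrM; congr (_^-1%:E * _)%E; congr `|_|; ring.
Qed.

(** The uniqueness of the product measure reduces area formulas to rectangles. *)
Lemma area_eq_pushforward a b c d (k : R) (k0 : 0 <= k) :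
  (forall A B : set R, measurable (A : set mR) -> measurable (B : set mR) ->
    (k%:E * area (lin4 a b c d @^-1` (A `*` B)) = leb A * leb B)%E) ->
  forall S : set (R * R), measurable (S : set (mR * mR)) ->
  area S = (k%:E * area (lin4 a b c d @^-1` S))%E.
Proof.
move=> h S mS; have mT := measurable_lin4 a b c d.
pose m : {measure set (mR * mR) -> \bar R} :=
  mscale (NngNum k0) (pushforward area (lin4 a b c d : mR * mR -> mR * mR)).
exact: (product_measure_unique (m' := m mT)).
Qed.

Lemma area_rect (A B : set R) : measurable (A : set mR) -> measurable (B : set mR) ->
  area (A `*` B) = (leb A * leb B)%E.
Proof. by move=> mA mB; exact: product_measure1E. Qed.

Lemma area_scaling_diag a d : 0 < a -> 0 < d -> area_scaling a 0 0 d.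
Proof.
move=> a0 d0 S mS; rewrite mulr0 subr0 gtr0_norm ?mulr_gt0 //.
have ad0 : 0 <= a * d by rewrite mulr_ge0 ?ltW.
rewrite [area S](area_eq_pushforward (a := a) (b := 0) (c := 0) (d := d) ad0) //.
  by rewrite muleA -EFinM mulVf ?mul1e // gt_eqF ?mulr_gt0.
move=> A B mA mB.
rewrite (_ : _ @^-1` _ = ((fun x => a * x + 0) @^-1` A) `*` ((fun x => d * x + 0) @^-1` B)).
  rewrite area_rect; last 2 first.
  - by rewrite -[X in measurable X]setTI; exact: measurable_affine.
  - by rewrite -[X in measurable X]setTI; exact: measurable_affine.
  rewrite !lebesgue_affine // EFinM muleACA.
  by rewrite (muleA a%:E) (muleA d%:E) -!EFinM !mulfV ?gt_eqF // !mul1e.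
by apply/seteqP; split=> -[x y] /=; rewrite /lin4 /= !addr0 !mul0r addr0 add0r.
Qed.

Lemma area_scaling_swap : area_scaling 0 1 1 0.
Proof.
move=> S mS; rewrite mulr0 mulr1 sub0r normrN normr1 invr1 mul1e.
rewrite [RHS](area_eq_pushforward (a := 0) (b := 1) (c := 1) (d := 0) ler01) ?mul1e //.
move=> A B mA mB; rewrite mul1e.
rewrite (_ : _ @^-1` _ = B `*` A); first by rewrite area_rect // muleC.
by apply/seteqP; split=> -[x y] /=; rewrite /lin4 /= !mul0r !mul1r addr0 add0r => -[].
Qed.

Lemma area_scaling_neg : area_scaling (-1) 0 0 1.
Proof.
move=> S mS; rewrite mulN1r mulr0 subr0 normrN normr1 invr1 mul1e.
rewrite [RHS](area_eq_pushforward (a := -1) (b := 0) (c := 0) (d := 1) ler01) ?mul1e //.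
move=> A B mA mB; rewrite mul1e.
rewrite (_ : _ @^-1` _ = (-%R @^-1` A) `*` B).
  rewrite area_rect // -1?(lebesgue_measureN mA) //.
  by rewrite -[X in measurable X]setTI; exact: oppr_measurable.
by apply/seteqP; split=> -[x y] /=; rewrite /lin4 /= !mul0r !mul1r addr0 add0r mulN1r => -[].
Qed.

(** A shear translates every vertical section. *)
Lemma area_scaling_shear c : area_scaling 1 0 c 1.
Proof.
move=> S mS; rewrite mulr1 mul0r subr0 normr1 invr1 mul1e.
have mT := measurable_lin4_preimage 1 0 c 1 mS.
rewrite /Defs.area /product_measure1 /=; apply: eq_integral => x _ /=.
have mX : measurable (xsection S x : set mR) by exact: measurable_xsection.
have -> : xsection (lin4 1 0 c 1 @^-1` S) x = (fun y => 1 * y + c * x) @^-1` (xsection S x).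
  apply/seteqP; split=> y; rewrite /xsection /= !inE /= /lin4 /=;
  by rewrite !mul1r mul0r addr0 addrC.
by rewrite lebesgue_affine // invr1 mul1e.
Qed.

Lemma area_scaling_diagn a d : a != 0 -> d != 0 -> area_scaling a 0 0 d.
Proof.
have neg1 a' d' : area_scaling a' 0 0 d' -> area_scaling (- a') 0 0 d'.
  move=> g; have := area_scaling_mul area_scaling_neg g.
  by rewrite !(mulN1r, mul0r, mul1r, add0r, addr0, oppr0).
have swap a' d' : area_scaling a' 0 0 d' -> area_scaling d' 0 0 a'.
  move=> g; have := area_scaling_mul area_scaling_swap (area_scaling_mul g area_scaling_swap).
  by rewrite !(mulr0, mulr1, mul0r, mul1r, add0r, addr0).
have pos a' d' : 0 < a' -> d' != 0 -> area_scaling a' 0 0 d'.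
  move=> a0; case: (ltgtP d' 0) => // d0 _; last exact: area_scaling_diag.
  by apply: swap; rewrite -[d']opprK; apply: neg1; apply: area_scaling_diag => //; lra.
case: (ltgtP a 0) => // a0 _ d0; last exact: pos.
by rewrite -[a]opprK; apply: neg1; apply: pos => //; lra.
Qed.

(** Elimination: a matrix with nonzero upper left entry is the product of a
    lower shear, a diagonal matrix and an upper shear; otherwise the rows are
    swapped first. *)
Lemma area_scaling_all a b c d : a * d - b * c != 0 -> area_scaling a b c d.
Proof.
have ushear e : area_scaling 1 e 0 1.
  have := area_scaling_mul area_scaling_swap (area_scaling_mul (area_scaling_shear e) area_scaling_swap).
  by rewrite !(mulr0, mulr1, mul0r, mul1r, add0r, addr0).
have main a' b' c' d' : a' != 0 -> a' * d' - b' * c' != 0 -> area_scaling a' b' c' d'.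
  move=> a0 D0.
  have e0 : (a' * d' - b' * c') / a' != 0 by rewrite mulf_neq0 ?invr_neq0.
  have := area_scaling_mul (area_scaling_shear (c' / a')) (area_scaling_mul (area_scaling_diagn a0 e0) (ushear (b' / a'))).
  rewrite !(mulr0, mulr1, mul0r, mul1r, add0r, addr0).
  rewrite (_ : a' * (b' / a') = b'); last by field.
  rewrite (_ : c' / a' * a' = c'); last by field.
  by rewrite (_ : c' / a' * b' + _ = d'); last by field.
move=> D0; have [a0|a0] := eqVneq a 0; last exact: main.
have := area_scaling_mul area_scaling_swap (main c d a b _ _).
rewrite !(mul0r, mul1r, add0r, addr0); apply.
- by apply: contra D0 => /eqP ->; rewrite a0 mul0r mulr0 subrr.
- by apply: contra D0 => /eqP e; rewrite -oppr_eq0 opprB (mulrC b) (mulrC a) e.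
Qed.

Lemma area_shift (v : R * R) (S : set (R * R)) : measurable (S : set (mR * mR)) ->
  area ((fun z => z + v) @^-1` S) = area S.
Proof.
move=> mS; have mT : measurable_fun (setT : set (mR * mR))
    ((fun z : R * R => z + v) : mR * mR -> mR * mR).
  by apply: measurable_fun_pair => /=; apply: measurable_funD => //; exact: measurable_cst.
pose m : {measure set (mR * mR) -> \bar R} :=
  pushforward area ((fun z : R * R => z + v) : mR * mR -> mR * mR).
apply/esym; apply: (product_measure_unique (m' := m mT)) => // A B mA mB.
rewrite /m /= /pushforward.
rewrite (_ : _ @^-1` _ = ((fun x => 1 * x + v.1) @^-1` A) `*` ((fun x => 1 * x + v.2) @^-1` B)).
  rewrite area_rect; last 2 first.
  - by rewrite -[X in measurable X]setTI; exact: measurable_affine.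
  - by rewrite -[X in measurable X]setTI; exact: measurable_affine.
  by rewrite !lebesgue_affine // invr1 !mul1e.
by apply/seteqP; split=> -[x y] /=; rewrite !mul1r.
Qed.

End ChangeOfVariables.

(** * Integrals under linear maps *)

Section IntegralChange.
Variable R : realType.
Local Notation mR := (measurableTypeR R).
Local Notation area := (@area R).
Local Notation C := R[i].

(** The image measure of [area] under [T] is a multiple of [area]. *)
Lemma ge0_integral_scale_measure (T : R * R -> R * R) (k : R) (k0 : 0 <= k)
    (mT : measurable_fun (setT : set (mR * mR)) (T : mR * mR -> mR * mR))
    (u : R * R -> \bar R) :
  (forall S, measurable (S : set (mR * mR)) -> area (T @^-1` S) = (k%:E * area S)%E) ->
  measurable_fun (setT : set (mR * mR)) u -> (forall z, (0 <= u z)%E) ->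
  (\int[area]_z u (T z) = k%:E * \int[area]_z u z)%E.
Proof.
move=> hT mu u0.
have := ge0_integral_pushforward mT area measurableT mu (fun z _ => u0 z).
rewrite preimage_setT /= => <-.
pose k' := NngNum k0.
transitivity (\int[mscale k' area]_z u z)%E.
  by apply: eq_measure_integral => S mS _ /=; rewrite /pushforward /mscale /= hT.
exact: ge0_integral_mscale.
Qed.

Lemma ge0_integral_lin4 a b c d (u : R * R -> \bar R) : a * d - b * c != 0 ->
  measurable_fun (setT : set (mR * mR)) u -> (forall z, (0 <= u z)%E) ->
  (\int[area]_z u (lin4 a b c d z) = (`|a * d - b * c|^-1)%:E * \int[area]_z u z)%E.
Proof.
move=> D0; apply: ge0_integral_scale_measure; first by rewrite invr_ge0.
- exact: measurable_lin4.
- by move=> S mS; exact: area_scaling_all.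
Qed.

Lemma measurable_shift (v : R * R) :
  measurable_fun (setT : set (mR * mR)) ((fun z : R * R => z + v) : mR * mR -> mR * mR).
Proof.
by apply: measurable_fun_pair => /=; apply: measurable_funD => //; exact: measurable_cst.
Qed.

Lemma ge0_integral_shift v (u : R * R -> \bar R) :
  measurable_fun (setT : set (mR * mR)) u -> (forall z, (0 <= u z)%E) ->
  (\int[area]_z u (z + v)%R = \int[area]_z u z)%E.
Proof.
move=> mu u0; rewrite (ge0_integral_scale_measure (k := 1) (T := fun z => z + v)) ?mul1e //.
- exact: measurable_shift.
- by move=> S mS; rewrite mul1e area_shift.
Qed.

Lemma Rintegral_scale_measure (T : R * R -> R * R) (k : R) (k0 : 0 < k)
    (u : R * R -> R) :
  (forall u : R * R -> \bar R, measurable_fun (setT : set (mR * mR)) u ->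
     (forall z, (0 <= u z)%E) ->
  (\int[area]_z u (T z) = k%:E * \int[area]_z u z)%E) ->
  measurable_fun (setT : set (mR * mR)) u ->
  \int[area]_z u (T z) = k * \int[area]_z u z.
Proof.
move=> hT mu; rewrite /Rintegral integralE [in RHS]integralE.
have mE : measurable_fun (setT : set (mR * mR)) (fun z => (u z)%:E) by exact/measurable_EFinP.
have -> : (\int[area]_x (fun z => (u (T z))%:E)^\+ x = k%:E * \int[area]_x (fun z => (u z)%:E)^\+ x)%E.
  by rewrite -hT; [apply: eq_integral => z _; rewrite !funeposE|exact: measurable_funepos mE|].
have -> : (\int[area]_x (fun z => (u (T z))%:E)^\- x = k%:E * \int[area]_x (fun z => (u z)%:E)^\- x)%E.
  by rewrite -hT; [apply: eq_integral => z _; rewrite !funenegE|exact: measurable_funeneg mE|].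
set P := integral _ _ _; set N := (\int[area]_x (_^\- x))%E.
have P0 : (0 <= P)%E by apply: integral_ge0 => z _; exact: funepos_ge0.
have N0 : (0 <= N)%E by apply: integral_ge0 => z _; exact: funeneg_ge0.
case: P N P0 N0 => [p||] [n||] //= _ _; rewrite ?gt0_muley ?lte_fin //= ?mulr0 //.
by rewrite mulrBr.
Qed.

Lemma cintegral_lin4 a b c d (f : R * R -> C) : a * d - b * c != 0 -> cmeas f ->
  cintegral (fun z => f (lin4 a b c d z)) = (`|a * d - b * c|^-1)%:C * cintegral f.
Proof.
move=> D0 [m1 m2]; have k0 : 0 < `|a * d - b * c|^-1 by rewrite invr_gt0 normr_gt0.
have h u : measurable_fun (setT : set (mR * mR)) u ->
    (\int[area]_z u (lin4 a b c d z) = `|a * d - b * c|^-1 * \int[area]_z u z).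
  move=> mu; apply: (Rintegral_scale_measure (T := lin4 a b c d) k0) => // *.
  exact: ge0_integral_lin4.
apply: Cext; rewrite ?cReM ?cImM /= !mul0r ?subr0 ?addr0.
  exact: (h _ m1).
exact: (h _ m2).
Qed.

Lemma cintegral_shift v (f : R * R -> C) : cmeas f ->
  cintegral (fun z => f (z + v)) = cintegral f.
Proof.
move=> [m1 m2]; have h u : measurable_fun (setT : set (mR * mR)) u ->
    (\int[area]_z u (z + v) = 1 * \int[area]_z u z).
  move=> mu; apply: (Rintegral_scale_measure (T := fun z => z + v)) => // *.
  by rewrite mul1e; exact: ge0_integral_shift.
apply: Cext; rewrite /= -[RHS]mul1r.
  exact: (h _ m1).
exact: (h _ m2).
Qed.

Lemma sq_lin4 a b c d (f : R * R -> C) : a * d - b * c != 0 -> cmeas f ->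
  sq (fun z => f (lin4 a b c d z)) = ((`|a * d - b * c|^-1)%:E * sq f)%E.
Proof.
move=> D0 mf; rewrite /sq -ge0_integral_lin4 //; first exact: measurable_csqE.
by move=> z; rewrite lee_fin csq_ge0.
Qed.

End IntegralChange.

(** * Exponentials *)

Section Waves.
Variable R : realType.
Local Notation mR := (measurableTypeR R).
Local Notation area := (@area R).
Local Notation C := R[i].

(** The character of the plane with frequency [v]; it is also the kernel of
    the inverse Fourier transform. *)
Definition wave (v xi : R * R) : C :=
  cos (2 * pi * dot v xi) +i* sin (2 * pi * dot v xi).

Lemma waveDl v w xi : wave (v + w) xi = wave v xi * wave w xi.
Proof.
rewrite /wave (_ : _ * dot (v + w) xi = 2 * pi * dot v xi + 2 * pi * dot w xi).
  by apply: Cext; rewrite /= ?cosD ?sinD //; ring.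
by rewrite /dot /=; ring.
Qed.

Lemma wave_sym v xi : wave v xi = wave xi v.
Proof. by rewrite /wave /dot; congr (cos _ +i* sin _); ring. Qed.

Lemma waveDr v xi eta : wave v (xi + eta) = wave v xi * wave v eta.
Proof. by rewrite wave_sym waveDl !(wave_sym v). Qed.

Lemma waveN v xi : wave (- v) xi = (wave v xi)^*.
Proof.
rewrite /wave (_ : _ * dot (- v) xi = - (2 * pi * dot v xi)).
  by apply: Cext; rewrite ?cReJ ?cImJ /= ?cosN ?sinN.
by rewrite /dot /=; ring.
Qed.

Lemma csq_wave v xi : csq (wave v xi) = 1.
Proof. by rewrite /csq /= cos2Dsin2. Qed.

Lemma wave0 xi : wave 0 xi = 1.
Proof.
have d0 : dot 0 xi = 0 by rewrite /dot /= !mul0r addr0.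
by apply: Cext; rewrite /wave d0 mulr0 /= ?cos0 ?sin0.
Qed.

Lemma waveJ v xi : wave v xi * (wave v xi)^* = 1.
Proof. by rewrite -csqE csq_wave. Qed.

Lemma measurable_dot v : measurable_fun (setT : set (mR * mR)) (dot v).
Proof.
by apply: measurable_funD; apply: measurable_funM => //; exact: measurable_cst.
Qed.

Lemma cmeas_wave v : cmeas (wave v).
Proof.
have m1 : measurable_fun (setT : set (mR * mR)) (fun xi => 2 * pi * dot v xi).
  by apply: measurable_funM; [exact: measurable_cst|exact: measurable_dot].
split.
  apply: (measurableT_comp (f := @cos R)) m1.
  by apply: continuous_measurable_fun => x; exact: continuous_cos.
apply: (measurableT_comp (f := @sin R)) m1.
by apply: continuous_measurable_fun => x; exact: continuous_sin.
Qed.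

Definition emb (k : int * int) : R * R := (k.1%:~R, k.2%:~R).

Lemma embD k l : emb (k + l) = emb k + emb l.
Proof. by rewrite /emb /= !intrD. Qed.
Lemma embN k : emb (- k) = - emb k.
Proof. by rewrite /emb /= !intrN. Qed.
Lemma emb0 : emb 0 = 0. Proof. by []. Qed.
Lemma emb_inj : injective emb.
Proof. by move=> [a b] [c d] [] /intr_inj -> /intr_inj ->. Qed.

Lemma cos_2pi_int (n : int) : cos (2 * pi * n%:~R) = 1 :> R.
Proof.
have cosn (m : nat) : cos (2 * pi * m%:R) = 1 :> R.
  elim: m => [|m IH]; first by rewrite mulr0 cos0.
  by rewrite -[m.+1]addn1 natrD mulrDr mulr1 [2 * pi]mulr_natl cosD2pi -[pi *+ 2]mulr_natl.
by case: n => n; [exact: cosn|rewrite NegzE intrN mulrN cosN; exact: cosn].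
Qed.

Lemma sin_2pi_int (n : int) : sin (2 * pi * n%:~R) = 0 :> R.
Proof. by apply: cos1sin0; rewrite cos_2pi_int normr1. Qed.

Lemma wave_emb k l : wave (emb k) (emb l) = 1.
Proof.
rewrite /wave /dot /= -!intrM -intrD; apply: Cext => /=.
  exact: cos_2pi_int.
exact: sin_2pi_int.
Qed.

End Waves.

(** * Closure of the trigonometric polynomials *)

Section TrigClosure.
Variable R : realType.
Local Notation mR := (measurableTypeR R).
Local Notation area := (@area R).
Local Notation C := R[i].
Implicit Types (f g h : R * R -> C) (u v : R * R -> R).

(** Dominated convergence in L^2. *)
Lemma sq_dominated (F : nat -> R * R -> C) (G : R * R -> R) :
  (forall n, cmeas (F n)) -> area.-integrable setT (EFin \o G) ->
  (forall n z, csq (F n z) <= G z) -> (forall z, csq (F n z) @[n --> \oo] --> 0) ->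
  forall eps : R, 0 < eps -> exists n, (sq (F n) < eps%:E)%E.
Proof.
move=> mF iG FG F0 eps e0.
have c : ((fun n => \int[area]_z (csq (F n z))%:E) @ \oo --> \int[area]_z (cst 0 z))%E.
  apply: (@dominated_cvg _ _ _ area _ measurableT (fun n z => (csq (F n z))%:E) (cst 0%E) (EFin \o G)).
  - by move=> n; exact: measurable_csqE.
  - by move=> z _; apply: cvg_EFin; [exact: nearW|exact: F0].
  - by [].
  - exact: iG.
  - by move=> n z _ /=; rewrite lee_fin ger0_norm ?csq_ge0.
rewrite integral0 in c.
have := (c [set x | (x < eps%:E)%E]); case.
  by apply: open_nbhs_nbhs; split; [exact: open_ereal_lt_ereal|rewrite /= lte_fin].
by move=> n _ /(_ n (leqnn n)) ?; exists n.
Qed.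

Definition cbounded f : Prop := exists M : R, forall z, csq (f z) <= M.

Lemma cbounded_pos f : cbounded f -> exists2 M : R, 0 < M & forall z, csq (f z) <= M.
Proof.
move=> [M hM]; exists (`|M| + 1); first by rewrite ltr_wpDl.
by move=> z; rewrite (le_trans (hM z)) // (le_trans (ler_norm M)) // lerDl.
Qed.

Lemma cbounded_cst c : cbounded (fun=> c). Proof. by exists (csq c). Qed.

Lemma cboundedD f g : cbounded f -> cbounded g -> cbounded (fun z => f z + g z).
Proof.
move=> [M hM] [N hN]; exists (2 * M + 2 * N) => z.
by rewrite (le_trans (csqD_le _ _)) // lerD // ler_pM2l.
Qed.

Lemma cboundedM f g : cbounded f -> cbounded g -> cbounded (fun z => f z * g z).
Proof.
move=> [M hM] [N hN]; exists (M * N) => z.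
by rewrite csqM ler_pM // csq_ge0.
Qed.

Lemma cbounded_wave (v : R * R) : cbounded (wave v).
Proof. by exists 1 => z; rewrite csq_wave. Qed.

Lemma cbounded_indic (A : set (R * R)) : cbounded (fun z => (\1_A z : R)%:C).
Proof.
by exists 1 => z; rewrite csq_real indicE; case: (z \in A); rewrite ?expr1n ?expr0n.
Qed.

Lemma sq_mul_le f g (M : R) : 0 <= M -> cmeas f -> cmeas g ->
  (forall z, csq (f z) <= M) -> (sq (fun z => f z * g z)%R <= M%:E * sq g)%E.
Proof.
move=> M0 mf mg fM.
have -> : (M%:E * sq g)%E = sq (fun z => (Num.sqrt M)%:C * g z).
  by rewrite sqZ // csq_real sqr_sqrtr.
apply: le_sq => [||z].
- exact: cmeasM.
- by apply: cmeasM => //; exact: cmeas_cst.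
- by rewrite !csqM csq_real sqr_sqrtr // ler_wpM2r // csq_ge0.
Qed.

(** Trigonometric polynomials are lists of coefficients and frequencies, in
    which a frequency may be repeated: sums and products need no collection of
    terms. *)
Definition trigp (l : seq (C * (int * int))) (z : R * R) : C :=
  \sum_(t <- l) t.1 * wave (emb R t.2) z.

Lemma cmeas_trigp l : cmeas (trigp l).
Proof.
apply: cmeas_sum => t; apply: cmeasM; first exact: cmeas_cst.
exact: cmeas_wave.
Qed.

Lemma cbounded_trigp l : cbounded (trigp l).
Proof.
rewrite /trigp; elim: l => [|t l IH].
  by under eq_fun do rewrite big_nil; exact: cbounded_cst.
under eq_fun do rewrite big_cons; apply: cboundedD => //; apply: cboundedM.
  exact: cbounded_cst.
exact: cbounded_wave.
Qed.

Lemma trigp_cat l l' z : trigp (l ++ l') z = trigp l z + trigp l' z.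
Proof. by rewrite /trigp big_cat. Qed.

Lemma trigp_mul l l' z :
  trigp [seq (s.1 * t.1, s.2 + t.2) | s <- l, t <- l'] z = trigp l z * trigp l' z.
Proof.
rewrite /trigp big_allpairs_dep /= big_distrlr /=.
apply: eq_bigr => s _; apply: eq_bigr => t _.
by rewrite embD waveDl; ring.
Qed.

Definition cut (W : set (R * R)) f : R * R -> C := fun z => (\1_W z : R)%:C * f z.

Lemma cmeas_cut W f : measurable (W : set (mR * mR)) -> cmeas f -> cmeas (cut W f).
Proof. by move=> mW mf; apply: cmeasM => //; exact: cmeas_indic. Qed.

Section OnDomain.
Variable W : set (R * R).
Hypothesis mW : measurable (W : set (mR * mR)).
Hypothesis finW : (area W < +oo)%E.

Local Notation onW := (cut W).

(** Boundedness is part of the definition because it makes these functions an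
    algebra. *)
Definition trig_closed f : Prop := [/\ cmeas f, cbounded f &
  forall eps : R, 0 < eps ->
    exists l, (sq (onW (fun z => f z - trigp l z)%R) < eps%:E)%E].

Lemma cmeas_onW f : cmeas f -> cmeas (onW f).
Proof. exact: cmeas_cut. Qed.

Lemma trig_closed_approx f : cmeas f -> cbounded f ->
  (forall eps : R, 0 < eps -> exists2 g, trig_closed g &
     (sq (onW (fun z => f z - g z)%R) < eps%:E)%E) -> trig_closed f.
Proof.
move=> mf bf h; split=> // eps e0.
have e4 : 0 < eps / 4 by rewrite divr_gt0.
have [g [mg bg /(_ _ e4)[l gl]] fg] := h _ e4; exists l.
rewrite (_ : onW _ = fun z => onW (fun z => f z - g z) z + onW (fun z => g z - trigp l z) z); last first.
  by apply/funext => z; rewrite /cut; ring.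
have mt := cmeas_trigp l.
apply: le_lt_trans (sqD_le _ _) _; try by apply: cmeas_onW; exact: cmeasB.
apply: (@lt_le_trans _ _ (2%:E * (eps / 4)%:E + 2%:E * (eps / 4)%:E)%E).
  by apply: lteD; rewrite lte_pmul2l.
by rewrite -!EFinM -EFinD lee_fin; lra.
Qed.

Lemma trig_closed_trigp l : trig_closed (trigp l).
Proof.
split; [exact: cmeas_trigp|exact: cbounded_trigp|move=> eps e0; exists l].
by rewrite /sq /cut; under eq_integral do rewrite subrr mulr0 csq0; rewrite integral0.
Qed.

Lemma trig_closed_cst c : trig_closed (fun=> c).
Proof.
have := trig_closed_trigp [:: (c, 0)]; congr trig_closed; apply/funext => z.
by rewrite /trigp big_seq1 /= emb0 wave0 mulr1.
Qed.

Lemma trig_closedD f g : trig_closed f -> trig_closed g ->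
  trig_closed (fun z => f z + g z).
Proof.
move=> [mf bf hf] [mg bg hg].
split; [exact: cmeasD|exact: cboundedD|move=> eps e0].
have e4 : 0 < eps / 4 by rewrite divr_gt0.
have [l fl] := hf _ e4; have [l' gl] := hg _ e4; exists (l ++ l').
have mt := cmeas_trigp l; have mt' := cmeas_trigp l'.
rewrite (_ : onW _ = fun z => onW (fun z => f z - trigp l z) z + onW (fun z => g z - trigp l' z) z); last first.
  by apply/funext => z; rewrite /cut trigp_cat; ring.
apply: le_lt_trans (sqD_le _ _) _; try by apply: cmeas_onW; exact: cmeasB.
apply: (@lt_le_trans _ _ (2%:E * (eps / 4)%:E + 2%:E * (eps / 4)%:E)%E).
  by apply: lteD; rewrite lte_pmul2l.
by rewrite -!EFinM -EFinD lee_fin; lra.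
Qed.

(** From f g - p q = f (g - q) + q (f - p): the approximation p of f is chosen
    after q, as its precision depends on the bound of q. *)
Lemma trig_closedM f g : trig_closed f -> trig_closed g ->
  trig_closed (fun z => f z * g z).
Proof.
move=> [mf bf hf] [mg bg hg].
split; [exact: cmeasM|exact: cboundedM|move=> eps e0].
have [M M0 fM] := cbounded_pos bf.
have e1 : 0 < eps / (4 * M) by rewrite divr_gt0 ?mulr_gt0.
have [l' gl] := hg _ e1.
have [K K0 tK] := cbounded_pos (cbounded_trigp l').
have e2 : 0 < eps / (4 * K) by rewrite divr_gt0 ?mulr_gt0.
have [l fl] := hf _ e2.
exists [seq (s.1 * t.1, s.2 + t.2) | s <- l, t <- l'].
have mt := cmeas_trigp l; have mt' := cmeas_trigp l'.
rewrite (_ : onW _ = fun z => f z * onW (fun z => g z - trigp l' z) z +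
   trigp l' z * onW (fun z => f z - trigp l z) z); last first.
  by apply/funext => z; rewrite /cut trigp_mul; ring.
have m1 := cmeas_onW (cmeasB mg mt'); have m2 := cmeas_onW (cmeasB mf mt).
apply: le_lt_trans (sqD_le (cmeasM mf m1) (cmeasM mt' m2)) _.
have b1 := sq_mul_le (ltW M0) mf m1 fM.
have b2 := sq_mul_le (ltW K0) mt' m2 tK.
apply: (@lt_le_trans _ _ (2%:E * (M%:E * (eps / (4 * M))%:E) + 2%:E * (K%:E * (eps / (4 * K))%:E))%E).
  apply: lteD; rewrite lte_pmul2l //.
    by apply: le_lt_trans b1 _; rewrite lte_pmul2l.
  by apply: le_lt_trans b2 _; rewrite lte_pmul2l.
rewrite -!EFinM -EFinD lee_fin (_ : _ + _ = eps) //; field.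
by rewrite !gt_eqF.
Qed.

Lemma integrable_cstW (M : R) : area.-integrable setT (EFin \o (fun z => M * \1_W z)).
Proof.
have i1 : area.-integrable setT (EFin \o \1_W).
  apply/integrableP; split; first exact/measurable_EFinP/measurable_indic.
  under eq_integral do rewrite /= ger0_norm //.
  by rewrite integral_indic ?setIT.
exact: eq_integrable (integrableZl measurableT M i1).
Qed.

Lemma trig_closed_lim (F : nat -> R * R -> C) f (M : R) :
  (forall n, trig_closed (F n)) -> cmeas f ->
  (forall n z, csq (F n z) <= M) -> (forall z, csq (f z) <= M) ->
  (forall z, csq (f z - F n z) @[n --> \oo] --> 0) -> trig_closed f.
Proof.
move=> tF mf FM fM Ff; apply: trig_closed_approx => //; first by exists M.
move=> eps e0.
have [n nl] : exists n, (sq (onW (fun z => f z - F n z)%R) < eps%:E)%E.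
  apply: (sq_dominated (F := fun n => onW (fun z => f z - F n z)%R)) (integrable_cstW (4 * M)) _ _ _ e0.
  - by move=> n; apply: cmeas_onW; apply: cmeasB => //; case: (tF n).
  - move=> n z; rewrite /cut csqM csq_real indicE; case: (z \in W); last by rewrite expr0n mulr0 mul0r.
    rewrite expr1n mul1r mulr1 (le_trans (csqD_le _ _)) // csqN.
    have := fM z; have := FM n z; lra.
  - move=> z; have Fz := Ff z; rewrite /cut indicE; case: (z \in W) => /=.
      by under eq_fun do rewrite mul1r.
    by under eq_fun do rewrite mul0r csq0; exact: cvg_cst.
by exists (F n).
Qed.

End OnDomain.
End TrigClosure.

(** * Real functions and sets in the closure *)

Section TrigDense.
Variable R : realType.
Local Notation mR := (measurableTypeR R).
Local Notation area := (@area R).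
Local Notation C := R[i].
Implicit Types (f g h : R * R -> C) (u v q : R * R -> R).
Variable W : set (R * R).
Hypothesis mW : measurable (W : set (mR * mR)).
Hypothesis finW : (area W < +oo)%E.

(** Real functions, because the arguments below use the order: absolute
    values, positive parts and indicator functions. *)
Definition rclosed u : Prop := trig_closed W (fun z => (u z)%:C).

Lemma rclosed_meas u : rclosed u -> measurable_fun (setT : set (mR * mR)) u.
Proof. by case=> -[]. Qed.

Lemma rclosed_cst c : rclosed (fun=> c).
Proof. exact: trig_closed_cst. Qed.

Lemma rclosedD u v : rclosed u -> rclosed v -> rclosed (fun z => u z + v z).
Proof.
move=> cu cv; have := trig_closedD mW cu cv; congr trig_closed.
by apply/funext => z; apply: Cext; rewrite /= ?addr0.
Qed.

Lemma rclosedM u v : rclosed u -> rclosed v -> rclosed (fun z => u z * v z).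
Proof.
move=> cu cv; have := trig_closedM mW cu cv; congr trig_closed.
by apply/funext => z; apply: Cext; rewrite /= ?mul0r ?mulr0 ?subr0 ?addr0.
Qed.

Lemma rclosedZ c u : rclosed u -> rclosed (fun z => c * u z).
Proof. by move=> cu; exact: (rclosedM (rclosed_cst c)). Qed.

Lemma rclosedN u : rclosed u -> rclosed (fun z => - u z).
Proof.
by move=> /(rclosedZ (-1)); congr rclosed; apply/funext => z; rewrite mulN1r.
Qed.

Lemma rclosedB u v : rclosed u -> rclosed v -> rclosed (fun z => u z - v z).
Proof. by move=> cu cv; apply: rclosedD => //; exact: rclosedN. Qed.

Lemma rclosedX u n : rclosed u -> rclosed (fun z => u z ^+ n).
Proof.
move=> cu; elim: n => [|n IH]; first exact: rclosed_cst.
by under eq_fun do rewrite exprS; exact: rclosedM.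
Qed.

Lemma rclosed_lim (F : nat -> R * R -> R) u :
  (forall n, rclosed (F n)) -> (forall n z, `|F n z| <= 1) ->
  (forall z, F n z @[n --> \oo] --> u z) -> rclosed u.
Proof.
move=> cF F1 Fu.
have u1 z : `|u z| <= 1.
  rewrite ler_norml -(cvg_lim _ (Fu z)) //; apply/andP; split.
    by apply: limr_ge; [exact: cvgP (Fu z)|]; apply: nearW => n; case/ler_normlP: (F1 n z); lra.
  by apply: limr_le; [exact: cvgP (Fu z)|]; apply: nearW => n; case/ler_normlP: (F1 n z); lra.
have sq1 (x : R) : `|x| <= 1 -> csq x%:C <= 1.
  by move=> x1; rewrite csq_real -real_normK ?num_real // expr_le1.
apply: (trig_closed_lim mW finW (F := fun n z => (F n z)%:C) (M := 1)) => //.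
- apply: cmeas_real; apply: (measurable_fun_cvg (h := F)) => //.
    by move=> n; exact: rclosed_meas.
- by move=> n z; exact: sq1.
- by move=> z; exact: sq1.
- move=> z; have -> : (fun n => csq ((u z)%:C - (F n z)%:C)) = (fun n => (u z - F n z) * (u z - F n z)).
    by apply/funext => n; rewrite /csq /=; ring.
  have c0 : u z - F n z @[n --> \oo] --> (0 : R).
    by rewrite -(subrr (u z)); exact: cvgB (cvg_cst _) (Fu z).
  by rewrite -(mulr0 0); exact: (cvgM c0 c0).
Qed.

(** For |x| <= 1 this polynomial iteration increases to |x|; it stands in for
    the Weierstrass approximation of the absolute value. *)
Fixpoint abs_iter (x : R) (n : nat) : R :=
  if n is m.+1 then abs_iter x m + (x ^+ 2 - abs_iter x m ^+ 2) / 2 else 0.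

(** With a = |x|, the error satisfies a - s' = (a - s) (1 - (a + s) / 2). *)
Lemma abs_iter_bound x n : `|x| <= 1 ->
  0 <= abs_iter x n /\ abs_iter x n <= `|x| /\
  `|x| - abs_iter x n <= `|x| * (1 - `|x| / 2) ^+ n.
Proof.
move=> x1; have x0 := normr_ge0 x.
elim: n => [|n [s0 [sx e]]] /=; first by rewrite expr0 mulr1 subr0 lexx.
rewrite -(real_normK (num_real x)).
set s := abs_iter x n in s0 sx e *; set a := `|x| in x0 x1 sx e *.
split; first by nra.
split; first by nra.
have -> : a - (s + (a ^+ 2 - s ^+ 2) / 2) = (a - s) * (1 - (a + s) / 2) by field.
rewrite exprSr mulrA; apply: (@le_trans _ _ ((a - s) * (1 - a / 2))).
  by rewrite ler_wpM2l //; lra.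
by rewrite ler_wpM2r //; lra.
Qed.

Lemma abs_iter_cvg x : `|x| <= 1 -> abs_iter x n @[n --> \oo] --> `|x|.
Proof.
move=> x1; have x0 := normr_ge0 x.
apply: (squeeze_cvgr (f := fun n => `|x| - `|x| * (1 - `|x| / 2) ^+ n) (h := fun=> `|x|)).
- by apply: nearW => n; have [_ [-> e]] := abs_iter_bound n x1; rewrite andbT; lra.
- have [->|xn] := eqVneq x 0.
    by rewrite normr0; under eq_fun do rewrite mul0r subr0; exact: cvg_cst.
  have xp : 0 < `|x| by rewrite normr_gt0.
  rewrite -[X in _ --> X]subr0; apply: cvgB; first exact: cvg_cst.
  by apply: cvg_geometric; rewrite ger0_norm; lra.
- exact: cvg_cst.
Qed.

Lemma rclosed_abs q : rclosed q -> (forall z, `|q z| <= 1) -> rclosed (fun z => `|q z|).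
Proof.
move=> cq q1; apply: (rclosed_lim (F := fun n z => abs_iter (q z) n)).
- elim=> [|n IH] /=; first exact: rclosed_cst.
  apply: rclosedD => //; under eq_fun do rewrite mulrC; apply: rclosedZ.
  by apply: rclosedB; exact: rclosedX.
- move=> n z; have [s0 [s1 _]] := abs_iter_bound n (q1 z).
  by rewrite ger0_norm // (le_trans s1).
- by move=> z; exact: abs_iter_cvg.
Qed.

(** Let p be the positive part of q: the powers (1 - p)^n decrease to the
    indicator function of the set where q <= 0. *)
Lemma rclosed_pos q : rclosed q -> (forall z, `|q z| <= 1) ->
  rclosed (\1_[set z | 0 < q z]).
Proof.
move=> cq q1.
pose p z := (q z + `|q z|) / 2.
have cp : rclosed p.
  rewrite /p; under eq_fun do rewrite mulrC; apply: rclosedZ; apply: rclosedD => //.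
  exact: rclosed_abs.
have p01 z : 0 <= p z <= 1.
  have := q1 z; have := ler_norm (q z); have := ler_norm (- q z); rewrite normrN /p; lra.
apply: (rclosed_lim (F := fun n z => 1 - (1 - p z) ^+ n)).
- by move=> n; apply: rclosedB; [exact: rclosed_cst|apply: rclosedX; apply: rclosedB => //; exact: rclosed_cst].
- move=> n z; have /andP[a b] := p01 z.
  have : 0 <= (1 - p z) ^+ n by rewrite exprn_ge0 //; lra.
  have : (1 - p z) ^+ n <= 1 by rewrite exprn_ile1 //; lra.
  by rewrite ler_norml; lra.
- move=> z; have /andP[a b] := p01 z; rewrite indicE.
  have [qz|qz] := ltP 0 (q z).
    rewrite mem_set //= -[X in _ --> X]subr0; apply: cvgB; first exact: cvg_cst.
    have pz : 0 < p z by rewrite /p gtr0_norm //; lra.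
    by apply: cvg_expr; rewrite ger0_norm; lra.
  rewrite memNset /=; last by apply/negP; rewrite -leNgt.
  have -> : p z = 0 by rewrite /p ler0_norm //; lra.
  under eq_fun do rewrite subr0 expr1n subrr; exact: cvg_cst.
Qed.

Definition mclosed (A : set (R * R)) : Prop :=
  measurable (A : set (mR * mR)) /\ rclosed (\1_A).

Lemma mclosed_pos q : rclosed q -> (forall z, `|q z| <= 1) ->
  mclosed [set z | 0 < q z].
Proof.
move=> cq q1; split; last exact: rclosed_pos.
apply/measurable_indicP; exact: rclosed_meas (rclosed_pos cq q1).
Qed.

Lemma mclosedC A : mclosed A -> mclosed (~` A).
Proof.
move=> [mA cA]; split; first exact: measurableC.
have := rclosedB (rclosed_cst 1) cA; congr rclosed; apply/funext => z.
by rewrite !indicE in_setC; case: (z \in A); rewrite ?subr0 ?subrr.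
Qed.

Lemma mclosedT : mclosed setT.
Proof.
split; first exact: measurableT.
by have := rclosed_cst 1; congr rclosed; apply/funext => z; rewrite indicE in_setT.
Qed.

Lemma mclosed0 : mclosed set0.
Proof. by rewrite -setCT; exact: mclosedC mclosedT. Qed.

Lemma mclosedI A B : mclosed A -> mclosed B -> mclosed (A `&` B).
Proof.
move=> [mA cA] [mB cB]; split; first exact: measurableI.
have := rclosedM cA cB; congr rclosed; apply/funext => z.
by rewrite !indicE in_setI; case: (z \in A); case: (z \in B); rewrite ?mul0r ?mul1r.
Qed.

Lemma mclosedU A B : mclosed A -> mclosed B -> mclosed (A `|` B).
Proof.
by move=> /mclosedC cA /mclosedC cB; have /mclosedC := mclosedI cA cB; rewrite setCI !setCK.
Qed.

Lemma mclosed_bigcup (A : (set (R * R))^nat) : (forall n, mclosed (A n)) ->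
  mclosed (\bigcup_n A n).
Proof.
move=> cA; split; first by apply: bigcupT_measurable => n; case: (cA n).
have cU n : mclosed (\big[setU/set0]_(i < n) A i).
  elim: n => [|n IH]; first by rewrite big_ord0; exact: mclosed0.
  by rewrite big_ord_recr; exact: mclosedU.
apply: (rclosed_lim (F := fun n => \1_(\big[setU/set0]_(i < n) A i))).
- by move=> n; case: (cU n).
- by move=> n z; rewrite indicE; case: (_ \in _); rewrite ?normr0 ?normr1.
- move=> z; rewrite indicE; have [/set_mem[N _ AN]|zA] := boolP (z \in _).
    apply: cvg_near_cst; exists N.+1 => // n /= Nn; rewrite indicE mem_set //.
    by rewrite -bigcup_mkord; exists N.
  apply: cvg_near_cst; apply: nearW => n; rewrite indicE memNset //.
  rewrite -bigcup_mkord => -[i _ Ai]; move/negP: zA; apply; apply/mem_set.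
  by exists i.
Qed.

(** Closure of the sets under countable unions comes from closure of the
    functions under bounded pointwise limits. *)
Lemma mclosed_sigma : sigma_algebra setT mclosed.
Proof.
split; [exact: mclosed0|move=> A|exact: mclosed_bigcup].
by rewrite setTD; exact: mclosedC.
Qed.

End TrigDense.

(** * Completeness of the exponentials on a packing *)

Section Periodization.
Variable R : realType.
Local Notation mR := (measurableTypeR R).
Local Notation area := (@area R).
Local Notation C := R[i].
Local Notation Re := complex.Re.
Local Notation Im := complex.Im.
Implicit Types (f g h : R * R -> C) (u v q : R * R -> R).
Variable W : set (R * R).
Hypothesis mW : measurable (W : set (mR * mR)).
Hypothesis finW : (area W < +oo)%E.
Local Notation emb := (emb R).

Definition frac (x : R) : R := x - (Num.floor x)%:~R.

Lemma frac_bounds x : 0 <= frac x < 1.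
Proof.
have /andP[] := floor_itv x; rewrite intrD /frac; lra.
Qed.

Lemma rclosed_cos (k : int * int) c :
  rclosed W (fun z => cos (2 * pi * dot (emb k) z - c)).
Proof.
have ck : rclosed W (fun z => cos (2 * pi * dot (emb k) z)).
  have := trig_closed_trigp W [:: ((2^-1)%:C, k); ((2^-1)%:C, - k)]; congr trig_closed.
  apply/funext => z; rewrite /trigp !big_cons big_nil /= embN waveN /wave.
  apply: Cext; rewrite !(cReD, cImD, cReM, cImM, cReJ, cImJ) /=; lra.
have sk : rclosed W (fun z => sin (2 * pi * dot (emb k) z)).
  have := trig_closed_trigp W [:: (0 +i* - 2^-1, k); (0 +i* 2^-1, - k)].
  congr trig_closed.
  apply/funext => z; rewrite /trigp !big_cons big_nil /= embN waveN /wave.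
  apply: Cext; rewrite !(cReD, cImD, cReM, cImM, cReJ, cImJ) /=; lra.
under eq_fun do rewrite cosB; apply: rclosedD => //.
  by under eq_fun do rewrite mulrC; exact: rclosedZ.
by under eq_fun do rewrite mulrC; exact: rclosedZ.
Qed.

Lemma cos_shift_int (x c : R) (n : int) :
  cos (2 * pi * (x + n%:~R) - c) = cos (2 * pi * x - c).
Proof.
rewrite (_ : _ - c = (2 * pi * x - c) + 2 * pi * n%:~R); last by ring.
by rewrite cosD cos_2pi_int sin_2pi_int mulr0 mulr1 subr0.
Qed.

(** On a period the left-hand side is sin (pi (t - a)) sin (pi (1 - t)), which
    has the sign of t - a. *)
Lemma frac_gt_cos (a x : R) : 0 <= a < 1 ->
  (0 < (cos (2 * pi * x - pi * (1 + a)) - cos (pi * (1 - a))) / 2) = (a < frac x).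
Proof.
move=> /andP[a0 a1].
have -> : cos (2 * pi * x - pi * (1 + a)) = cos (2 * pi * frac x - pi * (1 + a)).
  by rewrite -(cos_shift_int (frac x) _ (Num.floor x)) /frac subrK.
have := frac_bounds x; move: (frac x) => t /andP[t0 t1].
have -> : (cos (2 * pi * t - pi * (1 + a)) - cos (pi * (1 - a))) / 2 =
    sin (pi * (t - a)) * sin (pi * (1 - t)).
  have -> : 2 * pi * t - pi * (1 + a) = pi * (t - a) - pi * (1 - t) by ring.
  have -> : pi * (1 - a) = pi * (t - a) + pi * (1 - t) by ring.
  by rewrite cosB cosD; field.
have p0 := pi_gt0 R.
have [at_|ta] := ltP a t.
  by rewrite mulr_gt0 // sin_gt0_pi //; apply/andP; split; nra.
apply/negbTE; rewrite -leNgt mulr_le0_ge0 //.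
  rewrite -oppr_ge0 -sinN; apply: sin_ge0_pi; apply/andP; split; nra.
apply: sin_ge0_pi; apply/andP; split; nra.
Qed.

Lemma mclosed_frac_ray (k : int * int) (a : R) :
  mclosed W [set z | a < frac (dot (emb k) z)].
Proof.
have [a0|a0] := ltP a 0.
  rewrite (_ : [set _ | _] = setT); first exact: mclosedT.
  by apply/seteqP; split=> // z _ /=; case/andP: (frac_bounds (dot (emb k) z)); lra.
have [a1|a1] := ltP a 1; last first.
  rewrite (_ : [set _ | _] = set0); first exact: mclosed0.
  by apply/seteqP; split=> // z /=; case/andP: (frac_bounds (dot (emb k) z)); lra.
pose q z := (cos (2 * pi * dot (emb k) z - pi * (1 + a)) - cos (pi * (1 - a))) / 2.
have -> : [set z | a < frac (dot (emb k) z)] = [set z | 0 < q z].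
  by apply/seteqP; split=> z /=; rewrite frac_gt_cos // a0 a1.
apply: mclosed_pos => //.
  rewrite /q; under eq_fun do rewrite mulrC; apply: rclosedZ => //; apply: rclosedB => //.
    exact: rclosed_cos.
  exact: rclosed_cst.
move=> z; rewrite /q ler_norml; set x := _ - pi * _.
have := cos_le1 x; have := cos_geN1 x.
have := cos_le1 (pi * (1 - a)); have := cos_geN1 (pi * (1 - a)).
by move=> *; apply/andP; split; lra.
Qed.

(** The rays generate the Borel sets. *)
Lemma mclosed_frac (k : int * int) (B : set R) : measurable (B : set mR) ->
  mclosed W [set z | B (frac (dot (emb k) z))].
Proof.
have [s0 sC sU] := mclosed_sigma mW finW.
move=> mB; have {mB} : (@RGenOInfty.G R).-sigma.-measurable B by rewrite -RGenOInfty.measurableE.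
move: B.
apply: (smallest_sub (X := [set B | mclosed W [set z | B (frac (dot (emb k) z))]])).
  split=> /=.
  - exact: s0.
  - by move=> A /sC.
  - by move=> A /sU; congr mclosed; apply/seteqP; split=> z [n _ An]; exists n.
move=> _ [a ->] /=; have := mclosed_frac_ray k a; congr mclosed.
by apply/seteqP; split=> z /=; rewrite in_itv /= andbT.
Qed.

Definition frac2 (z : R * R) : R * R := (frac z.1, frac z.2).

(** This settles all Z^2-periodic Borel sets, whose indicator functions factor
    through the fractional parts of the coordinates. *)
Lemma mclosed_frac2 (B : set (R * R)) : measurable (B : set (mR * mR)) ->
  mclosed W (frac2 @^-1` B).
Proof.
have [s0 sC sU] := mclosed_sigma mW finW.
rewrite measurable_prod_measurableType.
apply: (smallest_sub (X := [set B | mclosed W (frac2 @^-1` B)])).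
  split=> /=.
  - exact: s0.
  - by move=> A /sC.
  - by move=> A /sU; rewrite preimage_bigcup.
move=> _ [A mA [B' mB' <-]] /=.
have := mclosedI mW (mclosed_frac (1, 0) mA) (mclosed_frac (0, 1) mB').
congr mclosed; apply/seteqP; split=> -[x y]; rewrite /dot /= ?mul1r ?mul0r ?addr0 ?add0r;
 by case.
Qed.

Definition packing (W : set (R * R)) : Prop :=
  forall z k, W z -> W (z + emb k) -> k = 0.

Hypothesis packW : packing W.

(** As [W] is a packing, a Borel subset of [W] is the trace on [W] of a
    Z^2-periodic Borel set. *)
Lemma rclosed_indic (B : set (R * R)) : measurable (B : set (mR * mR)) ->
  rclosed W (\1_B).
Proof.
move=> mB.
(* the periodic hull of the part of B in W *)
pose B' := \bigcup_(k in setT) ((fun z => z + emb k) @^-1` (B `&` W)).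
have mB' : measurable (B' : set (mR * mR)).
  apply: countable_bigcupT_measurable => [|k].
    exact: countableP.
  by rewrite -[X in measurable X]setTI; apply: measurable_shift => //; exact: measurableI.
have [mF cF] := mclosed_frac2 mB'.
split; first exact: cmeas_indic.
  exact: cbounded_indic.
move=> eps e0; have [_ _ /(_ _ e0)[l hl]] := cF; exists l.
rewrite (_ : cut W _ = cut W (fun z => (\1_(frac2 @^-1` B') z)%:C - trigp l z)) //.
apply/funext => z; rewrite /cut [\1_W z]indicE.
have [/set_mem Wz|] := boolP (z \in W); last by rewrite !mul0r.
have zE : z = frac2 z + emb (Num.floor z.1, Num.floor z.2).
  by case: z {Wz} => x y; rewrite /frac2 /frac /=; congr pair => /=; rewrite subrK.
rewrite !mul1r; congr (_%:C - _); rewrite !indicE; congr (_%:R); congr nat_of_bool.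
apply/idP/idP => /set_mem h; apply/mem_set.
  by exists (Num.floor z.1, Num.floor z.2) => //=; rewrite -zE.
have [k _ [Bk Wk]] := h.
suff e : z = frac2 z + emb k by rewrite e.
have := packW Wz (k := k - (Num.floor z.1, Num.floor z.2)).
rewrite {1}zE embD embN addrACA subrr addr0 => /(_ Wk) /eqP.
by rewrite subr_eq0 => /eqP ->.
Qed.

(** The binary digits of [u] are indicator functions. *)
Lemma rclosed_dyadic n u : measurable_fun (setT : set (mR * mR)) u ->
  (forall z, 0 <= u z <= 1) ->
  exists2 v, rclosed W v & forall z, `|u z - v z| <= 2^-1 ^+ n.
Proof.
elim: n u => [|n IH] u mu u01.
  exists (fun=> 0); first exact: rclosed_cst.
  by move=> z; rewrite subr0 expr0; have /andP[a b] := u01 z; rewrite ger0_norm.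
pose B := [set z | 2^-1 <= u z].
have mB : measurable (B : set (mR * mR)).
  rewrite (_ : B = u @^-1` `[2^-1, +oo[%classic).
    by rewrite -[X in measurable X]setTI; exact: mu.
  by apply/seteqP; split=> z; rewrite /B /= in_itv /= andbT.
have i01 z : 0 <= 2 * u z - \1_B z <= 1.
  have /andP[a b] := u01 z; rewrite indicE; have [/set_mem|h] := boolP (z \in B).
    by rewrite /B /=; lra.
  have : ~ (2^-1 <= u z) by move=> uz; move/negP: h; apply; exact/mem_set.
  by move=> /negP; rewrite -ltNge /=; lra.
have [|v cv hv] := IH (fun z => 2 * u z - \1_B z) _ i01.
  apply: measurable_funB; last exact: measurable_indic.
  by apply: measurable_funM => //; exact: measurable_cst.
exists (fun z => 2^-1 * (v z + \1_B z)).
  by apply: rclosedZ => //; apply: rclosedD => //; exact: rclosed_indic.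
move=> z; have -> : u z - 2^-1 * (v z + \1_B z) = 2^-1 * (2 * u z - \1_B z - v z) by field.
by rewrite normrM gtr0_norm ?invr_gt0 // exprS ler_wpM2l.
Qed.

Lemma rclosed_all01 u : measurable_fun (setT : set (mR * mR)) u ->
  (forall z, 0 <= u z <= 1) -> rclosed W u.
Proof.
move=> mu u01.
have mF : forall n, {v | rclosed W v & forall z, `|u z - v z| <= 2^-1 ^+ n}.
  by move=> n; apply: cid2; exact: rclosed_dyadic.
have [v cv hv] : exists2 v : nat -> R * R -> R, (forall n, rclosed W (v n)) &
    forall n z, `|u z - v n z| <= 2^-1 ^+ n.
  by exists (fun n => s2val (mF n)) => n; [exact: (s2valP (mF n))|exact: (s2valP' (mF n))].
apply: (trig_closed_lim mW finW (F := fun n z => (v n z)%:C) (M := 4)).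
- exact: cv.
- exact: cmeas_real.
- move=> n z; rewrite csq_real; have /andP[a b] := u01 z.
  have := hv n z; have : 2^-1 ^+ n <= 1 :> R.
    by rewrite exprn_ile1 ?invr_ge0 // invf_le1 // ler1n.
  move: (2^-1 ^+ n) => d d1 /ler_normlP[h1 h2].
  have h3 : `|v n z| <= 2 by rewrite ler_norml; apply/andP; split; lra.
  by rewrite -real_normK ?num_real //; have := normr_ge0 (v n z); nra.
- by move=> z; rewrite csq_real; have /andP[a b] := u01 z; nra.
- move=> z; apply: (squeeze_cvgr (f := fun=> 0) (h := fun n => 2^-1 ^+ n)).
  + apply: nearW => n; rewrite csq_ge0 /=.
    have -> : csq ((u z)%:C - (v n z)%:C) = `|u z - v n z| ^+ 2.
      by rewrite real_normK ?num_real // /csq /=; ring.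
    have h := hv n z; have d1 : 2^-1 ^+ n <= 1 :> R.
      by rewrite exprn_ile1 ?invr_ge0 // invf_le1 // ler1n.
    apply: le_trans h; rewrite expr2 ler_piMr //.
    by apply: le_trans (hv n z) d1.
  + exact: cvg_cst.
  + by apply: cvg_expr; rewrite ger0_norm ?invr_ge0 // invf_lt1 // ltr1n.
Qed.

Lemma rclosed_all u (M : R) : measurable_fun (setT : set (mR * mR)) u ->
  (forall z, `|u z| <= M) -> rclosed W u.
Proof.
move=> mu uM.
have M0 : 0 <= M by exact: le_trans (normr_ge0 (u 0)) (uM 0).
have [e|Mn] := eqVneq M 0.
  have -> : u = fun=> 0 by apply/funext => z; apply/eqP; rewrite -normr_le0 -e.
  exact: rclosed_cst.
have Mp : 0 < M by rewrite lt_neqAle eq_sym Mn.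
have -> : u = fun z => 2 * M * ((u z + M) / (2 * M)) + - M.
  by apply/funext => z; field.
apply: rclosedD => //; last exact: rclosed_cst.
apply: rclosedZ => //; apply: rclosed_all01.
  apply: measurable_funM; last exact: measurable_cst.
  by apply: measurable_funD => //; exact: measurable_cst.
move=> z; have /ler_normlP[h1 h2] := uM z.
by rewrite divr_ge0 ?ler_pdivrMr ?mulr_gt0 //=; lra.
Qed.

(** The real and the imaginary part are treated separately, and scaled into
    [0, 1]. *)
Lemma trig_dense f : cmeas f -> cbounded f -> trig_closed W f.
Proof.
move=> [m1 m2] [M fM].
have -> : f = fun z => (Re (f z))%:C + 'i%C * (Im (f z))%:C.
  by apply/funext => z; case: (f z) => a b; apply: Cext; rewrite /=; ring.
apply: trig_closedD => //.
  apply: (@rclosed_all _ (1 + M)) => // z.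
  by rewrite (le_trans (Re_le_csq _)) // lerD2l.
apply: trig_closedM => //; first exact: trig_closed_cst.
apply: (@rclosed_all _ (1 + M)) => // z.
by rewrite (le_trans (Im_le_csq _)) // lerD2l.
Qed.

End Periodization.

(** * Tiles for the integer translations *)

Lemma int2_enum : exists e : nat -> int * int, bijective e.
Proof.
have inf : ~ finite_set [set: int * int].
  move=> fin; apply: infinite_nat; pose f (n : nat) : int * int := (n%:Z, 0).
  have : finite_set (f @^-1` setT) by apply: finite_preimage => // x y _ _ [].
  by rewrite preimage_setT.
have /pcard_eqP[g] := eq_card_nat (countableP _) inf.
have [e ge eg] := @bijTT _ _ g.
by exists e; exists g.
Qed.

Section Tiles.
Variable R : realType.
Local Notation mR := (measurableTypeR R).
Local Notation area := (@area R).
Local Notation C := R[i].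
Local Notation emb := (emb R).
Implicit Types (f g : R * R -> C) (W : set (R * R)).

Definition tile (W : set (R * R)) : Prop :=
  packing W /\ forall z, exists k, W (z + emb k).

Definition periodic2 (T : Type) (f : R * R -> T) : Prop :=
  forall z k, f (z + emb k) = f z.

Lemma cutE W (f : R * R -> C) z : cut W f z = if z \in W then f z else 0.
Proof. by rewrite /cut indicE; case: (z \in W); rewrite ?mul1r ?mul0r. Qed.

Lemma in_L2_indic W : measurable (W : set (mR * mR)) -> (area W < +oo)%E ->
  in_L2 (fun z => (\1_W z : R)%:C).
Proof.
move=> mW fW; apply/in_L2P; split; first exact: cmeas_indic.
suff -> : sq (fun z => (\1_W z : R)%:C) = (\int[area]_z (\1_W z)%:E)%E.
  by rewrite integral_indic ?setIT.
by apply: eq_integral => z _; rewrite csq_real indicE; case: (z \in W); rewrite ?expr1n ?expr0n.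
Qed.

Lemma in_L2_mulb f g : cmeas f -> cbounded f -> in_L2 g -> in_L2 (fun z => f z * g z).
Proof.
move=> mf bf /in_L2P[mg fg]; have [M M0 fM] := cbounded_pos bf.
apply/in_L2P; split; first exact: cmeasM.
apply: le_lt_trans (sq_mul_le (ltW M0) mf mg fM) _.
by rewrite lte_mul_pinfty // lee_fin ltW.
Qed.

Lemma in_L2_cut W f : measurable (W : set (mR * mR)) -> (area W < +oo)%E ->
  cmeas f -> cbounded f -> in_L2 (cut W f).
Proof.
move=> mW fW mf bf; have := in_L2_mulb mf bf (in_L2_indic mW fW).
by congr in_L2; apply/funext => z; rewrite /cut mulrC.
Qed.

Lemma cintegrable_cut W f : measurable (W : set (mR * mR)) -> (area W < +oo)%E ->
  cmeas f -> cbounded f -> cintegrable (cut W f).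
Proof.
move=> mW fW mf bf.
have := cintegrable_mul (in_L2_indic mW fW) (in_L2_cut mW fW mf bf).
congr cintegrable; apply/funext => z; rewrite cutE indicE.
by case: (z \in W); rewrite ?mul1r ?mul0r.
Qed.

Lemma emb_step z k l : z + emb k + emb (l - k) = z + emb l.
Proof. by rewrite embD embN -addrA [emb k + _]addrC addrNK. Qed.

Section Decomposition.
Variables (e : nat -> int * int) (be : bijective e).

(** The plane is the disjoint union of the integer translates of [W]. *)
Lemma ge0_integral_tile W (u : R * R -> \bar R) :
  measurable (W : set (mR * mR)) -> tile W ->
  measurable_fun (setT : set (mR * mR)) u -> (forall z, (0 <= u z)%E) ->
  (\int[area]_z u z =
   \int[area]_(z in W) (\sum_(n <oo) u (z + emb (- e n))%R))%E.
Proof.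
move=> mW [pW cW] mu u0; have [e' eK e'K] := be.
pose S n := (fun z => z + emb (e n)) @^-1` W.
have mS n : measurable (S n : set (mR * mR)).
  by rewrite -[X in measurable X]setTI; exact: measurable_shift.
have mus n : measurable_fun (setT : set (mR * mR)) (fun z => u (z + emb (- e n))).
  by apply: (measurableT_comp mu); exact: measurable_shift.
have tS : trivIset setT S.
  apply/trivIsetP => n m _ _ nm; rewrite -subset0 => z [] /= Wn Wm.
  have := pW _ (e m - e n) Wn; rewrite emb_step => /(_ Wm) /eqP; rewrite subr_eq0.
  by move=> /eqP /(can_inj eK) mn; rewrite mn eqxx in nm.
have cS : \bigcup_n S n = setT.
  apply/seteqP; split=> // z _; have [k Wk] := cW z.
  by exists (e' k) => //; rewrite /S /= e'K.
rewrite -{1}cS ge0_integral_bigcup //; last by rewrite cS.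
rewrite integral_nneseries //; last by move=> n; exact: measurable_funS (mus n).
apply: eq_eseriesr => n _; rewrite integral_mkcond [RHS]integral_mkcond.
rewrite -(ge0_integral_shift (emb (- e n))) //.
- apply: eq_integral => z _; rewrite /patch.
  have -> : (z + emb (- e n) \in S n) = (z \in W) by
    rewrite /S; apply/idP/idP => /set_mem h; apply/mem_set; move: h; rewrite /= embN addrNK.
  by [].
- apply/(measurable_restrictT _ _).1 => //; exact: measurable_funTS.
- by move=> z; rewrite /patch; case: ifP.
Qed.

Lemma tile_indic_sum W z : tile W ->
  (\sum_(n <oo) (\1_W (z + emb (- e n)) : R)%:E = 1)%E.
Proof.
move=> [pW cW]; have [e' eK e'K] := be.
have [k Wk] := cW z; pose N := e' (- k).
have eN : - e N = k by rewrite /N e'K opprK.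
rewrite (nneseriesD1 (n := N)) // eN indicE mem_set //= eseries0 ?adde0 // => n _ nN.
rewrite indicE memNset // => Wn; move/eqP: nN; apply.
have := pW _ (- e n - k) Wk; rewrite emb_step.
by move=> /(_ Wn)/eqP; rewrite subr_eq0 -eN eqr_opp => /eqP/(can_inj eK).
Qed.

(** Folding the integral of p over W along the translates of W' leaves p on W'
    times the number of translates meeting a point, which is 1. *)
Lemma ge0_integral_periodic W W' (p : R * R -> R) :
  measurable (W : set (mR * mR)) -> tile W ->
  measurable (W' : set (mR * mR)) -> tile W' ->
  measurable_fun (setT : set (mR * mR)) p -> (forall z, 0 <= p z) -> periodic2 p ->
  (\int[area]_(z in W) (p z)%:E = \int[area]_(z in W') (p z)%:E)%E.
Proof.
move=> mW tW mW' tW' mp p0 pp.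
rewrite integral_mkcond.
have pE z : ((fun z => (p z)%:E) \_ W) z = (p z * \1_W z)%:E.
  by rewrite /patch indicE; case: ifP; rewrite ?mulr1 ?mulr0.
transitivity (\int[area]_z (p z * \1_W z)%:E)%E.
  by apply: eq_integral => z _; rewrite pE.
rewrite (ge0_integral_tile mW' tW'); last 2 first.
- apply/measurable_EFinP; apply: measurable_funM => //; exact: measurable_indic.
- by move=> z; rewrite lee_fin mulr_ge0.
apply: eq_integral => z _.
under eq_eseriesr do rewrite pp EFinM.
by rewrite nneseriesZl ?tile_indic_sum ?mule1 // => n _; rewrite lee_fin.
Qed.

End Decomposition.

Lemma cintegral_periodic W W' (f : R * R -> C) :
  measurable (W : set (mR * mR)) -> tile W ->
  measurable (W' : set (mR * mR)) -> tile W' ->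
  cmeas f -> periodic2 f -> cintegral (cut W f) = cintegral (cut W' f).
Proof.
move=> mW tW mW' tW' [m1 m2] pf; have [e be] := int2_enum.
have main (u : R * R -> R) : measurable_fun (setT : set (mR * mR)) u -> periodic2 u ->
    \int[area]_(z in W) u z = \int[area]_(z in W') u z.
  move=> mu pu; rewrite /Rintegral integralE [in RHS]integralE.
  have posE D : (\int[area]_(x in D) (fun z => (u z)%:E)^\+ x = \int[area]_(x in D) (Num.max (u x) 0)%:E)%E.
    by apply: eq_integral => z _; rewrite funeposE -EFin_max.
  have negE D : (\int[area]_(x in D) (fun z => (u z)%:E)^\- x = \int[area]_(x in D) (Num.max (- u x) 0)%:E)%E.
    by apply: eq_integral => z _; rewrite funenegE -EFin_max.
  rewrite !posE !negE; congr (fine (_ - _)); apply: (ge0_integral_periodic be) => //.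
  - by apply: measurable_maxr => //; exact: measurable_cst.
  - by move=> z; rewrite le_max lexx orbT.
  - by move=> z k; rewrite pu.
  - by apply: measurable_maxr; [exact: measurable_funN|exact: measurable_cst].
  - by move=> z; rewrite le_max lexx orbT.
  - by move=> z k; rewrite pu.
have cutR D (g : C -> R) : g 0 = 0 ->
    \int[area]_z g (cut D f z) = \int[area]_(z in D) g (f z).
  move=> g0; rewrite [RHS]Rintegral_mkcond; apply: eq_Rintegral => z _.
  by rewrite cutE /patch; case: ifP.
by apply: Cext; rewrite /= !cutR //; apply: main => // z k; rewrite pf.
Qed.

Lemma tile_shift W v : tile W -> tile ((fun z => z + v) @^-1` W).
Proof.
move=> [pW cW]; split=> [z k|z] /=; first by rewrite addrAC; exact: pW.
by have [k Wk] := cW (z + v); exists k; rewrite addrAC.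
Qed.

Definition unit_square : set (R * R) := `[0, 1[%classic `*` `[0, 1[%classic.

Lemma measurable_unit_square : measurable (unit_square : set (mR * mR)).
Proof. by apply: measurableX; exact: measurable_itv. Qed.

Lemma area_unit_square : area unit_square = 1%E.
Proof.
rewrite area_rect; [|exact: measurable_itv..].
by rewrite lebesgue_measure_itv /= lte_fin ltr01 oppr0 adde0 mule1.
Qed.

Lemma int_small (n : int) (x : R) : 0 <= x < 1 -> 0 <= x + n%:~R < 1 -> n = 0.
Proof.
move=> /andP[a b] /andP[c d].
have : (-1)%:~R < n%:~R :> R by rewrite intrN; lra.
have : n%:~R < 1%:~R :> R by rewrite /=; lra.
by rewrite !ltr_int; lia.
Qed.

Lemma tile_unit_square : tile unit_square.
Proof.
split=> [[x y] [m n] [/= x1 y1] [/= x2 y2]|[x y]].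
  rewrite !in_itv /= in x1 y1 x2 y2.
  by rewrite (int_small x1 x2) (int_small y1 y2).
exists (- Num.floor x, - Num.floor y); split; rewrite /= in_itv /= intrN;
 exact: frac_bounds.
Qed.

Lemma wave_periodic k : periodic2 (wave (emb k)).
Proof. by move=> z l; rewrite waveDr wave_emb mulr1. Qed.

Lemma wave_half k : k != 0 -> exists v, wave (emb k) v = -1.
Proof.
have w v : dot (emb k) v = 2^-1 -> wave (emb k) v = -1.
  move=> d; rewrite /wave d mulrAC divff ?mul1r // cospi sinpi.
  by apply: Cext => /=; rewrite ?oppr0.
case: k w => m n w; case: (eqVneq m 0) w => [->|m0] w k0.
  have n0 : n%:~R != 0 :> R by rewrite intr_eq0; apply: contra k0 => /eqP ->.
  by exists (0, (2 * n%:~R)^-1); apply: w; rewrite /dot /=; field.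
have m0' : m%:~R != 0 :> R by rewrite intr_eq0.
by exists ((2 * m%:~R)^-1, 0); apply: w; rewrite /dot /=; field.
Qed.

(** The tile may be replaced by the unit square, and then by a translate of
    the unit square. If k is not 0, some translation multiplies the integral
    by -1. *)
Lemma cintegral_wave_tile W k : measurable (W : set (mR * mR)) -> tile W ->
  cintegral (cut W (wave (emb k))) = (k == 0)%:R.
Proof.
move=> mW tW; have mQ := measurable_unit_square; have tQ := tile_unit_square.
rewrite (cintegral_periodic mW tW mQ tQ (cmeas_wave _) (@wave_periodic k)).
have [->|k0] := eqVneq k 0.
  have cR (c : R) : \int[area]_z (c * \1_unit_square z) = c.
    rewrite /Rintegral; under eq_integral do rewrite EFinM.
    rewrite integralZl ?integral_indic ?setIT //; last first.
      have fQ : (area unit_square < +oo)%E by rewrite area_unit_square ltry.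
      by apply: eq_integrable (integrable_cstW mQ fQ 1) => // z _ /=; rewrite mul1r.
    by rewrite [X in (_ * X)%E]area_unit_square mule1.
  apply: Cext; rewrite -[RHS]cR; apply: eq_Rintegral => z _;
    by rewrite /cut emb0 wave0 mulr1 /= ?mul1r ?mul0r.
have [v wv] := wave_half k0.
have mQv : measurable ((fun z => z + (- v)) @^-1` unit_square : set (mR * mR)).
  by rewrite -[X in measurable X]setTI; exact: measurable_shift.
set c := cintegral _.
have e1 : c = - c.
  rewrite {1}/c (cintegral_periodic mQ tQ mQv (tile_shift (- v) tQ) (cmeas_wave _)
    (@wave_periodic k)).
  rewrite -(cintegral_shift v); last by apply: cmeas_cut => //; exact: cmeas_wave.
  rewrite (_ : (fun z => _) = (fun z => -1 * cut unit_square (wave (emb k)) z)).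
    rewrite cintegralZ ?mulN1r //; apply: cintegrable_cut => //.
    - by rewrite area_unit_square ltry.
    - exact: cmeas_wave.
    - exact: cbounded_wave.
  apply/funext => z; rewrite !cutE waveDr wv mulrN1 mulN1r.
  have -> : (z + v \in (fun z => z + - v) @^-1` unit_square) = (z \in unit_square).
    by apply/idP/idP => /set_mem h; apply/mem_set; move: h; rewrite /= addrK.
  by case: ifP; rewrite ?oppr0.
have : c *+ 2 = 0 by rewrite mulr2n {1}e1 addNr.
by move=> /eqP; rewrite mulrn_eq0 /= => /eqP.
Qed.

End Tiles.

(** * Approximation by linear combinations *)

Section Approximation.
Variable R : realType.
Local Notation area := (@area R).
Local Notation C := R[i].
Local Notation Re := complex.Re.
Implicit Types (f g h : R * R -> C).

Lemma cRe_sum (J : Type) (s : seq J) (F : J -> C) :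
  Re (\sum_(i <- s) F i) = \sum_(i <- s) Re (F i).
Proof. exact: (big_morph (@complex.Re R) (@cReD R)). Qed.

Section Family.
Variables (I : choiceType) (D : set I) (e : I -> R * R -> C).

Definition lincomb (l : seq (C * I)) (z : R * R) : C := \sum_(t <- l) t.1 * e t.2 z.

Lemma lincomb_uniq l z : lincomb l z =
  \sum_(i <- undup [seq t.2 | t <- l]) (\sum_(t <- l | t.2 == i) t.1) * e i z.
Proof.
under eq_bigr do rewrite big_distrl big_mkcond /=.
rewrite exchange_big /= /lincomb big_seq [RHS]big_seq; apply: eq_bigr => t tl.
rewrite (bigD1_seq t.2) ?undup_uniq //=; last by rewrite mem_undup; apply: map_f.
by rewrite eqxx big1 ?addr0 // => i; rewrite eq_sym => /negbTE ->.
Qed.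

(** The closure, in L^2, of the linear span of the [e i] with [i] in [D]. *)
Definition approx f : Prop := cmeas f /\ forall eps : R, 0 < eps ->
  exists2 l, (forall t, t \in l -> D t.2) & (sq (fun z => f z - lincomb l z)%R < eps%:E)%E.

Hypothesis me : forall i, D i -> cmeas (e i).

Lemma cmeas_lincomb l : (forall t, t \in l -> D t.2) -> cmeas (lincomb l).
Proof.
rewrite /lincomb; elim: l => [|t l IH] Dl.
  by under eq_fun do rewrite big_nil; exact: cmeas_cst.
under eq_fun do rewrite big_cons; apply: cmeasD.
  by apply: cmeasM; [exact: cmeas_cst|apply/me/Dl/mem_head].
by apply: IH => u ul; apply: Dl; rewrite inE ul orbT.
Qed.

Lemma sqD_lt f g (eps : R) : cmeas f -> cmeas g ->
  (sq f < (eps / 4)%:E)%E -> (sq g < (eps / 4)%:E)%E ->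
  (sq (fun z => f z + g z)%R < eps%:E)%E.
Proof.
move=> mf mg hf hg; apply: le_lt_trans (sqD_le mf mg) _.
apply: (@lt_le_trans _ _ (2%:E * (eps / 4)%:E + 2%:E * (eps / 4)%:E)%E).
  by apply: lteD; rewrite lte_pmul2l.
by rewrite -!EFinM -EFinD lee_fin; lra.
Qed.

Lemma approx_lim f : cmeas f ->
  (forall eps : R, 0 < eps -> exists2 g, approx g & (sq (fun z => f z - g z)%R < eps%:E)%E) ->
  approx f.
Proof.
move=> mf h; split=> // eps e0; have e4 : 0 < eps / 4 by rewrite divr_gt0.
have [g [mg /(_ _ e4)[l Dl gl]] fg] := h _ e4; exists l => //.
have ml := cmeas_lincomb Dl.
rewrite (_ : (fun z => f z - lincomb l z) = fun z => (f z - g z) + (g z - lincomb l z)).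
  by apply: sqD_lt => //; exact: cmeasB.
by apply/funext => z; rewrite addrA subrK.
Qed.

Lemma approx0 : approx (fun=> 0).
Proof.
split; first exact: cmeas_cst.
move=> eps e0; exists [::] => //; rewrite /sq /lincomb.
by under eq_integral do rewrite big_nil subr0 csq0; rewrite integral0.
Qed.

Lemma approxD f g : approx f -> approx g -> approx (fun z => f z + g z).
Proof.
move=> [mf hf] [mg hg]; split=> [|eps e0]; first exact: cmeasD.
have e4 : 0 < eps / 4 by rewrite divr_gt0.
have [l Dl fl] := hf _ e4; have [l' Dl' gl] := hg _ e4; exists (l ++ l') => [t|].
  by rewrite mem_cat => /orP[/Dl|/Dl'].
have ml := cmeas_lincomb Dl; have ml' := cmeas_lincomb Dl'.
rewrite (_ : (fun z => _) = fun z => (f z - lincomb l z) + (g z - lincomb l' z)).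
  by apply: sqD_lt => //; exact: cmeasB.
by apply/funext => z; rewrite /lincomb big_cat opprD addrACA.
Qed.

End Family.

Section Orthonormal.
Variables (I : eqType) (s : seq I) (e : I -> R * R -> C).
Hypotheses (us : uniq s) (le : forall i, i \in s -> in_L2 (e i)).
Hypothesis oe : forall i j, i \in s -> j \in s -> inner (e i) (e j) = (i == j)%:R.

(** Completing the square in the coefficients. *)
Lemma n2B_lincomb f (a : I -> C) : in_L2 f ->
  n2 (fun z => f z - \sum_(i <- s) a i * e i z) =
  n2 f - \sum_(i <- s) csq (inner f (e i)) +
         \sum_(i <- s) csq (inner f (e i) - a i).
Proof.
move=> lf; have lae i : i \in s -> in_L2 (fun z => a i * e i z).
  by move=> /le; exact: in_L2Z.
have lg := in_L2_sum lae; set g := (fun z => \sum_(i <- s) a i * e i z) in lg *.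
have gE h : in_L2 h -> inner g h = \sum_(i <- s) a i * inner (e i) h.
  move=> lh; rewrite inner_suml // big_seq [RHS]big_seq.
  by apply: eq_bigr => i /le li; exact: innerZl.
have ge j : j \in s -> inner g (e j) = a j.
  move=> js; rewrite (gE _ (le js)) (bigD1_seq j) //= oe // eqxx mulr1 big_seq_cond big1 ?addr0 //.
  by move=> i /andP[si ij]; rewrite oe // (negbTE ij) mulr0.
have gg : n2 g = \sum_(i <- s) csq (a i).
  rewrite /n2 gE // cRe_sum big_seq [RHS]big_seq.
  apply: eq_bigr => i si; rewrite innerC ge // -csqE //.
have fg : Re (inner f g) = \sum_(i <- s) Re ((a i)^* * inner f (e i)).
  rewrite innerC cReJ gE // cRe_sum big_seq [RHS]big_seq.
  apply: eq_bigr => i si; rewrite (innerC f) !(cReM, cReJ, cImJ); ring.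
rewrite n2B // gg fg -!addrA; congr (_ + _).
rewrite mulr_sumr -!sumrB -sumrN -big_split /= .
apply: eq_bigr => i _; rewrite /csq !(cReM, cReJ, cImJ, cReD, cReN, cImD, cImN); ring.
Qed.

Lemma bessel f : in_L2 f -> \sum_(i <- s) csq (inner f (e i)) <= n2 f.
Proof.
move=> lf; have := n2B_lincomb (fun i => inner f (e i)) lf.
under [X in _ + X]eq_bigr do rewrite subrr csq0.
rewrite big1_eq addr0 -subr_ge0 => <-; apply: n2_ge0; apply: in_L2B => //.
by apply: in_L2_sum => i /le; exact: in_L2Z.
Qed.

End Orthonormal.

End Approximation.

(** * Parseval on a tile *)

Section Parseval.
Variable R : realType.
Local Notation mR := (measurableTypeR R).
Local Notation area := (@area R).
Local Notation C := R[i].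
Local Notation emb := (emb R).
Implicit Types (f g h : R * R -> C) (W : set (R * R)).

Lemma ler_sum_subset (I : eqType) (s t : seq I) (F : I -> R) :
  uniq s -> uniq t -> {subset s <= t} -> (forall i, 0 <= F i) ->
  \sum_(i <- s) F i <= \sum_(i <- t) F i.
Proof.
move=> us ut st F0; rewrite [leRHS](bigID (mem s)) /= -[\sum_(i <- t | i \in s) _]big_filter.
rewrite [X in _ <= X + _](perm_big s); first by rewrite lerDl sumr_ge0.
apply: uniq_perm => //; first exact: filter_uniq.
by move=> i; rewrite mem_filter; case: (boolP (i \in s)) => // /st ->.
Qed.

Definition tile_wave W (k : int * int) : R * R -> C := cut W (wave (emb k)).

Section OnTile.
Variable W : set (R * R).
Hypotheses (mW : measurable (W : set (mR * mR))) (tW : tile W).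
Local Notation E := (tile_wave W).

Lemma area_tile : area W = 1%E.
Proof.
have [e be] := int2_enum.
have := ge0_integral_periodic (p := fun=> 1) be mW tW (@measurable_unit_square R) (@tile_unit_square R)
  (measurable_cst _) (fun=> ler01) (fun _ _ => erefl).
rewrite !integral_cst //; last exact: measurable_unit_square.
by rewrite !mul1e => ->; exact: area_unit_square.
Qed.

Lemma area_tile_lt : (area W < +oo)%E. Proof. by rewrite area_tile ltry. Qed.

Lemma cmeas_tile_wave k : cmeas (E k).
Proof. by apply: cmeas_cut => //; exact: cmeas_wave. Qed.

Lemma in_L2_tile_wave k : in_L2 (E k).
Proof.
apply: in_L2_cut => //; [exact: area_tile_lt|exact: cmeas_wave|exact: cbounded_wave].
Qed.

Lemma inner_tile_wave k l : inner (E k) (E l) = (k == l)%:R.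
Proof.
rewrite -[k == l]subr_eq0 -(cintegral_wave_tile _ mW tW); apply: eq_cintegral => z.
rewrite /tile_wave !cutE embD embN waveDl waveN; case: ifP => //.
by rewrite mul0r.
Qed.

Lemma lincomb_tile_wave l z : lincomb E l z = cut W (trigp l) z.
Proof.
rewrite /lincomb /trigp /cut big_distrr /=; apply: eq_bigr => t _.
by rewrite /tile_wave /cut mulrCA.
Qed.

Lemma approx_tile_wave f : cmeas f -> cbounded f -> approx setT E (cut W f).
Proof.
move=> mf bf; split=> [|eps e0]; first exact: cmeas_cut.
have [_ _ /(_ _ e0)[l hl]] := trig_dense mW area_tile_lt tW.1 mf bf.
exists l => //; rewrite (_ : (fun z => _) = cut W (fun z => f z - trigp l z)) //.
by apply/funext => z; rewrite lincomb_tile_wave /cut mulrBr.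
Qed.

(** One inequality is that of Bessel; the other holds up to any error because
    the exponentials are complete on [W]. *)
Lemma parseval (e : nat -> int * int) f : bijective e -> cmeas f -> cbounded f ->
  (\sum_(n <oo) (csq (inner (cut W f) (E (e n))))%:E = sq (cut W f))%E.
Proof.
move=> be mf bf; have lf := in_L2_cut mW area_tile_lt mf bf.
have [e' eK e'K] := be.
have ef N : \sum_(0 <= n < N) csq (inner (cut W f) (E (e n))) =
    \sum_(k <- map e (iota 0 N)) csq (inner (cut W f) (E k)).
  by rewrite big_map /index_iota subn0.
have us N : uniq (map e (iota 0 N)) by rewrite map_inj_uniq ?iota_uniq //; exact: can_inj eK.
have le k : in_L2 (E k) by exact: in_L2_tile_wave.
apply/eqP; rewrite eq_le; apply/andP; split.
  apply: lime_le; first by apply: is_cvg_nneseries => n _ _; rewrite lee_fin csq_ge0.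
  apply: nearW => N; rewrite sumEFin ef (sqE lf) lee_fin.
  by apply: bessel => // *; exact: inner_tile_wave.
rewrite (sqE lf); apply/lee_addgt0Pr => eps e0.
have [_ /(_ _ e0)[l _]] := approx_tile_wave mf bf.
set s := undup [seq t.2 | t <- l].
pose a k := \sum_(t <- l | t.2 == k) t.1.
rewrite (_ : (fun z => _) = fun z => cut W f z - \sum_(k <- s) a k * E k z); last first.
  by apply/funext => z; rewrite lincomb_uniq.
rewrite sqE; last first.
  by apply: in_L2B => //; apply: in_L2_sum => k _; exact: in_L2Z.
rewrite lte_fin n2B_lincomb //; last 2 first.
- exact: undup_uniq.
- by move=> *; exact: inner_tile_wave.
move=> hs; pose N := (\max_(k <- s) e' k).+1.
have sN : \sum_(k <- s) csq (inner (cut W f) (E k)) <=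
    \sum_(0 <= n < N) csq (inner (cut W f) (E (e n))).
  rewrite ef; apply: ler_sum_subset => //.
  - exact: undup_uniq.
  - move=> k ks; apply/mapP; exists (e' k); last by rewrite e'K.
    rewrite mem_iota add0n ltnS /N.
    by rewrite (big_rem k ks) /= leq_maxl.
  - by move=> *; exact: csq_ge0.
apply: le_trans (_ : _ <= (\sum_(0 <= n < N) (csq (inner (cut W f) (E (e n))))%:E + eps%:E))%E _.
  rewrite sumEFin -EFinD lee_fin.
  have : 0 <= \sum_(k <- s) csq (inner (cut W f) (E k) - a k).
    by apply: sumr_ge0 => *; exact: csq_ge0.
  lra.
rewrite leeD2r //; apply: nneseries_lim_ge => n _ _; rewrite lee_fin; exact: csq_ge0.
Qed.

End OnTile.
End Parseval.

(** * The Plancherel identity *)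

Section Fourier.
Variable R : realType.
Local Notation mR := (measurableTypeR R).
Local Notation area := (@area R).
Local Notation C := R[i].
Local Notation Re := complex.Re.
Local Notation Im := complex.Im.
Local Notation emb := (emb R).
Local Notation P2 := ((mR * mR) * (mR * mR))%type.
Implicit Types (f g h : R * R -> C) (W : set (R * R)).

Definition box (M : R) : set (R * R) := `[- M, M[%classic `*` `[- M, M[%classic.

Lemma measurable_box M : measurable (box M : set (mR * mR)).
Proof. by apply: measurableX; exact: measurable_itv. Qed.

Lemma area_box M : (area (box M) < +oo)%E.
Proof.
rewrite area_rect; [|exact: measurable_itv..].
rewrite lebesgue_measure_itv /=; case: ifP => _; last by rewrite mul0e ltry.
by rewrite -EFinB -EFinM ltry.
Qed.

Lemma in_box z : exists M, box M z.
Proof.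
exists (`|z.1| + `|z.2| + 1).
have := ler_norm z.1; have := ler_norm (- z.1); have := ler_norm z.2; have := ler_norm (- z.2).
rewrite !normrN; have := normr_ge0 z.1; have := normr_ge0 z.2 => *.
by split; rewrite /= in_itv /=; apply/andP; split; lra.
Qed.

Lemma box_sub M N : M <= N -> box M `<=` box N.
Proof.
move=> MN z [] /=; rewrite !in_itv /= => /andP[a b] /andP[c d].
by split; rewrite /= in_itv /=; apply/andP; split; lra.
Qed.

Lemma in_box_nat z : exists n : nat, box n%:R z.
Proof.
have [M Mz] := in_box z; exists (Num.bound `|M|).
apply: box_sub Mz; apply: le_trans (ler_norm _) _; apply: ltW; exact: archi_boundP.
Qed.

Lemma area_sigma_finite : sigma_finite setT area.
Proof.
exists (fun n => box n%:R) => [|n]; last by split; [exact: measurable_box|exact: area_box].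
by apply/seteqP; split=> // z _; have [n nz] := in_box_nat z; exists n.
Qed.

HB.instance Definition _ := Measure_isSigmaFinite.Build _ _ _ area area_sigma_finite.

(** The functions on which [inverse_fourier] is given by an absolutely
    convergent integral and on which its unitarity is proved; they are dense
    in L^2. *)
Definition bbs f : Prop :=
  [/\ cmeas f, cbounded f & exists M, forall z, ~ box M z -> f z = 0].

Lemma cut_box f M : (forall z, ~ box M z -> f z = 0) -> cut (box M) f = f.
Proof.
move=> f0; apply/funext => z; rewrite cutE; case: (boolP (z \in _)) => // /negP zM.
by rewrite f0 // => ?; apply: zM; exact/mem_set.
Qed.

Lemma bbs_in_L2 f : bbs f -> in_L2 f.
Proof.
move=> [mf bf [M /cut_box <-]]; apply: in_L2_cut => //; [exact: measurable_box|exact: area_box].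
Qed.

Lemma bbs_mul f g : bbs f -> cmeas g -> cbounded g -> bbs (fun z => f z * g z).
Proof.
move=> [mf bf [M f0]] mg bg; split; [exact: cmeasM|exact: cboundedM|].
by exists M => z /f0 ->; rewrite mul0r.
Qed.

Lemma bbsD f g : bbs f -> bbs g -> bbs (fun z => f z + g z).
Proof.
move=> [mf bf [M f0]] [mg bg [N g0]]; split; [exact: cmeasD|exact: cboundedD|].
exists (Num.max M N) => z zM; rewrite f0 ?g0 ?addr0 // => zm; apply: zM.
  by apply: box_sub zm; rewrite le_max lexx orbT.
by apply: box_sub zm; rewrite le_max lexx.
Qed.

Lemma bbsZ c f : bbs f -> bbs (fun z => c * f z).
Proof.
move=> bf; have := bbs_mul bf (cmeas_cst c) (cbounded_cst c).
by congr bbs; apply/funext => z; rewrite mulrC.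
Qed.

Lemma bbs_cintegrable f : bbs f -> cintegrable f.
Proof.
move=> [mf bf [M /cut_box <-]]; apply: cintegrable_cut => //.
  exact: measurable_box.
exact: area_box.
Qed.

Lemma inverse_fourierE f z : inverse_fourier f z = cintegral (fun xi => f xi * wave z xi).
Proof. by []. Qed.

Lemma bbs_wave f z : bbs f -> bbs (fun xi => f xi * wave z xi).
Proof. by move=> bf; apply: bbs_mul => //; [exact: cmeas_wave|exact: cbounded_wave]. Qed.

Lemma cintegrableJ f : cintegrable f -> cintegrable (fun z => (f z)^*).
Proof.
move=> [c1 c2]; split; first by apply: eq_integrable c1 => // z _; rewrite /= cReJ.
apply: eq_integrable (integrableZl measurableT (-1) c2) => // z _ /=.
by rewrite -EFinM mulN1r; case: (f z).
Qed.

Lemma measurable_wave_joint :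
  measurable_fun (setT : set P2) (fun w : P2 => Re (wave w.1 w.2)) /\
  measurable_fun (setT : set P2) (fun w : P2 => Im (wave w.1 w.2)).
Proof.
have m11 : measurable_fun (setT : set P2) (fun w : P2 => w.1.1 : R).
  exact: (measurableT_comp measurable_fst measurable_fst).
have m12 : measurable_fun (setT : set P2) (fun w : P2 => w.1.2 : R).
  exact: (measurableT_comp measurable_snd measurable_fst).
have m21 : measurable_fun (setT : set P2) (fun w : P2 => w.2.1 : R).
  exact: (measurableT_comp measurable_fst measurable_snd).
have m22 : measurable_fun (setT : set P2) (fun w : P2 => w.2.2 : R).
  exact: (measurableT_comp measurable_snd measurable_snd).
have md : measurable_fun (setT : set P2) (fun w : P2 => 2 * pi * dot w.1 w.2).
  apply: measurable_funM; first exact: measurable_cst.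
  by apply: measurable_funD; exact: measurable_funM.
split.
  apply: (measurableT_comp (f := @cos R)) md.
  by apply: continuous_measurable_fun => x; exact: continuous_cos.
apply: (measurableT_comp (f := @sin R)) md.
by apply: continuous_measurable_fun => x; exact: continuous_sin.
Qed.

Lemma measurable_kernel f h : cmeas f -> cmeas h ->
  measurable_fun (setT : set P2) (fun w : P2 => Re (f w.2 * wave w.1 w.2 * h w.1)) /\
  measurable_fun (setT : set P2) (fun w : P2 => Im (f w.2 * wave w.1 w.2 * h w.1)).
Proof.
move=> [f1 f2] [h1 h2]; have [w1 w2] := measurable_wave_joint.
have F1 : measurable_fun (setT : set P2) (fun w : P2 => Re (f w.2)).
  exact: (measurableT_comp f1 measurable_snd).
have F2 : measurable_fun (setT : set P2) (fun w : P2 => Im (f w.2)).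
  exact: (measurableT_comp f2 measurable_snd).
have H1 : measurable_fun (setT : set P2) (fun w : P2 => Re (h w.1)).
  exact: (measurableT_comp h1 measurable_fst).
have H2 : measurable_fun (setT : set P2) (fun w : P2 => Im (h w.1)).
  exact: (measurableT_comp h2 measurable_fst).
split.
  under eq_fun do rewrite !(cReM, cImM).
  apply: measurable_funB; apply: measurable_funM => //.
    by apply: measurable_funB; exact: measurable_funM.
  by apply: measurable_funD; exact: measurable_funM.
under eq_fun do rewrite !(cReM, cImM).
apply: measurable_funD; apply: measurable_funM => //.
  by apply: measurable_funB; exact: measurable_funM.
by apply: measurable_funD; exact: measurable_funM.
Qed.

Lemma measurable_Rintegral_section (u : P2 -> R) :
  measurable_fun (setT : set P2) u ->
  measurable_fun (setT : set (mR * mR)) (fun z => \int[area]_xi u (z, xi)).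
Proof.
move=> mu; have muE : measurable_fun (setT : set P2) (fun w => (u w)%:E).
  exact/measurable_EFinP.
rewrite /Rintegral; apply: (measurableT_comp (f := fine)) => //.
under eq_fun do rewrite integralE.
have mF (v : P2 -> \bar R) : measurable_fun (setT : set P2) v -> (forall w, 0 <= v w)%E ->
    measurable_fun (setT : set (mR * mR)) (fun z => \int[area]_xi v (z, xi))%E.
  by move=> mv v0; exact: (@measurable_fun_fubini_tonelli_F _ _ _ _ R area v).
apply: emeasurable_funB.
  under eq_fun do under eq_integral do rewrite funeposE.
  apply: (mF (fun w => maxe (u w)%:E 0%E)) => [|w]; last by rewrite le_max lexx orbT.
  by apply: measurable_maxe => //; exact: measurable_cst.
under eq_fun do under eq_integral do rewrite funenegE.
apply: (mF (fun w => maxe (- (u w)%:E) 0)%E) => [|w]; last by rewrite le_max lexx orbT.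
by apply: measurable_maxe => //; exact: measurableT_comp.
Qed.

Lemma cmeas_inverse_fourier f : cmeas f -> cmeas (inverse_fourier f).
Proof.
move=> mf; have [k1 k2] := measurable_kernel mf (cmeas_cst 1).
split; rewrite /=.
  have := measurable_Rintegral_section k1; congr measurable_fun.
  apply/funext => z; apply: eq_Rintegral => xi _ /=; by rewrite mulr1.
have := measurable_Rintegral_section k2; congr measurable_fun.
apply/funext => z; apply: eq_Rintegral => xi _ /=; by rewrite mulr1.
Qed.

Lemma fubini_bounded (u : P2 -> R) (c M N : R) :
  measurable_fun (setT : set P2) u ->
  (forall w, `|u w| <= c * \1_(box M) w.1 * \1_(box N) w.2) ->
  \int[area]_z \int[area]_xi u (z, xi) = \int[area]_xi \int[area]_z u (z, xi).
Proof.
move=> mu ub; have muE : measurable_fun (setT : set P2) (fun w => (u w)%:E).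
  exact/measurable_EFinP.
have ib (b : R) K : area.-integrable setT (fun z => (b * \1_(box K) z)%:E).
  by apply: integrable_cstW; [exact: measurable_box|exact: area_box].
have Ib (b : R) K : (\int[area]_z (b * \1_(box K) z)%:E = (b * fine (area (box K)))%:E)%E.
  under eq_integral do rewrite EFinM.
  rewrite integralZl //; last first.
    by apply: eq_integrable (ib 1 K) => // z _; rewrite mul1r.
  rewrite integral_indic ?setIT //; last exact: measurable_box.
  by rewrite EFinM fineK // ge0_fin_numE // area_box.
have i1 z : area.-integrable setT (fun xi => (u (z, xi))%:E).
  apply: le_integrable (ib (c * \1_(box M) z) N) => //.
    by apply: (measurableT_comp muE); exact: pair1_measurable.
  by move=> xi _ /=; rewrite lee_fin (le_trans (ub (z, xi))) //= ler_norm.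
have i2 xi : area.-integrable setT (fun z => (u (z, xi))%:E).
  apply: le_integrable (ib (c * \1_(box N) xi) M) => //.
    by apply: (measurableT_comp muE); exact: pair2_measurable.
  move=> z _ /=; rewrite lee_fin (le_trans (ub (z, xi))) //= mulrAC; exact: ler_norm.
have iP : (area \x area)%E.-integrable setT (fun w => (u w)%:E).
  apply/(integrable12ltyP area area muE).
  apply: (@le_lt_trans _ _ (\int[area]_z (c * fine (area (box N)) * \1_(box M) z)%:E)%E).
    apply: ge0_le_integral => //.
    - by move=> z _; exact: integral_ge0.
    - apply: (@measurable_fun_fubini_tonelli_F _ _ _ _ R area (fun w => `|(u w)%:E|%E)) => //.
      exact: measurableT_comp.
    - exact: measurable_int (ib _ _).
    - move=> z _; rewrite mulrAC -Ib; apply: ge0_le_integral => //.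
      + by apply: measurableT_comp => //; exact: measurable_int (i1 z).
      + exact: measurable_int (ib _ _).
      + by move=> xi _; rewrite lee_fin; exact: (ub (z, xi)).
  by rewrite Ib ltry.
rewrite /Rintegral.
transitivity (fine (\int[area]_z \int[area]_xi (u (z, xi))%:E)%E).
  by congr fine; apply: eq_integral => z _; rewrite fineK // integrable_fin_num.
rewrite (Fubini iP); congr fine; apply: eq_integral => xi _.
by rewrite fineK // integrable_fin_num.
Qed.

(** Fubini: the adjoint of the inverse Fourier transform is the Fourier
    transform, which is its composition with the central symmetry. *)
Lemma inner_inverse_fourier g h : bbs g -> bbs h ->
  inner (inverse_fourier g) h = inner g (fun xi => inverse_fourier h (- xi)).
Proof.
move=> bg bh; have [mg [A gA] [N gN]] := bg; have [mh [B hB] [M hM]] := bh.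
pose K (w : P2) := g w.2 * wave w.1 w.2 * (h w.1)^*.
have [k1 k2] := measurable_kernel mg (cmeasJ mh).
have Kb w : csq (K w) <= A * B.
  rewrite /K !csqM csqJ csq_wave mulr1; apply: ler_pM; rewrite ?csq_ge0 //.
have K0 w : w.1 \notin box M \/ w.2 \notin box N -> K w = 0.
  rewrite /K => -[/negP w1|/negP w2].
    by rewrite hM ?conjC0 ?mulr0 // => ?; apply: w1; exact/mem_set.
  by rewrite gN ?mul0r // => ?; apply: w2; exact/mem_set.
have bnd (r : C -> R) : r 0 = 0 -> (forall x, `|r x| <= 1 + csq x) ->
    forall w, `|r (K w)| <= (1 + A * B) * \1_(box M) w.1 * \1_(box N) w.2.
  move=> r0 r1 w; rewrite !indicE.
  case: (boolP (w.1 \in box M)) => w1; last by rewrite K0 ?r0 ?normr0 ?mulr0 ?mul0r //; left.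
  case: (boolP (w.2 \in box N)) => w2; last by rewrite K0 ?r0 ?normr0 ?mulr0 //; right.
  by rewrite !mulr1 (le_trans (r1 _)) // lerD2l.
have K1 z : inverse_fourier g z * (h z)^* = cintegral (fun xi => K (z, xi)).
  rewrite inverse_fourierE mulrC -cintegralZ; last exact/bbs_cintegrable/bbs_wave.
  by apply: eq_cintegral => xi; rewrite /K /= mulrC.
have K2 xi : g xi * (inverse_fourier h (- xi))^* = cintegral (fun z => K (z, xi)).
  transitivity (g xi * cintegral (fun z => (h z * wave (- xi) z)^*)).
    by congr (_ * _); apply/esym; exact: cintegralJ.
  rewrite -cintegralZ; last first.
    exact/cintegrableJ/bbs_cintegrable/bbs_wave.
  apply: eq_cintegral => z; rewrite /K /= waveN (wave_sym xi).
  by case: (g xi) (h z) (wave z xi) => [? ?] [? ?] [? ?]; apply: Cext => /=; ring.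
rewrite /inner (eq_cintegral K1) (eq_cintegral K2).
apply: Cext.
  exact: (fubini_bounded k1 (bnd (@complex.Re R) erefl (@Re_le_csq R))).
exact: (fubini_bounded k2 (bnd (@complex.Im R) erefl (@Im_le_csq R))).
Qed.

(** The values of the inverse transform at z - k, for k in Z^2, are the
    coefficients of f times the character of z on the tile. Parseval sums
    their squares, and the integral over z in the unit square recovers the
    whole plane. *)
Lemma plancherel_tile W f : measurable (W : set (mR * mR)) -> tile W ->
  cmeas f -> cbounded f -> sq (inverse_fourier (cut W f)) = sq (cut W f).
Proof.
move=> mW tW mf bf; have [e be] := int2_enum.
have mF := cmeas_inverse_fourier (cmeas_cut mW mf).
rewrite {1}/sq (ge0_integral_tile be (@measurable_unit_square R) (@tile_unit_square R)); last 2 first.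
- exact: measurable_csqE.
- by move=> z; rewrite lee_fin csq_ge0.
transitivity (\int[area]_(z in @unit_square R) (sq (cut W f)))%E; last first.
  rewrite integral_cst; last exact: measurable_unit_square.
  by rewrite [X in (_ * X)%E]area_unit_square mule1.
apply: eq_integral => z _.
have mw := cmeas_wave z; have bw := cbounded_wave z.
have <- : sq (cut W (fun xi => f xi * wave z xi)) = sq (cut W f).
  by apply: eq_integral => xi _; rewrite /cut !csqM csq_wave mulr1.
rewrite -(parseval mW tW be (cmeasM mf mw) (cboundedM bf bw)).
apply: eq_eseriesr => n _; congr (csq _)%:E.
apply: eq_cintegral => xi; rewrite /tile_wave !cutE; case: ifP => _; last by rewrite !mul0r.
by rewrite -/(wave _ _) embN waveDl waveN mulrA.
Qed.

Lemma cbounded_comp f (T : R * R -> R * R) : cbounded f -> cbounded (fun z => f (T z)).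
Proof. by move=> [M fM]; exists M. Qed.

(** A dilation brings the support of [f] inside a translate of the unit
    square. *)
Lemma plancherel f : bbs f -> sq (inverse_fourier f) = sq f.
Proof.
move=> [mf bf [M0 f0]]; pose a := 2 * (`|M0| + 1).
have a0 : 0 < a by rewrite mulr_gt0 // ltr_wpDl.
have an : a != 0 by rewrite gt_eqF.
pose W := (fun z => z + (2^-1, 2^-1)) @^-1` (@unit_square R).
have mW : measurable (W : set (mR * mR)).
  rewrite -[X in measurable X]setTI; apply: measurable_shift => //.
  exact: measurable_unit_square.
have tW : tile W by apply: tile_shift; exact: tile_unit_square.
have D0 : a * a - 0 * 0 != 0 by rewrite mul0r subr0 mulf_neq0.
have D1 : a^-1 * a^-1 - 0 * 0 != 0 by rewrite mul0r subr0 mulf_neq0 // invr_neq0.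
pose f' z := f (lin4 a 0 0 a z).
have mf' : cmeas f' by apply: cmeas_comp => //; exact: measurable_lin4.
have f'E : cut W f' = f'.
  apply/funext => z; rewrite cutE; case: (boolP (z \in W)) => // /negP zW.
  rewrite /f' f0 // => h; apply: zW; apply/mem_set.
  have [] : box (a / 2) (lin4 a 0 0 a z).
    by apply: box_sub h; rewrite /a; have := ler_norm M0; lra.
  rewrite /lin4 /= !in_itv /= !mul0r addr0 add0r => /andP[x1 x2] /andP[y1 y2].
  split; rewrite /= in_itv /=; apply/andP; split;
  by rewrite -(ltr_pM2l a0) || rewrite -(ler_pM2l a0); lra.
have := plancherel_tile mW tW mf' (cbounded_comp _ bf); rewrite f'E.
have -> : inverse_fourier f' =
    fun z => ((a * a)^-1)%:C * inverse_fourier f (lin4 a^-1 0 0 a^-1 z).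
  apply/funext => z; rewrite !inverse_fourierE.
  have := @cintegral_lin4 _ a 0 0 a (fun eta => f eta * wave (lin4 a^-1 0 0 a^-1 z) eta) D0.
  rewrite mul0r subr0 gtr0_norm ?mulr_gt0 // => <-; last first.
    by apply: cmeasM => //; exact: cmeas_wave.
  apply: eq_cintegral => xi; congr (_ * _); rewrite /wave /dot /lin4 /=.
  by congr (cos _ +i* sin _); field.
have mF := cmeas_inverse_fourier mf.
rewrite sqZ; last by apply: cmeas_comp => //; exact: measurable_lin4.
rewrite !sq_lin4 // !mul0r !subr0 csq_real !gtr0_norm ?mulr_gt0 ?invr_gt0 //.
rewrite muleA -EFinM.
have -> : ((a * a)^-1) ^+ 2 / (a^-1 / a) = (a * a)^-1 by field.
move=> h; have := congr1 (fun x => (a * a)%:E * x)%E h.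
by rewrite !muleA -!EFinM mulfV ?mulf_neq0 // !mul1e.
Qed.

End Fourier.

(** * Density of the range of the inverse Fourier transform *)

Section FourierUnitary.
Variable R : realType.
Local Notation mR := (measurableTypeR R).
Local Notation area := (@area R).
Local Notation C := R[i].
Local Notation Re := complex.Re.
Implicit Types (f g h : R * R -> C) (W : set (R * R)).

Lemma inverse_fourierD f g : bbs f -> bbs g ->
  inverse_fourier (fun xi => f xi + g xi) =
  fun z => inverse_fourier f z + inverse_fourier g z.
Proof.
move=> bf bg; apply/funext => z.
rewrite !inverse_fourierE -cintegralD; try exact/bbs_cintegrable/bbs_wave.
by apply: eq_cintegral => xi; rewrite mulrDl.
Qed.

Lemma inverse_fourierZ c f : bbs f ->
  inverse_fourier (fun xi => c * f xi) = fun z => c * inverse_fourier f z.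
Proof.
move=> bf; apply/funext => z.
rewrite !inverse_fourierE -cintegralZ; last exact/bbs_cintegrable/bbs_wave.
by apply: eq_cintegral => xi; rewrite mulrA.
Qed.

Lemma inverse_fourierB f g : bbs f -> bbs g ->
  inverse_fourier (fun xi => f xi - g xi) =
  fun z => inverse_fourier f z - inverse_fourier g z.
Proof.
move=> bf bg; have bg' := bbsZ (-1) bg.
rewrite (_ : (fun xi => _) = fun xi => f xi + -1 * g xi); last first.
  by apply/funext => xi; rewrite mulN1r.
by rewrite inverse_fourierD // inverse_fourierZ //; apply/funext => z; rewrite mulN1r.
Qed.

Lemma in_L2_inverse_fourier f : bbs f -> in_L2 (inverse_fourier f).
Proof.
move=> bf; apply/in_L2P; split; first by case: (bf) => mf _ _; exact: cmeas_inverse_fourier.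
by rewrite plancherel //; have /in_L2P[] := bbs_in_L2 bf.
Qed.

Lemma n2_inverse_fourier f : bbs f -> n2 (inverse_fourier f) = n2 f.
Proof.
move=> bf; apply: EFin_inj; rewrite -!sqE ?plancherel //.
  exact: bbs_in_L2.
exact: in_L2_inverse_fourier.
Qed.

(** Polarization. *)
Lemma inner_inverse_fourier2 f g : bbs f -> bbs g ->
  inner (inverse_fourier f) (inverse_fourier g) = inner f g.
Proof.
move=> bf bg; have lf := bbs_in_L2 bf; have lF := in_L2_inverse_fourier bf.
have reP h : bbs h -> Re (inner (inverse_fourier f) (inverse_fourier h)) = Re (inner f h).
  move=> bh; have lh := bbs_in_L2 bh; have lH := in_L2_inverse_fourier bh.
  have := n2_inverse_fourier (bbsD bf bh); rewrite inverse_fourierD //.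
  rewrite (n2D lF lH) (n2D lf lh) (n2_inverse_fourier bf) (n2_inverse_fourier bh); lra.
have lg := bbs_in_L2 bg; have lG := in_L2_inverse_fourier bg.
apply: Cext; first exact: reP.
have := reP _ (bbsZ 'i%C bg); rewrite inverse_fourierZ // (innerZr _ lF lG) (innerZr _ lf lg).
rewrite !(cReM, cReJ, cImJ) /=; lra.
Qed.

Definition truncation f (n : nat) : R * R -> C :=
  cut (box n%:R `&` [set z | csq (f z) <= n%:R]) f.

Lemma measurable_truncation_set f n : cmeas f ->
  measurable (box n%:R `&` [set z | csq (f z) <= n%:R] : set (mR * mR)).
Proof.
move=> mf; apply: measurableI; first exact: measurable_box.
have := measurable_csq mf => m.
rewrite (_ : [set z | _] = (fun z => csq (f z)) @^-1` `]-oo, n%:R]%classic).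
  by rewrite -[X in measurable X]setTI; exact: m.
by apply/seteqP; split=> z /=; rewrite in_itv.
Qed.

Lemma bbs_truncation f n : cmeas f -> bbs (truncation f n).
Proof.
move=> mf; have mA := measurable_truncation_set n mf.
split; first exact: cmeas_cut.
  exists n%:R => z; rewrite /truncation cutE; case: ifP => [/set_mem[_]//|_].
  by rewrite csq0.
exists n%:R => z zn; rewrite /truncation cutE memNset // => -[] //.
Qed.

Lemma truncation_cvg f (eps : R) : in_L2 f -> 0 < eps ->
  exists n, (sq (fun z => f z - truncation f n z)%R < eps%:E)%E.
Proof.
move=> /in_L2P[mf sf] e0.
apply: (sq_dominated (F := fun n z => f z - truncation f n z) (G := fun z => csq (f z))) => //.
- by move=> n; apply: cmeasB => //; have [] := bbs_truncation n mf.
- apply/integrableP; split; first exact: measurable_csqE.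
  rewrite (_ : integral _ _ _ = sq f) //; apply: eq_integral => z _ /=.
  by rewrite ger0_norm ?csq_ge0.
- move=> n z; rewrite /truncation cutE; case: ifP => _; last by rewrite subr0.
  by rewrite subrr csq0 csq_ge0.
- move=> z; have [M Mz] := in_box z.
  apply: cvg_near_cst; exists (Num.bound (`|M| + csq (f z))) => // n /= bn.
  have Mn : `|M| + csq (f z) <= n%:R.
    apply: le_trans (_ : _ <= (Num.bound (`|M| + csq (f z)))%:R) _; last by rewrite ler_nat.
    by apply/ltW/archi_boundP; rewrite addr_ge0 ?csq_ge0.
  have := csq_ge0 (f z); have := ler_norm M; have := normr_ge0 M => *.
  rewrite /truncation cutE mem_set ?subrr ?csq0 //; split=> /=; last by lra.
  by apply: box_sub Mz; lra.
Qed.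

(** Let k be the Fourier transform of h and g a truncation of k. By adjunction
    and by the Plancherel identity for h, the distance from h to the inverse
    transform of g equals the distance from k to g. *)
Lemma inverse_fourier_dense h (eps : R) : bbs h -> 0 < eps ->
  exists2 g, bbs g & (sq (fun z => h z - inverse_fourier g z)%R < eps%:E)%E.
Proof.
move=> bh e0; pose k xi := inverse_fourier h (- xi).
have mF : cmeas (inverse_fourier h) by case: bh => mh _ _; exact: cmeas_inverse_fourier.
have kE : k = fun xi => inverse_fourier h (lin4 (-1) 0 0 (-1) xi).
  apply/funext => -[x y]; rewrite /k /lin4 /= !mul0r !mulN1r addr0 add0r.
  by congr (inverse_fourier h _).
have D0 : -1 * -1 - 0 * 0 != 0 :> R by rewrite mul0r subr0 mulN1r opprK oner_neq0.
have mk : cmeas k by rewrite kE; apply: cmeas_comp => //; exact: measurable_lin4.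
have sk : sq k = sq h.
  rewrite kE sq_lin4 // mul0r subr0 mulN1r opprK normr1 invr1 mul1e.
  exact: plancherel.
have lh := bbs_in_L2 bh.
have lk : in_L2 k by apply/in_L2P; split; rewrite // sk; have /in_L2P[] := lh.
have [n hn] := truncation_cvg lk e0.
set g := truncation k n; have bg : bbs g by exact: bbs_truncation.
have lg := bbs_in_L2 bg; have lFg := in_L2_inverse_fourier bg.
exists g => //; move: hn; rewrite !sqE; try exact: in_L2B.
rewrite !lte_fin; congr (_ < _).
have gk : inner g k = (n2 g)%:C.
  rewrite -inner_self; apply: eq_cintegral => z.
  by rewrite /g /truncation cutE; case: ifP; rewrite // !mul0r.
rewrite !n2B // n2_inverse_fourier // (innerC g k) (innerC (inverse_fourier g) h).
rewrite inner_inverse_fourier // -/k gk !cReJ /=.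
have -> : n2 k = n2 h by apply: EFin_inj; rewrite -!sqE.
by [].
Qed.

Section Transfer.
Variables (I : choiceType) (D : set I) (g : I -> R * R -> C).
Hypothesis bg : forall i, D i -> bbs (g i).

Lemma bbs_lincomb l : (forall t, t \in l -> D t.2) -> bbs (lincomb g l).
Proof.
rewrite /lincomb; elim: l => [|t l IH] Dl.
  under eq_fun do rewrite big_nil; split; [exact: cmeas_cst|exact: cbounded_cst|].
  by exists 0.
under eq_fun do rewrite big_cons; apply: bbsD.
  by apply: bbsZ; apply/bg/Dl/mem_head.
by apply: IH => u ul; apply: Dl; rewrite inE ul orbT.
Qed.

Lemma inverse_fourier_lincomb l : (forall t, t \in l -> D t.2) ->
  inverse_fourier (lincomb g l) = lincomb (fun i => inverse_fourier (g i)) l.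
Proof.
elim: l => [|t l IH] Dl; apply/funext => z.
  transitivity (inner (fun=> 0) (wave (- z))); last by rewrite inner0l /lincomb big_nil.
  by apply: eq_cintegral => xi; rewrite /lincomb big_nil !mul0r.
have Dt : D t.2 by apply/Dl/mem_head.
have Dl' u : u \in l -> D u.2 by move=> ul; apply: Dl; rewrite inE ul orbT.
have bt := bbsZ t.1 (bg Dt); have bl := bbs_lincomb Dl'.
transitivity (inverse_fourier (fun xi => t.1 * g t.2 xi + lincomb g l xi) z).
  by congr (inverse_fourier _ z); apply/funext => xi; rewrite /lincomb big_cons.
rewrite (inverse_fourierD bt bl) inverse_fourierZ ?(IH Dl') /lincomb ?big_cons //.
exact: bg.
Qed.

(** An isometry with dense range carries total families to total families. *)
Lemma approx_inverse_fourier f : (forall h, bbs h -> approx D g h) -> in_L2 f ->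
  approx D (fun i => inverse_fourier (g i)) f.
Proof.
move=> hg lf; have /in_L2P[mf _] := lf.
have mg i : D i -> cmeas (inverse_fourier (g i)).
  by move=> /bg[mi _ _]; exact: cmeas_inverse_fourier.
apply: approx_lim => // eps e0; have [n fn] := truncation_cvg lf e0.
exists (truncation f n) => //; have bt : bbs (truncation f n) by exact: bbs_truncation.
have [mt _ _] := bt.
apply: approx_lim => // {fn}eps {}e0; have [h bh th] := inverse_fourier_dense bt e0.
exists (inverse_fourier h) => //; split.
  by have [mh _ _] := bh; exact: cmeas_inverse_fourier.
move=> {th} eps {}e0; have [_ /(_ _ e0)[l Dl hl]] := hg _ bh; exists l => //.
have bl := bbs_lincomb Dl.
rewrite -inverse_fourier_lincomb // -[X in sq X]inverse_fourierB // plancherel //.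
have := bbsD bh (bbsZ (-1) bl); congr bbs; apply/funext => z.
by rewrite mulN1r.
Qed.

End Transfer.
End FourierUnitary.

(** * A set tiling by translations and by dilations *)

Section CantorBernstein.
Variables (T : Type) (r1 r2 : T -> T -> Prop).

Definition equivalence_prop (r : T -> T -> Prop) : Prop :=
  [/\ (forall x, r x x), (forall x y, r x y -> r y x) &
      (forall x y z, r x y -> r y z -> r x z)].

Definition saturation (r : T -> T -> Prop) (A : set T) : set T :=
  [set z | exists2 a, A a & r z a].

Variables (Y E F : set T).

(** Think of [r1] as translation and [r2] as dilation: E meets every class of
    [r2] in Y once and every class of [r1] at most once, F has the same
    property with [r1] and [r2] exchanged. The wanted set meets every class of
    both relations once. As in the Cantor-Bernstein argument, points of E with
    no [r2]-partner in F have to be taken; their [r1]-partners in F are then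
    forbidden, so that the [r2]-partners in E of those have to be taken, and
    so on. *)
Fixpoint cb_stage (n : nat) : set T :=
  if n is m.+1 then E `&` saturation r2 (F `&` saturation r1 (cb_stage m))
  else E `\` saturation r2 F.

Definition cb_part : set T := \bigcup_n cb_stage n.

(** In the [r2]-classes without forced points, those of F are taken. *)
Definition cb_set : set T := cb_part `|` (F `\` saturation r2 cb_part).

Hypotheses (eq1 : equivalence_prop r1) (eq2 : equivalence_prop r2).
Hypotheses (EY : E `<=` Y) (FY : F `<=` Y).
Hypothesis E1 : forall x y, E x -> E y -> r1 x y -> x = y.
Hypothesis E2 : forall x y, E x -> E y -> r2 x y -> x = y.
Hypothesis F1 : forall x y, F x -> F y -> r1 x y -> x = y.
Hypothesis F2 : forall x y, F x -> F y -> r2 x y -> x = y.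
Hypothesis E_cover : forall y, Y y -> exists2 x, E x & r2 y x.
Hypothesis F_cover : forall y, exists2 x, F x & r1 y x.

Lemma cb_stage_sub n : cb_stage n `<=` E.
Proof. by case: n => [|n] z []. Qed.

Lemma cb_part_sub : cb_part `<=` E.
Proof. by move=> z [n _]; exact: cb_stage_sub. Qed.

Lemma cb_set_sub : cb_set `<=` Y.
Proof. by move=> z [/cb_part_sub/EY|[/FY]]. Qed.

Lemma cb_set_packing2 x y : cb_set x -> cb_set y -> r2 x y -> x = y.
Proof.
have [_ s2 _] := eq2.
move=> [Ax|[Fx nx]] [Ay|[Fy ny]] r.
- by apply: E2 => //; exact: cb_part_sub.
- by case: ny; exists x => //; exact: s2.
- by case: nx; exists y.
- exact: F2.
Qed.

(** If a forced point a were [r1]-related to a chosen b in F, the [r2]-partner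
    of b in E would be forced too. *)
Lemma cb_set_packing1 x y : cb_set x -> cb_set y -> r1 x y -> x = y.
Proof.
have [_ s1 _] := eq1; have [_ s2 _] := eq2.
have mixed a b : cb_part a -> F b -> ~ saturation r2 cb_part b -> r1 a b -> False.
  move=> [n _ Aa] Fb nb r; have [e Ee be] := E_cover (FY Fb).
  apply: nb; exists e => //; exists n.+1 => //=; split=> //.
  by exists b; [split=> //; exists a => //; exact: s1|exact: s2].
move=> [Ax|[Fx nx]] [Ay|[Fy ny]] r.
- by apply: E1 => //; exact: cb_part_sub.
- by case: (mixed x y).
- by case: (mixed y x) => //; exact: s1.
- exact: F1.
Qed.

Lemma cb_set_cover2 y : Y y -> exists2 x, cb_set x & r2 y x.
Proof.
have [_ s2 t2] := eq2.
move=> /E_cover[e Ee ye]; case: (pselect (cb_part e)) => [Ae|nAe].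
  by exists e => //; left.
have [f Ff ef] : saturation r2 F e.
  by apply: contrapT => ne; apply: nAe; exists 0%N.
exists f; last exact: t2 ye ef.
right; split=> // -[a Aa fa]; apply: nAe; suff -> : e = a by [].
apply: E2 => //; [exact: cb_part_sub|exact: t2 ef fa].
Qed.

Lemma cb_set_cover1 y : exists2 x, cb_set x & r1 y x.
Proof.
have [_ s1 t1] := eq1; have [_ s2 t2] := eq2.
have [f Ff yf] := F_cover y.
case: (pselect (saturation r2 cb_part f)) => [|nf]; last by exists f => //; right.
move=> [a [[|n] _ Aa] fa]; first by case: Aa => _; case; exists f => //; exact: s2.
have [Ea [f' [Ff' [a' Aa' fa']] aa']] := Aa.
exists a'; first by left; exists n.
apply: t1 yf _; suff -> : f = f' by [].
by apply: F2 => //; exact: t2 fa aa'.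
Qed.

End CantorBernstein.

Section WaveletTile.
Variable R : realType.
Local Notation mR := (measurableTypeR R).
Local Notation emb := (emb R).

Definition tr_eq (z w : R * R) : Prop := exists k, w = z + emb k.

Definition dil_eq (d : nat) (z w : R * R) : Prop := exists j : int, w = (d%:R ^ j : R) *: z.

Lemma equivalence_tr : equivalence_prop tr_eq.
Proof.
split=> [z|z w [k ->]|z w v [k ->] [l ->]].
- by exists 0; rewrite emb0 addr0.
- by exists (- k); rewrite embN addrK.
- by exists (k + l); rewrite embD addrA.
Qed.

Lemma equivalence_dil d : (0 < d)%N -> equivalence_prop (dil_eq d).
Proof.
move=> d0; have dn : (d%:R : R) != 0 by rewrite pnatr_eq0 -lt0n.
split=> [z|z w [k ->]|z w v [k ->] [l ->]].
- by exists 0; rewrite expr0z scale1r.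
- by exists (- k); rewrite scalerA -expfzDr // addNr expr0z scale1r.
- by exists (l + k); rewrite scalerA -expfzDr.
Qed.

Lemma measurable_saturation_tr (A : set (R * R)) : measurable (A : set (mR * mR)) ->
  measurable (saturation tr_eq A : set (mR * mR)).
Proof.
move=> mA; rewrite (_ : saturation _ _ = \bigcup_(k in setT) ((fun z => z + emb k) @^-1` A)).
  apply: countable_bigcupT_measurable => [|k]; first exact: countableP.
  by rewrite -[X in measurable X]setTI; exact: measurable_shift.
apply/seteqP; split=> z; first by move=> [a Aa [k e]]; exists k => //; rewrite /= -e.
by move=> [k _ /= Ak]; exists (z + emb k) => //; exists k.
Qed.

Lemma scale_lin4 (a : R) z : a *: z = lin4 a 0 0 a z.
Proof. by case: z => x y; rewrite /lin4 /= !mul0r addr0 add0r. Qed.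

Lemma measurable_scale_preimage (a : R) (A : set (R * R)) : measurable (A : set (mR * mR)) ->
  measurable ((fun z => a *: z) @^-1` A : set (mR * mR)).
Proof.
move=> mA; rewrite (_ : _ @^-1` A = lin4 a 0 0 a @^-1` A).
  exact: measurable_lin4_preimage.
by apply/seteqP; split=> z; rewrite /= scale_lin4.
Qed.

Lemma measurable_saturation_dil d (A : set (R * R)) : measurable (A : set (mR * mR)) ->
  measurable (saturation (dil_eq d) A : set (mR * mR)).
Proof.
move=> mA; rewrite (_ : saturation _ _ =
    \bigcup_(j in [set: int]) ((fun z => (d%:R ^ j : R) *: z) @^-1` A)).
  apply: countable_bigcupT_measurable => [|k]; first exact: countableP.
  exact: measurable_scale_preimage.
apply/seteqP; split=> z; first by move=> [a Aa [k e]]; exists k => //; rewrite /= -e.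
by move=> [k _ /= Ak]; exists ((d%:R ^ k : R) *: z) => //; exists k.
Qed.

(** Both relations have countable classes, so that saturations are countable
    unions of images under Borel isomorphisms. *)
Lemma measurable_cb_set d E F : measurable (E : set (mR * mR)) ->
  measurable (F : set (mR * mR)) ->
  measurable (cb_set tr_eq (dil_eq d) E F : set (mR * mR)).
Proof.
move=> mE mF.
have mS n : measurable (cb_stage tr_eq (dil_eq d) E F n : set (mR * mR)).
  elim: n => [|n IH] /=; first by apply: measurableD => //; exact: measurable_saturation_dil.
  apply: measurableI => //; apply: measurable_saturation_dil; apply: measurableI => //.
  exact: measurable_saturation_tr.
have mP : measurable (cb_part tr_eq (dil_eq d) E F : set (mR * mR)).
  exact: bigcupT_measurable.
apply: measurableU => //; apply: measurableD => //; exact: measurable_saturation_dil.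
Qed.

Lemma dil_normalize (d : nat) (y : R) : (2 <= d)%N -> 0 < y ->
  exists j : int, 1 <= (d%:R ^ j : R) * y < d%:R.
Proof.
move=> d2 y0; have d0 : 0 < d%:R :> R by rewrite ltr0n; lia.
have big (x : R) : exists n : nat, x < d%:R ^+ n.
  exists (Num.bound `|x|); apply: le_lt_trans (ler_norm x) _.
  apply: lt_trans (archi_boundP (normr_ge0 x)) _.
  by rewrite -natrX ltr_nat; exact: ltn_expl.
have [y1|y1] := leP 1 y.
  case: (ex_minnP (big y)) => -[|n]; first by rewrite expr0; lra.
  move=> yn min; exists (- n%:Z); rewrite -invr_expz -exprnP.
  have dn : 0 < d%:R ^+ n :> R by rewrite exprn_gt0.
  rewrite mulrC ler_pdivlMr // ltr_pdivrMr // mul1r -exprS yn andbT leNgt.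
  by apply/negP => /min; rewrite ltnn.
have exn : exists n : nat, 1 <= d%:R ^+ n * y.
  have [n hn] := big y^-1; exists n.
  by rewrite -ler_pdivrMr // mul1r ltW.
case: (ex_minnP exn) => -[|n]; first by rewrite expr0 mul1r; lra.
move=> yn min; exists n.+1%:Z; rewrite -exprnP yn /= exprS -mulrA.
rewrite -[ltRHS]mulr1 ltr_pM2l // ltNge.
by apply/negP => /min; rewrite ltnn.
Qed.

Definition sup_norm (z : R * R) : R := Num.max `|z.1| `|z.2|.

Lemma sup_normZ a z : sup_norm (a *: z) = `|a| * sup_norm z.
Proof. by rewrite /sup_norm /= !normrM maxr_pMr. Qed.

Lemma sup_norm_ge1 z : `|z.1| <= sup_norm z. Proof. by rewrite le_max lexx. Qed.
Lemma sup_norm_ge2 z : `|z.2| <= sup_norm z. Proof. by rewrite le_max lexx orbT. Qed.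

Lemma sup_norm_gt0 z : z != 0 -> 0 < sup_norm z.
Proof.
move=> z0; rewrite lt_max !normr_gt0 -negb_and; apply: contra z0.
by case: z => x y /= /andP[/eqP -> /eqP ->].
Qed.

Lemma measurable_sup_norm : measurable_fun (setT : set (mR * mR)) sup_norm.
Proof. by apply: measurable_maxr; apply: measurableT_comp. Qed.

(** The ratio of the norms of two dilates is a power of [d]. *)
Lemma dil_eq_close d (x y : R * R) : (2 <= d)%N ->
  sup_norm y < d%:R * sup_norm x -> sup_norm x < d%:R * sup_norm y ->
  dil_eq d x y -> x = y.
Proof.
move=> d2 xy yx [j e].
have d1 : 1 < d%:R :> R by rewrite ltr1n.
have d0 : 0 < d%:R :> R by rewrite ltr0n; lia.
have nE : sup_norm y = (d%:R ^ j : R) * sup_norm x.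
  by rewrite e sup_normZ gtr0_norm // exprz_gt0.
have s0 : 0 < sup_norm x.
  have : 0 <= sup_norm x by rewrite le_max normr_ge0.
  rewrite le_eqVlt => /orP[/eqP h|//]; move: xy; rewrite nE -h !mulr0; lra.
suff -> : y = x by [].
suff j0 : j = 0 by rewrite e j0 expr0z scale1r.
apply/eqP; rewrite eq_le; apply/andP; split; rewrite leNgt; apply/negP => jn.
  move: xy; rewrite nE ltr_pM2r // -[X in _ < X]expr1z ltr_eXz2l //; lia.
move: yx; rewrite nE mulrA -[X in _ < X * _ * _]expr1z -expfzDr ?gt_eqF //.
rewrite -{1}[sup_norm x]mul1r ltr_pM2r // -[X in X < _](expr0z (d%:R : R)) ltr_eXz2l //; lia.
Qed.

Lemma int_shift_small (a b : R) (k : int) :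
  `|a| < 2^-1 -> `|b| < 2^-1 -> b = a + k%:~R -> k = 0.
Proof.
move=> /ltr_normlP[a1 a2] /ltr_normlP[b1 b2] eb.
have : (-1)%:~R < k%:~R :> R by rewrite intrN; lra.
have : k%:~R < 1%:~R :> R by rewrite /=; lra.
by rewrite !ltr_int; lia.
Qed.

Lemma cell_dist (x y : R) : 0 <= x - (Num.floor y)%:~R < 1 -> `|x - y| <= 1.
Proof.
have /andP[] := floor_itv y; rewrite intrD /= => f1 f2 /andP[a b].
by rewrite ler_norml; apply/andP; split; lra.
Qed.

(** Any open cone contains a Z^2-tile whose dilates by the powers of [d] tile
    the cone: a small annulus is a packing for the translations and a tile for
    the dilations, a unit cell far out in the cone is a tile for the
    translations and a packing for the dilations, and the Cantor-Bernstein
    argument combines them. *)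
Lemma wavelet_tile (d : nat) (Y : set (R * R)) (p : R * R) (eps : R) :
  (2 <= d)%N -> measurable (Y : set (mR * mR)) ->
  (forall (t : R) z, 0 < t -> Y z -> Y (t *: z)) ->
  p != 0 -> 0 < eps -> (forall q, `|q.1| <= eps -> `|q.2| <= eps -> Y (p + q)) ->
  exists W : set (R * R), [/\ measurable (W : set (mR * mR)), tile W,
    W `<=` Y /\ (exists M : R, W `<=` box M),
    (forall z, Y z -> z != 0 -> exists j : int, W ((d%:R ^ j : R) *: z)) &
    (forall w j, W w -> W ((d%:R ^ j : R) *: w) -> j = 0)].
Proof.
move=> d2 mY YZ p0 e0 Yp.
have d1 : 1 < d%:R :> R by rewrite ltr1n.
have d2R : 2 <= d%:R :> R by rewrite (ler_nat _ 2).
have d0 : 0 < d%:R :> R by lra.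
have sp := sup_norm_gt0 p0.
(* The annulus r <= |z| < d r has d r = 1 / 2: it lies in an open square of
   side 1 and contains no two points that differ by an integer vector. *)
pose r : R := (2 * d%:R)^-1.
have r0 : 0 < r by rewrite invr_gt0 mulr_gt0.
have dr : d%:R * r = 2^-1 by rewrite /r; field; lra.
pose Y' := Y `&` [set z | 0 < sup_norm z].
have mray (a : R) : measurable ([set z | a <= sup_norm z] : set (mR * mR)).
  rewrite (_ : [set z | _] = sup_norm @^-1` `[a, +oo[%classic).
    by rewrite -[X in measurable X]setTI; exact: measurable_sup_norm.
  by apply/seteqP; split=> z; rewrite /= in_itv /= andbT.
have mlt (a : R) : measurable ([set z | sup_norm z < a] : set (mR * mR)).
  rewrite (_ : [set z | _] = ~` [set z | a <= sup_norm z]); first exact: measurableC.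
  by apply/seteqP; split=> z /=; rewrite ltNge => /negP.
pose E := Y `&` ([set z | r <= sup_norm z] `&` [set z | sup_norm z < d%:R * r]).
have mE : measurable (E : set (mR * mR)) by do 2 apply: measurableI => //.
(* The unit cell F lies within distance 1 of t p: since t >= 1 / eps it is in
   the cone, and since |t p| > 4 its points have norms within a factor less
   than 2. *)
pose t : R := eps^-1 + 4 / sup_norm p.
have t0 : 0 < t by rewrite addr_gt0 ?invr_gt0 ?divr_gt0.
pose K : int * int := (Num.floor (t * p.1), Num.floor (t * p.2)).
pose F := (fun z => z + - emb K) @^-1` (@unit_square R).
have mF : measurable (F : set (mR * mR)).
  rewrite -[X in measurable X]setTI; apply: measurable_shift => //.
  exact: measurable_unit_square.
have Fq z : F z -> `|(z - t *: p).1| <= 1 /\ `|(z - t *: p).2| <= 1.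
  by rewrite /F /unit_square /= !in_itv /= => -[/cell_dist ? /cell_dist].
have Fn z : F z -> t * sup_norm p - 1 <= sup_norm z <= t * sup_norm p + 1.
  move=> /Fq[]; rewrite /= /GRing.scale /= => h1 h2.
  have -> : t * sup_norm p = Num.max `|t * p.1| `|t * p.2|.
    by rewrite !normrM (gtr0_norm t0) maxr_pMr // ltW.
  have := ler_normB z.1 (z.1 - t * p.1); have := ler_normB (t * p.1) (- (z.1 - t * p.1)).
  have := ler_normB z.2 (z.2 - t * p.2); have := ler_normB (t * p.2) (- (z.2 - t * p.2)).
  rewrite !opprK !normrN !subKr !(addrC (t * _)) !subrK => a1 a2 a3 a4.
  apply/andP; split.
    rewrite lerBlDr ge_max /sup_norm; apply/andP; split.
      by have := sup_norm_ge1 z; rewrite /sup_norm; lra.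
    by have := sup_norm_ge2 z; rewrite /sup_norm; lra.
  rewrite ge_max; apply/andP; split.
    have : `|t * p.1| <= Num.max `|t * p.1| `|t * p.2| by rewrite le_max lexx.
    lra.
  have : `|t * p.2| <= Num.max `|t * p.1| `|t * p.2| by rewrite le_max lexx orbT.
  lra.
have tp4 : 4 < t * sup_norm p.
  by rewrite /t mulrDl divfK ?gt_eqF // ltrDr mulr_gt0 ?invr_gt0.
have EY' : E `<=` Y' by move=> z [Yz [/= a b]]; split=> //=; lra.
have FY' : F `<=` Y'.
  move=> z Fz; split; last by have /andP[] := Fn z Fz; rewrite /=; lra.
  have -> : z = t *: (p + t^-1 *: (z - t *: p)).
    rewrite scalerDr scalerA mulfV ?gt_eqF // scale1r addrC subrK //.
  apply: YZ => //; have [q1 q2] := Fq z Fz.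
  have te : t^-1 <= eps.
    by rewrite -[eps]invrK lef_pV2 ?posrE ?invr_gt0 // /t lerDl divr_ge0 ?ltW.
  by apply: Yp; rewrite /= normrM gtr0_norm ?invr_gt0 //;
    apply: le_trans te; rewrite -[leRHS]mulr1 ler_pM2l ?invr_gt0.
have E1 x y : E x -> E y -> tr_eq x y -> x = y.
  move=> [_ [_ /= x2]] [_ [_ /= y2]] [[m n] e].
  rewrite dr in x2 y2.
  have m0 : m = 0.
    apply: (@int_shift_small x.1 y.1); last by rewrite e.
      exact: le_lt_trans (sup_norm_ge1 x) x2.
    exact: le_lt_trans (sup_norm_ge1 y) y2.
  have n0 : n = 0.
    apply: (@int_shift_small x.2 y.2); last by rewrite e.
      exact: le_lt_trans (sup_norm_ge2 x) x2.
    exact: le_lt_trans (sup_norm_ge2 y) y2.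
  by rewrite e m0 n0 emb0 addr0.
have E2 x y : E x -> E y -> dil_eq d x y -> x = y.
  by move=> [_ [/= x1 x2]] [_ [/= y1 y2]]; apply: dil_eq_close => //; nra.
have F1 x y : F x -> F y -> tr_eq x y -> x = y.
  have [pF _] := tile_shift (- emb K) (@tile_unit_square R).
  by move=> Fx + [k e]; rewrite e => /(pF _ _ Fx) ->; rewrite emb0 addr0.
have F2 x y : F x -> F y -> dil_eq d x y -> x = y.
  move=> /Fn/andP[x1 x2] /Fn/andP[y1 y2]; apply: dil_eq_close => //; nra.
have Ec y : Y' y -> exists2 x, E x & dil_eq d y x.
  move=> [Yy /= y0]; have [j /andP[j1 j2]] := dil_normalize d2 (divr_gt0 y0 r0).
  have dj : 0 < (d%:R ^ j : R) by rewrite exprz_gt0.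
  exists ((d%:R ^ j : R) *: y); last by exists j.
  rewrite mulrA ler_pdivlMr // mul1r in j1; rewrite mulrA ltr_pdivrMr // in j2.
  split; first exact: YZ.
  by split; rewrite /= sup_normZ gtr0_norm.
have Fc y : exists2 x, F x & tr_eq y x.
  have [_ /(_ y)[k Fk]] := tile_shift (- emb K) (@tile_unit_square R).
  by exists (y + emb k) => //; exists k.
have eqd := equivalence_dil (ltnW d2).
exists (cb_set tr_eq (dil_eq d) E F); split.
- exact: measurable_cb_set.
- split=> [z k Wz Wk|z].
    have := cb_set_packing1 equivalence_tr eqd FY' E1 F1 Ec Wz Wk.
    have zk : tr_eq z (z + emb k) by exists k.
    move=> /(_ zk)/eqP; rewrite -{1}[z]addr0 (inj_eq (addrI z)) -emb0.
    by move=> /eqP/(@emb_inj R).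
  have [w Ww [k e]] := cb_set_cover1 E equivalence_tr eqd F2 Fc z.
  by exists k; rewrite -e.
- split=> [z /(cb_set_sub EY' FY')[]//|].
  exists (t * sup_norm p + 2) => z Wz.
  have zle : sup_norm z < t * sup_norm p + 2.
    case: Wz => [[n _ Wz]|[Fz _]]; last by have /andP[_] := Fn z Fz; lra.
    have Ez : E z by apply: cb_stage_sub Wz.
    by move: Ez => [_ [_ /=]]; rewrite dr; lra.
  have /ltr_normlP[a1 a2] := le_lt_trans (sup_norm_ge1 z) zle.
  have /ltr_normlP[b1 b2] := le_lt_trans (sup_norm_ge2 z) zle.
  by split; rewrite /= in_itv /=; apply/andP; split; lra.
- move=> z Yz z0; have Yz' : Y' z by split=> //; exact: sup_norm_gt0.
  by have [w Ww [j e]] := @cb_set_cover2 _ tr_eq _ _ _ F eqd E2 Ec _ Yz'; exists j; rewrite -e.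
- move=> w j Ww Wj; have wj : dil_eq d w ((d%:R ^ j : R) *: w) by exists j.
  have e := cb_set_packing2 eqd E2 F2 Ww Wj wj.
  have [_ /= w0] := cb_set_sub EY' FY' Ww.
  have := congr1 sup_norm e; rewrite sup_normZ gtr0_norm ?exprz_gt0 //.
  rewrite -{1}[sup_norm w]mul1r => /(mulIf (lt0r_neq0 w0)).
  rewrite -{1}(expr0z (d%:R : R)) => /(ieexprIz d0) -> //.
  by rewrite gt_eqF.
Qed.

End WaveletTile.

(** * Dirichlet cones of finite orthogonal groups *)

Section OrthogonalAction.
Variable R : realType.
Local Notation mR := (measurableTypeR R).
Local Notation area := (@area R).
Implicit Types (L M : O2 R) (z w p : R * R).

(** A head symbol of its own for the action of an isometry on points keeps the
    coercion of isometries to matrices out of rewriting. *)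
Definition ap L z : R * R := mx_point L z.

Lemma ap_mul L M z : ap (O2_mul L M) z = ap L (ap M z).
Proof. exact: mx_pointM. Qed.

Lemma ap_one z : ap (O2_one R) z = z.
Proof. exact: mx_point1. Qed.

Lemma O2_mulV L : O2_mul (O2_inv L) L = O2_one R.
Proof. by apply/val_inj; rewrite /= mulVmx ?O2_unit. Qed.

Lemma O2_mulrV L : O2_mul L (O2_inv L) = O2_one R.
Proof. by apply/val_inj; rewrite /= mulmxV ?O2_unit. Qed.

Lemma O2_mulA L M N : O2_mul L (O2_mul M N) = O2_mul (O2_mul L M) N.
Proof. by apply/val_inj; rewrite /= mulmxA. Qed.

Lemma O2_mul1 L : O2_mul (O2_one R) L = L.
Proof. by apply/val_inj; rewrite /= mul1mx. Qed.

Lemma O2_mulr1 L : O2_mul L (O2_one R) = L.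
Proof. by apply/val_inj; rewrite /= mulmx1. Qed.

Lemma ap_invK L z : ap (O2_inv L) (ap L z) = z.
Proof. by rewrite -ap_mul O2_mulV ap_one. Qed.

Lemma ap_Kinv L z : ap L (ap (O2_inv L) z) = z.
Proof. by rewrite -ap_mul O2_mulrV ap_one. Qed.

Lemma O2_entries L : [/\ L 0 0 ^+ 2 + L 1 0 ^+ 2 = 1, L 0 1 ^+ 2 + L 1 1 ^+ 2 = 1 &
  L 0 0 * L 0 1 + L 1 0 * L 1 1 = 0].
Proof.
have e i j : \sum_k L k i * L k j = (i == j)%:R.
  have := congr1 (fun A : 'M[R]_2 => A i j) (O2_tr L); rewrite !mxE => <-.
  by apply: eq_bigr => k _; rewrite !mxE.
have h1 := e 0 0; have h2 := e 1 1; have h3 := e 0 1.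
rewrite !big_ord_recl !big_ord0 /= in h1 h2 h3.
have i1 : lift ord0 ord0 = 1 :> 'I_2 by exact/val_inj.
rewrite i1 in h1 h2 h3; split; [rewrite -[RHS]h1|rewrite -[RHS]h2|rewrite -[RHS]h3]; ring.
Qed.

Lemma dot_ap L z w : dot (ap L z) (ap L w) = dot z w.
Proof.
have [e1 e2 e3] := O2_entries L; rewrite /dot /ap /mx_point /=.
transitivity ((L 0 0 ^+ 2 + L 1 0 ^+ 2) * (z.1 * w.1) + (L 0 1 ^+ 2 + L 1 1 ^+ 2) * (z.2 * w.2) +
  (L 0 0 * L 0 1 + L 1 0 * L 1 1) * (z.1 * w.2 + z.2 * w.1)); first by ring.
by rewrite e1 e2 e3; ring.
Qed.

Lemma dot_ap_inv L z w : dot (ap (O2_inv L) z) w = dot z (ap L w).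
Proof. by rewrite -(dot_ap L) ap_Kinv. Qed.

Lemma O2_det L : (L 0 0 * L 1 1 - L 0 1 * L 1 0) ^+ 2 = 1.
Proof.
have [e1 e2 e3] := O2_entries L.
transitivity ((L 0 0 ^+ 2 + L 1 0 ^+ 2) * (L 0 1 ^+ 2 + L 1 1 ^+ 2) -
  (L 0 0 * L 0 1 + L 1 0 * L 1 1) ^+ 2); first by ring.
by rewrite e1 e2 e3; ring.
Qed.

Lemma O2_ext L M : L 0 0 = M 0 0 -> L 0 1 = M 0 1 -> L 1 0 = M 1 0 -> L 1 1 = M 1 1 -> L = M.
Proof.
move=> e1 e2 e3 e4; apply/val_inj/matrixP => i j.
have i1 (h : (1 < 2)%N) : Ordinal h = 1 :> 'I_2 by exact/val_inj.
have i0 (h : (0 < 2)%N) : Ordinal h = 0 :> 'I_2 by exact/val_inj.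
by case: i => [[|[|//]] hi]; case: j => [[|[|//]] hj]; rewrite ?i0 ?i1.
Qed.

(** An isometry is determined by the images of two independent vectors. *)
Lemma ap_eq L M z w : z.1 * w.2 - z.2 * w.1 != 0 -> ap L z = ap M z -> ap L w = ap M w -> L = M.
Proof.
move=> D0 [z1 z2] [w1 w2].
have cramer (a b a' b' : R) : a * z.1 + b * z.2 = a' * z.1 + b' * z.2 ->
    a * w.1 + b * w.2 = a' * w.1 + b' * w.2 -> a = a' /\ b = b'.
  move=> h1 h2.
  have ea : (a - a') * (z.1 * w.2 - z.2 * w.1) = 0.
    transitivity ((a * z.1 + b * z.2 - (a' * z.1 + b' * z.2)) * w.2 -
      (a * w.1 + b * w.2 - (a' * w.1 + b' * w.2)) * z.2); first by ring.
    by rewrite h1 h2; ring.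
  have eb : (b - b') * (z.1 * w.2 - z.2 * w.1) = 0.
    transitivity ((a * w.1 + b * w.2 - (a' * w.1 + b' * w.2)) * z.1 -
      (a * z.1 + b * z.2 - (a' * z.1 + b' * z.2)) * w.1); first by ring.
    by rewrite h1 h2; ring.
  move/eqP: ea; move/eqP: eb; rewrite !mulf_eq0 (negbTE D0) !orbF !subr_eq0.
  by move=> /eqP -> /eqP ->.
have [e1 e2] := cramer _ _ _ _ z1 w1; have [e3 e4] := cramer _ _ _ _ z2 w2.
exact: O2_ext.
Qed.

Lemma dotC z w : dot z w = dot w z.
Proof. by rewrite /dot; ring. Qed.
Lemma dotDl z w v : dot (z + w) v = dot z v + dot w v.
Proof. by rewrite /dot /=; ring. Qed.
Lemma dotBr z w v : dot z (w - v) = dot z w - dot z v.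
Proof. by rewrite /dot /=; ring. Qed.
Lemma dotZl t z w : dot (t *: z) w = t * dot z w.
Proof. by rewrite /dot /= /GRing.scale /=; ring. Qed.
Lemma dot_self_gt0 z : z != 0 -> 0 < dot z z.
Proof.
move=> z0; rewrite /dot lt_neqAle addr_ge0 -?expr2 ?sqr_ge0 // andbT eq_sym.
rewrite paddr_eq0 ?sqr_ge0 // !sqrf_eq0; apply: contra z0.
by case: z => x y /= /andP[/eqP -> /eqP ->].
Qed.

Lemma area_line w : w != 0 -> area [set z | dot z w = 0] = 0%E.
Proof.
move=> w0; have m0 : measurable ([set 0] : set mR) by exact: measurable_set1.
have z0 (A : set R) : measurable (A : set mR) -> area (A `*` [set 0]) = 0%E.
  by move=> mA; rewrite area_rect // lebesgue_measure_set1 mule0.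
have [w2|w2] := eqVneq w.2 0.
  have w1 : w.1 != 0.
    apply: contra w0 => /eqP w1; apply/eqP; move: w1 w2; case: w => x y /= -> -> //.
  have D0 : 0 * 0 - 1 * w.1 != 0 by rewrite mul0r sub0r mul1r oppr_eq0.
  rewrite (_ : [set z | _] = lin4 0 1 w.1 0 @^-1` (setT `*` [set 0])).
    by rewrite area_scaling_all ?z0 ?mule0 //; exact: measurableX.
  apply/seteqP; split=> z; rewrite /dot /lin4 /= w2 mulr0 mul0r !addr0 mulrC; last by case.
  by move=> h; split.
have D0 : 1 * w.2 - 0 * w.1 != 0 by rewrite mul0r subr0 mul1r.
rewrite (_ : [set z | _] = lin4 1 0 w.1 w.2 @^-1` (setT `*` [set 0])).
  by rewrite area_scaling_all ?z0 ?mule0 //; exact: measurableX.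
apply/seteqP; split=> z; rewrite /dot /lin4 /= mulrC (mulrC z.2); last by case.
by move=> h; split.
Qed.

Lemma measurable_line w : measurable ([set z | dot z w = 0] : set (mR * mR)).
Proof.
rewrite (_ : [set z | _] = dot w @^-1` [set 0]).
  by rewrite -[X in measurable X]setTI; apply: measurable_dot => //; exact: measurable_set1.
by apply/seteqP; split=> z; rewrite /= dotC.
Qed.

End OrthogonalAction.

Section DirichletCone.
Variable R : realType.
Local Notation mR := (measurableTypeR R).
Local Notation area := (@area R).
Implicit Types (L M : O2 R) (z w p : R * R).

Variables (P : set (O2 R)) (s : seq (O2 R)).
Hypotheses (Ps : forall L, P L <-> L \in s).
Hypotheses (P1 : P (O2_one R)) (PM : forall L M, P L -> P M -> P (O2_mul L M))
  (PV : forall L, P L -> P (O2_inv L)).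

(** A nontrivial isometry fixes at most one point (1, t), so a finite group
    leaves all points with large t without stabilizer. *)
Lemma generic_point : exists p, p != 0 /\ forall L, P L -> ap L p = p -> L = O2_one R.
Proof.
suff [N hN] : exists N : R, forall t L, N <= t -> L \in s -> ap L (1, t) = (1, t) -> L = O2_one R.
  exists (1, N); split=> [|L /Ps Ls e]; first by apply/eqP => -[/eqP]; rewrite oner_eq0.
  exact: hN e.
elim: s => [|L l [N hN]]; first by exists 0.
have [N' hN'] : exists N' : R, forall t, N' <= t -> ap L (1, t) = (1, t) -> L = O2_one R.
  case: (pselect (exists t : R, ap L (1, t) = (1, t))) => [[t0 e0]|no]; last first.
    by exists 0 => t _ e; case: no; exists t.
  exists (t0 + 1) => t tt e; apply: (@ap_eq _ _ _ (1, t0) (1, t)); rewrite ?ap_one //=.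
  by rewrite mul1r mulr1 subr_eq0; apply/eqP; lra.
exists (Num.max N N') => t M; rewrite ge_max inE => /andP[a b] /orP[/eqP ->|Ml].
  exact: hN'.
exact: hN.
Qed.

Variable p : R * R.
Hypotheses (p0 : p != 0) (gp : forall L, P L -> ap L p = p -> L = O2_one R).

(** The open Dirichlet region of [p] for its orbit under [P]: as isometries
    preserve norms, being closest to p among the points of the orbit means
    maximizing the scalar product. It is a fundamental domain of [P] up to
    finitely many lines, and a cone. *)
Definition dirichlet : set (R * R) :=
  [set z | forall L, P L -> L != O2_one R -> dot z (ap L p) < dot z p].

Lemma orbit_inj L M : P L -> P M -> ap L p = ap M p -> L = M.
Proof.
move=> PL PMm e; have := gp (PM (PV PMm) PL); rewrite ap_mul e ap_invK => /(_ erefl) h.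
by rewrite -[L]O2_mul1 -(O2_mulrV M) -O2_mulA h O2_mulr1.
Qed.

Lemma dirichletZ (t : R) z : 0 < t -> dirichlet z -> dirichlet (t *: z).
Proof. by move=> t0 Yz L PL L1; rewrite !dotZl ltr_pM2l // Yz. Qed.

Lemma measurable_dirichlet : measurable (dirichlet : set (mR * mR)).
Proof.
have -> : dirichlet = [set z | forall L, L \in s -> L != O2_one R -> dot z (ap L p) < dot z p].
  by apply/seteqP; split=> z h L /Ps; exact: h.
elim: s => [|L l IH].
  by rewrite (_ : [set z | _] = setT) //; apply/seteqP; split=> // z _ L.
rewrite (_ : [set z | _] = [set z | L != O2_one R -> dot z (ap L p) < dot z p] `&`
   [set z | forall L, L \in l -> L != O2_one R -> dot z (ap L p) < dot z p]).
  apply: measurableI => //; have [->|L1] := eqVneq L (O2_one R).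
    by rewrite (_ : [set z | _] = setT) //; apply/seteqP; split=> // z _ /=; rewrite eqxx.
  have md q : measurable_fun (setT : set (mR * mR)) (fun z => dot z q).
    by have := measurable_dot q; congr measurable_fun; apply/funext => z; rewrite dotC.
  rewrite (_ : [set z | _] = (fun z => dot z p - dot z (ap L p)) @^-1` `]0, +oo[%classic).
    rewrite -[X in measurable X]setTI; apply: measurable_funB => //; exact: measurable_itv.
  apply/seteqP; split=> z /=; rewrite in_itv /= andbT subr_gt0; first by move=> /(_ isT).
  by [].
apply/seteqP; split=> z /=.
  move=> h; split=> [L1|M Ml]; first by apply: h => //; exact: mem_head.
  by apply: h; rewrite inE Ml orbT.
by move=> [h1 h2] M; rewrite inE => /orP[/eqP ->|/h2].
Qed.

Lemma dirichlet_open : exists2 eps : R, 0 < eps &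
  forall q, `|q.1| <= eps -> `|q.2| <= eps -> dirichlet (p + q).
Proof.
suff [eps e0 he] : exists2 eps : R, 0 < eps & forall q L, `|q.1| <= eps -> `|q.2| <= eps ->
    L \in [seq L <- s | L != O2_one R] -> dot (p + q) (ap L p) < dot (p + q) p.
  by exists eps => // q q1 q2 L /Ps Ls L1; apply: he => //; rewrite mem_filter L1.
have : forall L, L \in [seq L <- s | L != O2_one R] -> 0 < dot p (p - ap L p).
  move=> L; rewrite mem_filter => /andP[L1 /Ps PL].
  have pw : p - ap L p != 0.
    by rewrite subr_eq0; apply: contra L1 => /eqP e; apply/eqP; apply: gp.
  have := dot_self_gt0 pw; rewrite dotBr (dotC _ p) (dotC _ (ap L p)) !dotBr dot_ap.
  by rewrite (dotC (ap L p) p); lra.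
elim: [seq _ <- _ | _] => [|L l IH] h; first by exists 1.
have [M Ml|eps e0 he] := IH; first by apply: h; rewrite inE Ml orbT.
have dL := h L (mem_head _ _); set w := p - ap L p in dL.
(* Moving p by at most c in each coordinate changes its scalar product with w
   by less than half. *)
pose c := dot p w / (2 * (`|w.1| + `|w.2| + 1)).
have w0 : 0 < 2 * (`|w.1| + `|w.2| + 1) by rewrite mulr_gt0 // ltr_wpDl // addr_ge0.
have c0 : 0 < c by rewrite divr_gt0.
exists (Num.min eps c); first by rewrite lt_min e0.
move=> q M; rewrite !le_min => /andP[q1 q1'] /andP[q2 q2']; rewrite inE => /orP[/eqP ->|].
  rewrite -subr_gt0 -dotBr -/w dotDl.
  have b1 : `|q.1 * w.1| <= c * `|w.1| by rewrite normrM ler_wpM2r.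
  have b2 : `|q.2 * w.2| <= c * `|w.2| by rewrite normrM ler_wpM2r.
  have cE : c * (2 * (`|w.1| + `|w.2| + 1)) = dot p w by rewrite /c divfK // gt_eqF.
  move: b1 b2; rewrite /dot => /ler_normlP[b1 _] /ler_normlP[b2 _].
  have cw1 : 0 <= c * `|w.1| by rewrite mulr_ge0 // ltW.
  have cw2 : 0 <= c * `|w.2| by rewrite mulr_ge0 // ltW.
  move: cE; rewrite /dot; lra.
exact: he.
Qed.

(** The isometry [L] is the one for which <z, L p> is the strict maximum over
    the orbit. *)
Lemma dirichlet_disjoint L M z : P L -> P M ->
  dirichlet (ap (O2_inv L) z) -> dirichlet (ap (O2_inv M) z) -> L = M.
Proof.
move=> PL PMm YL YM; apply/eqP/negPn/negP => LM.
have key L' M' : P L' -> P M' -> L' != M' -> dirichlet (ap (O2_inv L') z) ->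
    dot z (ap M' p) < dot z (ap L' p).
  move=> PL' PM' ne h; have PN := PM (PV PL') PM'.
  have N1 : O2_mul (O2_inv L') M' != O2_one R.
    by apply: contra ne => /eqP e; rewrite -[L']O2_mulr1 -e O2_mulA O2_mulrV O2_mul1.
  by have := h _ PN N1; rewrite !dot_ap_inv ap_mul ap_Kinv.
have := key _ _ PL PMm LM YL; rewrite eq_sym in LM.
by have := key _ _ PMm PL LM YM; lra.
Qed.

Lemma seq_argmax (T : eqType) (l : seq T) (f : T -> R) x : x \in l ->
  exists2 y, y \in l & forall v, v \in l -> f v <= f y.
Proof.
elim: l x => [//|a l IH] x _; case: l IH => [|b l] IH.
  by exists a => [|v]; [exact: mem_head|rewrite inE => /eqP ->].
have [y yl hy] := IH b (mem_head _ _).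
have [ay|ya] := leP (f a) (f y).
  by exists y => [|v]; rewrite inE ?yl ?orbT // => /orP[/eqP ->|/hy].
exists a => [|v]; first exact: mem_head.
by rewrite inE => /orP[/eqP ->|/hy] // /le_trans; apply; exact: ltW.
Qed.

(** A maximum of <z, L p> over [P] exists as [P] is finite, and it is strict
    unless z lies on one of finitely many lines. *)
Lemma dirichlet_cover : exists N : set (R * R), [/\ measurable (N : set (mR * mR)),
  area N = 0%E & forall z, ~ N z -> exists2 L, P L & dirichlet (ap (O2_inv L) z)].
Proof.
pose N := \big[setU/set0]_(LM <- [seq (L, M) | L <- s, M <- s] | LM.1 != LM.2)
  [set z | dot z (ap LM.1 p - ap LM.2 p) = 0].
have memP LM : LM \in [seq (L, M) | L <- s, M <- s] -> P LM.1 /\ P LM.2.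
  by move=> /allpairsP[[L M] /= [/Ps ? /Ps ? ->]].
have [mN N0] : measurable (N : set (mR * mR)) /\ area N = 0%E.
  rewrite /N big_seq_cond; elim/big_ind: _ => [|A B [mA A0] [mB B0]|LM /andP[/memP[PL PMm] ne]].
  - by split; [exact: measurable0|rewrite measure0].
  - by split; [exact: measurableU|rewrite null_set_setU].
  - split; first exact: measurable_line.
    by apply: area_line; rewrite subr_eq0; apply: contra ne => /eqP/(orbit_inj PL PMm) ->.
exists N; split=> // z Nz.
have [L Ls hL] := seq_argmax (fun L => dot z (ap L p)) ((Ps _).1 P1).
have PL := (Ps L).2 Ls; exists L => // M PMm M1.
rewrite !dot_ap_inv -ap_mul; have PLM := PM PL PMm.
rewrite lt_neqAle hL ?andbT; last exact/Ps.
apply/eqP => e; apply: Nz; rewrite /N.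
rewrite (big_rem (O2_mul L M, L)) /=; last by apply/allpairsP; exists (O2_mul L M, L); split=> //; exact/Ps.
case: ifPn => [_|/negPn/eqP h]; first by left; rewrite /= dotBr e subrr.
by case/eqP: M1; rewrite -[M]O2_mul1 -(O2_mulV L) -O2_mulA h.
Qed.

End DirichletCone.

(** * Groups of motions over a lattice *)

Section LatticeGroups.
Variable R : realType.
Implicit Types (L M : O2 R) (x z s u v : R * R) (g h : motion R).

Lemma pair_ext z x : z.1 = x.1 -> z.2 = x.2 -> z = x.
Proof. by case: z => a b; case: x => c d /= -> ->. Qed.

Section Lattice.
Variables u v : R * R.

Definition lattice (k : int * int) : R * R := k.1%:~R *: u + k.2%:~R *: v.

Lemma latticeD k l : lattice (k + l) = lattice k + lattice l.
Proof. by rewrite /lattice !intrD !scalerDl addrACA. Qed.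

Lemma latticeN k : lattice (- k) = - lattice k.
Proof. by rewrite /lattice !intrN !scaleNr opprD. Qed.

Lemma lattice0 : lattice 0 = 0.
Proof. by rewrite /lattice !scale0r addr0. Qed.

Lemma ap_lattice L k : ap L (lattice k) = k.1%:~R *: ap L u + k.2%:~R *: ap L v.
Proof.
by rewrite /ap /lattice mx_pointD; congr (_ + _); congr pair; rewrite /= /GRing.scale /=; ring.
Qed.

Definition in_lattice : set (R * R) := range lattice.

Lemma in_latticeD x z : in_lattice x -> in_lattice z -> in_lattice (x + z).
Proof. by move=> [k _ <-] [l _ <-]; exists (k + l) => //; rewrite latticeD. Qed.

Lemma in_latticeN x : in_lattice x -> in_lattice (- x).
Proof. by move=> [k _ <-]; exists (- k) => //; rewrite latticeN. Qed.

Lemma in_latticeB x z : in_lattice x -> in_lattice z -> in_lattice (x - z).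
Proof. by move=> lx /in_latticeN; exact: in_latticeD. Qed.

Lemma in_latticeZ (n : int) x : in_lattice x -> in_lattice (n%:~R *: x).
Proof.
move=> [k _ <-]; exists (n * k.1, n * k.2) => //.
by rewrite /lattice /= !intrM scalerDr !scalerA.
Qed.

(** The conditions on the inverse make this property pass to inverses without
    computing determinants of integer matrices. *)
Definition lattice_auto L : Prop := [/\ in_lattice (ap L u), in_lattice (ap L v),
  in_lattice (ap (O2_inv L) u) & in_lattice (ap (O2_inv L) v)].

Lemma lattice_auto_ap L x : lattice_auto L -> in_lattice x -> in_lattice (ap L x).
Proof.
move=> [lu lv _ _] [k _ <-]; rewrite ap_lattice.
by apply: in_latticeD; exact: in_latticeZ.
Qed.

Lemma O2_invK L : O2_inv (O2_inv L) = L.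
Proof. by apply/val_inj; rewrite /= invmxK. Qed.

Lemma O2_inv1 : O2_inv (O2_one R) = O2_one R.
Proof. by apply/val_inj; rewrite /= invmx1. Qed.

Lemma O2_invM L M : O2_inv (O2_mul L M) = O2_mul (O2_inv M) (O2_inv L).
Proof.
apply/val_inj; rewrite /= -/(O2_mx (O2_mul L M)) (O2_invmx (O2_mul L M)) trmx_mul.
by rewrite -!O2_invmx.
Qed.

Lemma lattice_auto_inv L : lattice_auto L -> lattice_auto (O2_inv L).
Proof. by move=> [? ? ? ?]; split; rewrite ?O2_invK. Qed.

Lemma lattice_auto_mul L M : lattice_auto L -> lattice_auto M -> lattice_auto (O2_mul L M).
Proof.
move=> aL aM; have [? ? _ _] := aM; have [_ _ ? ?] := aL.
have aM' := lattice_auto_inv aM.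
by split; rewrite ?O2_invM ap_mul; apply: lattice_auto_ap.
Qed.

Lemma in_lattice_u : in_lattice u.
Proof. by exists (1, 0) => //; rewrite /lattice /= scale1r scale0r addr0. Qed.
Lemma in_lattice_v : in_lattice v.
Proof. by exists (0, 1) => //; rewrite /lattice /= scale1r scale0r add0r. Qed.
Lemma in_lattice0 : in_lattice 0.
Proof. by exists 0 => //; rewrite lattice0. Qed.

(** An explicit group of motions containing a wallpaper group: modulo the
    lattice, the translation part depends only on the determinant and is 0 for
    rotations, [s] for reflections. It separates the translations of a group
    given by generators from the rest. *)
Definition twisted_motions s : set (motion R) := [set g | [/\ lattice_auto (lin g),
  in_lattice (ap (lin g) s - s) &
  exists b : bool, \det (lin g) = (-1) ^+ b /\ in_lattice (trans g - (b%:R : R) *: s)]].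

Lemma apD L x z : ap L (x + z) = ap L x + ap L z. Proof. exact: mx_pointD. Qed.
Lemma apN L x : ap L (- x) = - ap L x. Proof. exact: mx_pointN. Qed.
Lemma apB L x z : ap L (x - z) = ap L x - ap L z. Proof. by rewrite apD apN. Qed.

Lemma twisted_motionsV s g : in_lattice (s + s) -> twisted_motions s g -> twisted_motions s g^-1%g.
Proof.
case: g => x L ss [/= aL sL [b [dL xb]]]; split=> /=.
- exact: lattice_auto_inv.
- have := lattice_auto_ap (lattice_auto_inv aL) (in_latticeN sL).
  by rewrite opprB apB ap_invK.
- exists b; split.
    by rewrite det_inv dL; case: b {dL xb} => /=; rewrite ?expr1 ?invrN1 ?invr1.
  case: b dL xb => _ /=; last first.
    rewrite !scale0r !subr0 => /(lattice_auto_ap aL); exact: in_latticeN.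
  rewrite !scale1r => /(lattice_auto_ap aL); rewrite apB => h.
  have := in_latticeN (in_latticeD (in_latticeD h sL) ss); congr in_lattice.
  by apply: pair_ext; rewrite /=; ring.
Qed.

(** Modulo the lattice all isometries involved fix s and 2 s vanishes, so that
    the translation parts add up like the determinants multiply. *)
Lemma twisted_motionsM s g h : in_lattice (s + s) ->
  twisted_motions s g -> twisted_motions s h -> twisted_motions s (g * h)%g.
Proof.
case: g => x L; case: h => y M ss [/= aL sL [b [dL xb]]] [/= aM sM [c [dM yc]]]; split=> /=.
- exact: lattice_auto_mul.
- have := in_latticeD (lattice_auto_ap aL sM) sL.
  by rewrite apB ap_mul addrA subrK.
- exists (b (+) c); split; first by rewrite det_mulmx dL dM signr_addb.
  have aMV := lattice_auto_inv aM.
  have h1 := in_latticeD (lattice_auto_ap aMV xb) yc.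
  have sMV := lattice_auto_ap aMV (in_latticeN sM); rewrite opprB apB ap_invK in sMV.
  rewrite -/(ap (O2_inv M) x); case: b dL xb h1 => _ xb; case: c dM yc => _ yc /=;
    rewrite ?scale1r ?scale0r ?subr0 // ?apB => h1.
  + by have := in_latticeD (in_latticeD h1 sMV) ss; congr in_lattice;
      apply: pair_ext; rewrite /=; ring.
  + by have := in_latticeD h1 sMV; congr in_lattice;
      apply: pair_ext; rewrite /=; ring.
  + by move: h1; rewrite addrA.
Qed.

Lemma twisted_motions1 s : twisted_motions s 1%g.
Proof.
split=> /=.
- by split; rewrite ?O2_inv1 ap_one; [exact: in_lattice_u|exact: in_lattice_v|exact: in_lattice_u|exact: in_lattice_v].
- by rewrite ap_one subrr; exact: in_lattice0.
- exists false; rewrite det1 /= scale0r subr0; split=> //; exact: in_lattice0.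
Qed.

Lemma generated_twisted s (S : set (motion R)) : in_lattice (s + s) ->
  S `<=` twisted_motions s -> generated S `<=` twisted_motions s.
Proof.
move=> ss Ss g; elim=> [h /Ss//||h1 h2 _ t1 _ t2|h _ t1].
- exact: twisted_motions1.
- exact: twisted_motionsM.
- exact: twisted_motionsV.
Qed.

Lemma twisted_motions_translation s x : twisted_motions s (Motion x (O2_one R)) -> in_lattice x.
Proof.
move=> [_ _ [b [/= d1 xb]]]; move: d1 xb; rewrite det1; case: b => /=.
  by move=> /eqP; rewrite expr1 -subr_eq0 opprK -mulr2n pnatr_eq0.
by rewrite scale0r subr0.
Qed.

Lemma generated_lattice (S : set (motion R)) k :
  S (translation u) -> S (translation v) -> generated S (translation (lattice k)).
Proof.
move=> Su Sv.
have gD x z : generated S (translation x) -> generated S (translation z) ->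
    generated S (translation (x + z)).
  move=> gx gz; have := generated_mul gx gz; congr generated.
  congr Motion => /=; first by rewrite invmx1 mx_point1.
  by rewrite O2_mul1.
have gZ x (n : int) : generated S (translation x) -> generated S (translation (n%:~R *: x)).
  move=> gx; have gn (m : nat) : generated S (translation (m%:R *: x)).
    elim: m => [|m IH]; first by rewrite scale0r; exact: generated_one.
    by rewrite -[m.+1]addn1 natrD scalerDl scale1r; exact: gD.
  case: n => n; first exact: gn.
  have := generated_inv (gn n.+1); congr generated; congr Motion => /=.
    by rewrite mx_point1 NegzE intrN scaleNr.
  by apply/val_inj; rewrite /= invmx1.
by apply: gD; apply: gZ; exact: generated_gen.
Qed.

End Lattice.
End LatticeGroups.

(** * The wallpaper groups *)

Section PointGroups.
Variable R : realType.
Implicit Types (L M : O2 R) (x z s u v : R * R) (g h : motion R).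

Lemma finite_int_interval (n : nat) : finite_set [set k : int | `|k| <= n%:Z].
Proof.
apply: (@sub_finite_set _ _ ((fun i : 'I_(2 * n).+1 => (i : nat)%:Z - n%:Z) @` setT)).
  move=> k /= kn; have h : (absz (k + n%:Z)%R < (2 * n).+1)%N by lia.
  by exists (Ordinal h) => //=; lia.
exact/finite_image/finite_finset.
Qed.

(** The rule of Cramer bounds the coordinates of a lattice point by its
    length. *)
Lemma finite_lattice_ball u v (q : R) : u.1 * v.2 - u.2 * v.1 != 0 ->
  finite_set [set x | in_lattice u v x /\ dot x x <= q].
Proof.
move=> D0; set D := _ - _ in D0.
pose C := (1 + q) * (`|u.1| + `|u.2| + `|v.1| + `|v.2|) / `|D|.
pose K := [set k : int | `|k| <= (Num.bound C)%:Z].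
apply: (@sub_finite_set _ _ (lattice u v @` (K `*` K))); last first.
  by apply/finite_image/finite_setX; exact: finite_int_interval.
move=> _ [[k _ <-]]; set x := lattice u v k => xq.
have le1 (a b : R) : a ^+ 2 + b ^+ 2 <= q -> `|a| <= 1 + q.
  by move=> h; rewrite ler_norml; apply/andP; split; nra.
have x1 : `|x.1| <= 1 + q by apply: (le1 _ x.2); rewrite !expr2.
have x2 : `|x.2| <= 1 + q by apply: (le1 _ x.1); rewrite addrC !expr2.
have q0 : 0 <= 1 + q by apply: le_trans x1.
have key (j : int) (a b : R) : j%:~R * D = x.1 * a - x.2 * b ->
    `|a| + `|b| <= `|u.1| + `|u.2| + `|v.1| + `|v.2| -> K j.
  move=> e ab; rewrite /K /= -(ler_int R) intr_norm; apply: le_trans (ltW (archi_boundP _)).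
    rewrite /C ler_pdivlMr ?normr_gt0 // -normrM e.
    apply: le_trans (ler_normB _ _) _; rewrite !normrM.
    apply: (@le_trans _ _ ((1 + q) * (`|a| + `|b|))); last by rewrite ler_wpM2l.
    by rewrite mulrDr lerD // ler_wpM2r.
  by rewrite divr_ge0 // mulr_ge0 // !addr_ge0.
exists k => //; split.
  apply: (key _ v.2 v.1); last by have := normr_ge0 u.1; have := normr_ge0 u.2; lra.
  by rewrite /D /x /lattice /= /GRing.scale /=; ring.
apply: (key _ (- u.2) (- u.1)); last first.
  by rewrite !normrN; have := normr_ge0 v.1; have := normr_ge0 v.2; lra.
by rewrite /D /x /lattice /= /GRing.scale /=; ring.
Qed.

(** An isometry preserving the lattice is determined by the images of u and v,
    which are lattice points of given length. *)
Lemma finite_lattice_auto u v : u.1 * v.2 - u.2 * v.1 != 0 ->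
  finite_set [set L | lattice_auto u v L].
Proof.
move=> D0; pose B (w : R * R) := [set x | in_lattice u v x /\ dot x x <= dot w w].
pose h (zw : (R * R) * (R * R)) := xget (O2_one R) [set L | ap L u = zw.1 /\ ap L v = zw.2].
apply: (@sub_finite_set _ _ (h @` (B u `*` B v))); last first.
  by apply/finite_image/finite_setX; exact: finite_lattice_ball.
move=> L [Lu Lv _ _]; exists (ap L u, ap L v); first by split; split; rewrite /= ?dot_ap.
rewrite /h; case: xgetP => [M _ [e1 e2]|/(_ L)]; last by case.
exact: (ap_eq D0).
Qed.

Lemma ap_sigma v z : dot v v != 0 -> ap (sigma v) z = (2 * dot v z / dot v v) *: v - z.
Proof.
move=> v0; apply: pair_ext; rewrite /ap /mx_point /= !mxE /coord /= /GRing.scale /=;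
by rewrite /dot in v0 *; field.
Qed.

Lemma O2_inv_sigma v : O2_inv (sigma v) = sigma v.
Proof.
apply/val_inj; rewrite /= (O2_invmx (sigma v)); apply/matrixP => i j; rewrite !mxE eq_sym.
by congr (_ / _ - _); rewrite mulrAC.
Qed.

Lemma det_O2 L : \det L = L 0 0 * L 1 1 - L 0 1 * L 1 0.
Proof.
rewrite (expand_det_row _ ord0) !big_ord_recl big_ord0 /cofactor !det_mx11 !mxE /= addr0.
have i1 : lift ord0 ord0 = 1 :> 'I_2 by exact/val_inj.
have i0 : lift 1 0 = 0 :> 'I_2 by exact/val_inj.
by rewrite i1 i0 expr0 expr1 mul1r mulN1r mulrN.
Qed.

Lemma det_sigma v : dot v v != 0 -> \det (sigma v) = -1.
Proof.
by move=> v0; rewrite det_O2 !mxE /coord /=; rewrite /dot in v0 *; field.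
Qed.

Lemma det_rho n : \det (rho R n) = 1.
Proof. by rewrite det_O2 !mxE /=; rewrite -[RHS](cos2Dsin2 (2 * pi / n%:R)); ring. Qed.

Lemma ap_rho n (c s : R) : cos (2 * pi / n%:R) = c -> sin (2 * pi / n%:R) = s ->
  forall z, ap (rho R n) z = (c * z.1 - s * z.2, s * z.1 + c * z.2) /\
    ap (O2_inv (rho R n)) z = (c * z.1 + s * z.2, c * z.2 - s * z.1).
Proof.
move=> <- <- z; rewrite /ap /mx_point /= (O2_invmx (rho R n)) !mxE /=.
by split; congr pair; ring.
Qed.

Lemma ap_rho2 z : ap (rho R 2) z = - z /\ ap (O2_inv (rho R 2)) z = - z.
Proof.
have e : 2 * pi / 2%:R = pi :> R by field.
have [||-> ->] := @ap_rho 2 (-1) 0 _ _ z; rewrite ?e ?cospi ?sinpi //.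
by split; apply: pair_ext; rewrite /=; ring.
Qed.

Lemma ap_rho4 z : ap (rho R 4) z = (- z.2, z.1) /\ ap (O2_inv (rho R 4)) z = (z.2, - z.1).
Proof.
have e : 2 * pi / 4%:R = pi / 2 :> R by field.
have [||-> ->] := @ap_rho 4 0 1 _ _ z; rewrite ?e ?cos_pihalf ?sin_pihalf //.
by split; apply: pair_ext; rewrite /=; ring.
Qed.

Definition sqrt3half : R := Num.sqrt 3 / 2.

Lemma sqrt3half2 : sqrt3half ^+ 2 = 3 / 4.
Proof. by rewrite /sqrt3half exprMn sqr_sqrtr // exprVn; field. Qed.

Lemma sqrt3half_gt0 : 0 < sqrt3half.
Proof. by rewrite divr_gt0 // sqrtr_gt0. Qed.

(** With c = cos (pi / 3), the addition formulas applied to cos pi = -1 give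
    (c + 1) (2 c - 1)^2 = 0. *)
Lemma cos_pi3 : cos (pi / 3) = 2^-1 :> R.
Proof.
set t := pi / 3; have p0 := pi_gt0 R.
have c0 : 0 < cos t by apply: cos_gt0_pihalf; rewrite /t; apply/andP; split; lra.
have e : pi = t *+ 2 + t by rewrite /t; field.
have := cospi R; rewrite {1}e cosD cos_mulr2n sin_mulr2n => h.
have : (cos t + 1) * (2 * cos t - 1) ^+ 2 = 0.
  transitivity ((cos t ^+ 2 *+ 2 - 1) * cos t - (cos t * sin t) *+ 2 * sin t + 1 +
    2 * cos t * (cos t ^+ 2 + sin t ^+ 2 - 1)); first by ring.
  by rewrite h cos2Dsin2; ring.
by move=> /eqP; rewrite mulf_eq0 sqrf_eq0 => /orP[/eqP|/eqP]; lra.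
Qed.

Lemma sin_pi3 : sin (pi / 3) = sqrt3half.
Proof.
have p0 := pi_gt0 R.
have s0 : 0 < sin (pi / 3 : R) by apply: sin_gt0_pihalf; apply/andP; split; lra.
have := cos2Dsin2 (pi / 3 : R); rewrite cos_pi3 => h.
apply/eqP; rewrite -(@eqrXn2 _ 2) ?ltW ?sqrt3half_gt0 // sqrt3half2; apply/eqP; lra.
Qed.

Lemma ap_rho6 z : ap (rho R 6) z = (z.1 / 2 - sqrt3half * z.2, sqrt3half * z.1 + z.2 / 2) /\
  ap (O2_inv (rho R 6)) z = (z.1 / 2 + sqrt3half * z.2, z.2 / 2 - sqrt3half * z.1).
Proof.
have e : 2 * pi / 6%:R = pi / 3 :> R by field.
have [||-> ->] := @ap_rho 6 (2^-1) sqrt3half _ _ z; rewrite ?e ?cos_pi3 ?sin_pi3 //.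
by split; apply: pair_ext; rewrite /=; ring.
Qed.

Lemma ap_rho3 z : ap (rho R 3) z = (- (z.1 / 2) - sqrt3half * z.2, sqrt3half * z.1 - z.2 / 2) /\
  ap (O2_inv (rho R 3)) z = (- (z.1 / 2) + sqrt3half * z.2, - (z.2 / 2) - sqrt3half * z.1).
Proof.
have e : 2 * pi / 3%:R = (pi / 3) *+ 2 :> R by field.
have [||-> ->] := @ap_rho 3 (- 2^-1) sqrt3half _ _ z; rewrite ?e.
- by rewrite cos_mulr2n cos_pi3; field.
- by rewrite sin_mulr2n cos_pi3 sin_pi3; field.
by split; apply: pair_ext; rewrite /=; ring.
Qed.

Lemma ap_sigma01 z : ap (sigma (0, 1)) z = (- z.1, z.2).
Proof.
rewrite ap_sigma /dot /= ?mul0r ?add0r ?mul1r ?oner_eq0 //.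
by apply: pair_ext; rewrite /= /GRing.scale /=; field.
Qed.

Lemma ap_sigma10 z : ap (sigma (1, 0)) z = (z.1, - z.2).
Proof.
rewrite ap_sigma /dot /= ?mul0r ?addr0 ?mul1r ?oner_eq0 //.
by apply: pair_ext; rewrite /= /GRing.scale /=; field.
Qed.

Lemma ap_sigma11 z : ap (sigma (1, 1)) z = (z.2, z.1).
Proof.
rewrite ap_sigma /dot /= ?mul1r ?(pnatr_eq0 _ 2) //.
by apply: pair_ext; rewrite /= /GRing.scale /=; field.
Qed.

Lemma dot_sqrt3half : dot (sqrt3half, 2^-1) (sqrt3half, 2^-1) = 1.
Proof. by rewrite /dot /= -expr2 sqrt3half2; field. Qed.

Lemma ap_sigma30 z :
  ap (sigma (sqrt3half, 2^-1)) z = (z.1 / 2 + sqrt3half * z.2, sqrt3half * z.1 - z.2 / 2).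
Proof.
have h2 := sqrt3half2; rewrite ap_sigma dot_sqrt3half ?oner_eq0 // divr1.
apply: pair_ext; rewrite /dot /= /GRing.scale /=; last by field.
transitivity (2 * sqrt3half ^+ 2 * z.1 + sqrt3half * z.2 - z.1); first by field.
by rewrite h2; field.
Qed.

End PointGroups.

Section WallpaperLattices.
Variable R : realType.
Implicit Types (L M : O2 R) (x z s u v : R * R) (g h : motion R).
Local Notation e1 := ((1, 0) : R * R).
Local Notation e2 := ((0, 1) : R * R).
Local Notation hex := ((2^-1, Num.sqrt 3 / 2) : R * R).

(** It suffices to find the images of the basis vectors among the shortest
    vectors of the lattice. *)
Lemma square_auto L : ap L e1 \in [:: e1; - e1; e2; - e2] -> ap L e2 \in [:: e1; - e1; e2; - e2] ->
  ap (O2_inv L) e1 \in [:: e1; - e1; e2; - e2] -> ap (O2_inv L) e2 \in [:: e1; - e1; e2; - e2] ->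
  lattice_auto e1 e2 L.
Proof.
have h x : x \in [:: e1; - e1; e2; - e2] -> in_lattice e1 e2 x.
  have l1 := in_lattice_u e1 e2; have l2 := in_lattice_v e1 e2.
  by rewrite !inE => /or4P[] /eqP ->; do ?[exact: in_latticeN|exact: l1|exact: l2].
by move=> /h ? /h ? /h ? /h ?; split.
Qed.

Lemma hex_auto L : let H := [:: e1; - e1; hex; - hex; hex - e1; e1 - hex] in
  ap L e1 \in H -> ap L hex \in H -> ap (O2_inv L) e1 \in H -> ap (O2_inv L) hex \in H ->
  lattice_auto e1 hex L.
Proof.
move=> H; have h x : x \in H -> in_lattice e1 hex x.
  have l1 := in_lattice_u e1 hex; have l2 := in_lattice_v e1 hex.
  have l3 := in_latticeB l1 l2; have l4 := in_latticeB l2 l1.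
  have l5 := in_latticeN l1; have l6 := in_latticeN l2.
  by rewrite !inE => /or4P[/eqP ->|/eqP ->|/eqP ->|/or3P[] /eqP ->].
by move=> /h ? /h ? /h ? /h ?; split.
Qed.

Lemma mem_nth_eq (x : R * R) (H : seq (R * R)) (i : nat) :
  (i < size H)%N -> x = nth 0 H i -> x \in H.
Proof. by move=> iH ->; exact: mem_nth. Qed.

Lemma auto_rho2 : lattice_auto e1 e2 (rho R 2).
Proof.
by apply: square_auto; rewrite ?(ap_rho2 _).1 ?(ap_rho2 _).2;
  [apply: (@mem_nth_eq _ _ 1)|apply: (@mem_nth_eq _ _ 3)|apply: (@mem_nth_eq _ _ 1)|apply: (@mem_nth_eq _ _ 3)].
Qed.

Lemma auto_rho4 : lattice_auto e1 e2 (rho R 4).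
Proof.
by apply: square_auto; rewrite ?(ap_rho4 _).1 ?(ap_rho4 _).2;
  [apply: (@mem_nth_eq _ _ 2)|apply: (@mem_nth_eq _ _ 1)|apply: (@mem_nth_eq _ _ 3)|apply: (@mem_nth_eq _ _ 0)];
  rewrite //=; apply: pair_ext; rewrite /= ?oppr0.
Qed.

Lemma auto_sigma01 : lattice_auto e1 e2 (sigma (0, 1)).
Proof.
by apply: square_auto; rewrite ?O2_inv_sigma ap_sigma01;
  [apply: (@mem_nth_eq _ _ 1)|apply: (@mem_nth_eq _ _ 2)|apply: (@mem_nth_eq _ _ 1)|apply: (@mem_nth_eq _ _ 2)];
  rewrite //=; apply: pair_ext; rewrite /= ?oppr0.
Qed.

Lemma auto_sigma11 : lattice_auto e1 e2 (sigma (1, 1)).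
Proof.
by apply: square_auto; rewrite ?O2_inv_sigma ap_sigma11;
  [apply: (@mem_nth_eq _ _ 2)|apply: (@mem_nth_eq _ _ 0)|apply: (@mem_nth_eq _ _ 2)|apply: (@mem_nth_eq _ _ 0)].
Qed.

Lemma auto_rho3 : lattice_auto e1 hex (rho R 3).
Proof.
have h2 := sqrt3half2 R.
apply: hex_auto; rewrite ?(ap_rho3 _).1 ?(ap_rho3 _).2 -?/(sqrt3half R);
  [apply: (@mem_nth_eq _ _ 4)|apply: (@mem_nth_eq _ _ 1)|apply: (@mem_nth_eq _ _ 3)|apply: (@mem_nth_eq _ _ 5)];
  rewrite //=; apply: pair_ext; rewrite /= -?/(sqrt3half R); nra.
Qed.

Lemma auto_rho6 : lattice_auto e1 hex (rho R 6).
Proof.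
have h2 := sqrt3half2 R.
apply: hex_auto; rewrite ?(ap_rho6 _).1 ?(ap_rho6 _).2 -?/(sqrt3half R);
  [apply: (@mem_nth_eq _ _ 2)|apply: (@mem_nth_eq _ _ 4)|apply: (@mem_nth_eq _ _ 5)|apply: (@mem_nth_eq _ _ 0)];
  rewrite //=; apply: pair_ext; rewrite /= -?/(sqrt3half R); nra.
Qed.

Lemma auto_hex_sigma10 : lattice_auto e1 hex (sigma (1, 0)).
Proof.
apply: hex_auto; rewrite ?O2_inv_sigma ap_sigma10;
  [apply: (@mem_nth_eq _ _ 0)|apply: (@mem_nth_eq _ _ 5)|apply: (@mem_nth_eq _ _ 0)|apply: (@mem_nth_eq _ _ 5)];
  rewrite //=; apply: pair_ext; rewrite /=; lra.
Qed.

Lemma auto_hex_sigma01 : lattice_auto e1 hex (sigma (0, 1)).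
Proof.
apply: hex_auto; rewrite ?O2_inv_sigma ap_sigma01;
  [apply: (@mem_nth_eq _ _ 1)|apply: (@mem_nth_eq _ _ 4)|apply: (@mem_nth_eq _ _ 1)|apply: (@mem_nth_eq _ _ 4)];
  rewrite //=; apply: pair_ext; rewrite /=; lra.
Qed.

Lemma auto_hex_sigma30 : lattice_auto e1 hex (sigma (Num.sqrt 3 / 2, 2^-1)).
Proof.
have h2 := sqrt3half2 R.
apply: hex_auto; rewrite -?/(sqrt3half R) ?O2_inv_sigma ap_sigma30;
  [apply: (@mem_nth_eq _ _ 2)|apply: (@mem_nth_eq _ _ 0)|apply: (@mem_nth_eq _ _ 2)|apply: (@mem_nth_eq _ _ 0)];
  rewrite //=; apply: pair_ext; rewrite /= -?/(sqrt3half R); nra.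
Qed.

(** The translation part, modulo the lattice, of the orientation-reversing
    elements. *)
Definition glide_shift (w : wallpaper) : R * R :=
  match w with
  | pg | pmg => (0, 2^-1)
  | pgg | p4g => (2^-1, 2^-1)
  | _ => 0
  end.

Lemma twisted_direct u v s L : lattice_auto u v L -> in_lattice u v (ap L s - s) ->
  \det L = 1 -> twisted_motions u v s (linear_motion L).
Proof.
move=> aL sL d1; split=> //; exists false; rewrite expr0 scale0r subr0; split=> //.
exact: in_lattice0.
Qed.

Lemma twisted_opposite u v s L : lattice_auto u v L -> in_lattice u v (ap L s - s) ->
  \det L = -1 -> twisted_motions u v s (Motion s L).
Proof.
move=> aL sL d1; split=> //; exists true; rewrite expr1 scale1r subrr; split=> //.
exact: in_lattice0.
Qed.

Lemma twisted_translation u v s x : in_lattice u v x -> twisted_motions u v s (translation x).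
Proof.
move=> lx; have [a1 a2 _] := twisted_motions1 u v s; split=> //.
by exists false; rewrite det1 /= scale0r subr0.
Qed.

Lemma glide_shift_double w u v : lattice_basis R w = (u, v) ->
  in_lattice u v (glide_shift w + glide_shift w).
Proof.
have z : (0 : R * R) + 0 = 0 by rewrite addr0.
have h : 2^-1 + 2^-1 = 1 :> R by field.
case: w => /= -[<- <-]; rewrite ?z; try exact: in_lattice0.
- by exists (0, 1) => //; apply: pair_ext; rewrite /= /GRing.scale /=; lra.
- by exists (0, 1) => //; apply: pair_ext; rewrite /= /GRing.scale /=; lra.
- by exists (1, 1) => //; apply: pair_ext; rewrite /= /GRing.scale /=; lra.
- by exists (1, 1) => //; apply: pair_ext; rewrite /= /GRing.scale /=; lra.
Qed.

Lemma ap0_sub0 L : ap L 0 - 0 = 0.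
Proof. by apply: pair_ext; rewrite /=; ring. Qed.

Lemma wallpaper_twisted w u v : lattice_basis R w = (u, v) ->
  wallpaper_group w `<=` twisted_motions u v (glide_shift w).
Proof.
move=> eb; have r2 := det_rho R 2; have r3 := det_rho R 3; have r4 := det_rho R 4; have r6 := det_rho R 6.
have s01 : \det (sigma e2) = -1 by apply: det_sigma; rewrite /dot /= mul0r mul1r add0r oner_eq0.
have s10 : \det (sigma e1) = -1 by apply: det_sigma; rewrite /dot /= mul0r mul1r addr0 oner_eq0.
have s11 : \det (sigma ((1, 1) : R * R)) = -1.
  by apply: det_sigma; rewrite /dot /= mul1r -(natrD _ 1 1) pnatr_eq0.
have s30 : \det (sigma ((Num.sqrt 3 / 2, 2^-1) : R * R)) = -1.
  by apply: det_sigma; rewrite dot_sqrt3half oner_eq0.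
have z a b L : in_lattice a b (ap L 0 - 0) by rewrite ap0_sub0; exact: in_lattice0.
have a2 := auto_rho2; have a4 := auto_rho4; have b01 := auto_sigma01; have b11 := auto_sigma11.
have a3 := auto_rho3; have a6 := auto_rho6; have h10 := auto_hex_sigma10.
have h01 := auto_hex_sigma01; have h30 := auto_hex_sigma30.
have half_turn : in_lattice e1 e2 (ap (rho R 2) (0, 2^-1) - (0, 2^-1)).
  rewrite (ap_rho2 _).1; exists (0, -1) => //.
  by apply: pair_ext; rewrite /= /GRing.scale /=; lra.
have half_turn' : in_lattice e1 e2 (ap (rho R 2) (2^-1, 2^-1) - (2^-1, 2^-1)).
  rewrite (ap_rho2 _).1; exists (-1, -1) => //.
  by apply: pair_ext; rewrite /= /GRing.scale /=; lra.
have glide01 : in_lattice e1 e2 (ap (sigma (0, 1)) (0, 2^-1) - (0, 2^-1)).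
  rewrite ap_sigma01 oppr0 subrr; exact: in_lattice0.
have ss := glide_shift_double eb; rewrite /wallpaper_group eb.
apply: generated_twisted => // g [[->|->]|].
- exact/twisted_translation/in_lattice_u.
- exact/twisted_translation/in_lattice_v.
move: eb {ss}; case: w => /= -[<- <-] //.
- by move=> ->; exact: twisted_direct.
- by move=> ->; exact: twisted_opposite.
- by move=> ->; apply: twisted_opposite => //; exact: glide01.
- by move=> [->|->]; [exact: twisted_direct|exact: twisted_opposite].
- move=> [->|->]; first by apply: twisted_direct => //; exact: half_turn.
  by apply: twisted_opposite => //; exact: glide01.
- move=> [->|->]; first by apply: twisted_direct => //; exact: half_turn'.
  apply: twisted_opposite => //; rewrite ap_sigma01; exists (-1, 0) => //.
  by apply: pair_ext; rewrite /= /GRing.scale /=; lra.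
- by move=> ->; exact: twisted_direct.
- by move=> [->|->]; [exact: twisted_direct|exact: twisted_opposite].
- move=> [->|->]; [apply: twisted_direct => //|apply: twisted_opposite => //].
    rewrite (ap_rho4 _).1; exists (-1, 0) => //.
    by apply: pair_ext; rewrite /= /GRing.scale /=; lra.
  by rewrite ap_sigma11 subrr; exact: in_lattice0.
- by move=> ->; exact: twisted_opposite.
- by move=> [->|->]; [exact: twisted_direct|exact: twisted_opposite].
- by move=> ->; exact: twisted_direct.
- by move=> [->|->]; [exact: twisted_direct|exact: twisted_opposite].
- by move=> [->|->]; [exact: twisted_direct|exact: twisted_opposite].
- by move=> ->; exact: twisted_direct.
- by move=> [->|->]; [exact: twisted_direct|exact: twisted_opposite].
Qed.

Lemma lattice_basis_indep w u v : lattice_basis R w = (u, v) -> u.1 * v.2 - u.2 * v.1 != 0.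
Proof.
by rewrite /lattice_basis => -[<- <-]; case: is_hexagonal; rewrite /= mul0r subr0 mul1r.
Qed.

(** Products of translations and glide reflections could produce translations
    outside the lattice; the enclosing group [twisted_motions] excludes that. *)
Lemma wallpaper_translation w u v x : lattice_basis R w = (u, v) ->
  wallpaper_group w (translation x) <-> in_lattice u v x.
Proof.
move=> eb; have := wallpaper_twisted eb; rewrite /wallpaper_group eb => h.
split=> [/h/twisted_motions_translation//|[k _ <-]].
by apply: generated_lattice; left; [left|right].
Qed.

Definition point_group (G : set (motion R)) : set (O2 R) := [set L | exists x, G (Motion x L)].

Lemma finite_point_group w : finite_set (point_group (wallpaper_group w)).
Proof.
case eb : (lattice_basis R w) => [u v].
have h := wallpaper_twisted eb; have D0 := lattice_basis_indep eb.
apply: sub_finite_set (finite_lattice_auto D0) => L [x /h[]] //.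
Qed.

End WallpaperLattices.

(** * Transport of approximations *)

Section ApproximationTransfer.
Variable R : realType.
Local Notation C := R[i].

(** Approximability is transported by any bounded map of L^2 that sends the
    generators to multiples of generators. *)
Lemma approx_map (I J : choiceType) (D : set I) (D' : set J) (e : I -> R * R -> C)
    (e' : J -> R * R -> C) (m : I -> J) (c : C) (K : R) (f f' : R * R -> C) :
  0 <= K -> cmeas f' -> (forall i, D i -> D' (m i)) ->
  (forall l, (forall t, t \in l -> D t.2) ->
     (sq (fun z => f' z - lincomb e' [seq (t.1 * c, m t.2) | t <- l] z)%R
      <= K%:E * sq (fun z => f z - lincomb e l z)%R)%E) ->
  approx D e f -> approx D' e' f'.
Proof.
move=> K0 mf' Dm h [_ hf]; split=> // eps e0.
have K1 : 0 < K + 1 by lra.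
have [l Dl hl] := hf _ (divr_gt0 e0 K1).
exists [seq (t.1 * c, m t.2) | t <- l].
  by move=> _ /mapP[t tl ->] /=; apply/Dm/Dl.
apply: le_lt_trans (h l Dl) _.
apply: (@le_lt_trans _ _ (K%:E * (eps / (K + 1))%:E)%E).
  by rewrite lee_wpmul2l ?lee_fin // ltW.
by rewrite -EFinM lte_fin mulrA ltr_pdivrMr // mulrC ltr_pM2l; lra.
Qed.

Lemma bbs_lin4 a b c d (f : R * R -> C) : a * d - b * c != 0 -> bbs f ->
  bbs (fun z => f (lin4 a b c d z)).
Proof.
move=> D0 [mf bf [M f0]]; set D := _ - _ in D0.
split.
- exact: (cmeas_comp (@measurable_lin4 R a b c d)).
- exact: cbounded_comp.
pose N := (`|M| * (`|a| + `|b| + `|c| + `|d|)) / `|D| + 1.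
exists N => z zN; apply: f0 => -[]; rewrite /= !in_itv /= => y1 y2.
have D0' : 0 < `|D| by rewrite normr_gt0.
have hx (x y : R) : - M <= x < M -> `|x * y| <= `|M| * `|y|.
  move=> /andP[x1 x2]; rewrite normrM ler_wpM2r //.
  by rewrite (le_trans _ (ler_norm M)) // ler_norml x1 ltW.
have a1 := hx _ d y1; have a2 := hx _ b y2; have a3 := hx _ c y1; have a4 := hx _ a y2.
have M0 : 0 <= `|M| by [].
have key (t s1 s2 p q : R) : `|s1| <= `|M| * p -> `|s2| <= `|M| * q -> 0 <= p -> 0 <= q ->
    p + q <= `|a| + `|b| + `|c| + `|d| -> t * D = s1 - s2 -> - N <= t < N.
  move=> h1 h2 p0 q0 pq e.
  have : `|t| <= (`|M| * (`|a| + `|b| + `|c| + `|d|)) / `|D|.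
    rewrite ler_pdivlMr // -normrM e (le_trans (ler_normB _ _)) //.
    by rewrite (le_trans (lerD h1 h2)) // -mulrDr ler_wpM2l.
  by move=> /ler_normlP[t1 t2]; rewrite /N; apply/andP; split; lra.
apply: zN; split; rewrite /= in_itv /=.
  apply: (key _ _ _ `|d| `|b| a1 a2) => //; first by have := normr_ge0 a; have := normr_ge0 c; lra.
  by rewrite /D /lin4 /=; ring.
apply: (key _ _ _ `|a| `|c| a4 a3) => //; first by have := normr_ge0 b; have := normr_ge0 d; lra.
by rewrite /D /lin4 /=; ring.
Qed.

End ApproximationTransfer.

(** * Approximation on countably many pieces *)

Section ApproximationOnPieces.
Variable R : realType.
Local Notation mR := (measurableTypeR R).
Local Notation area := (@area R).
Local Notation C := R[i].

Lemma sq_off_null (N : set (R * R)) (f : R * R -> C) : measurable (N : set (mR * mR)) ->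
  area N = 0%E -> cmeas f -> sq (cut (~` N) f) = sq f.
Proof.
move=> mN N0 mf; have mg : cmeas (cut (~` N) f) by apply: cmeas_cut => //; exact: measurableC.
rewrite /sq (ge0_negligible_integral mN measurableT (measurable_csqE mg)) //; last first.
  by move=> z _; rewrite lee_fin csq_ge0.
rewrite [RHS](ge0_negligible_integral mN measurableT (measurable_csqE mf)) //; last first.
  by move=> z _; rewrite lee_fin csq_ge0.
apply: eq_integral => z /set_mem[_ Nz]; rewrite cutE mem_set //.
Qed.

(** Finite sums of the restrictions of [h] to the pieces converge to [h]
    outside of [N], dominated by [h]. *)
Lemma approx_pieces (I : choiceType) (D : set I) (e : I -> R * R -> C)
    (A : nat -> set (R * R)) (N : set (R * R)) (h : R * R -> C) :
  (forall i, D i -> cmeas (e i)) ->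
  (forall n, measurable (A n : set (mR * mR))) ->
  (forall n m z, A n z -> A m z -> n = m) ->
  measurable (N : set (mR * mR)) -> area N = 0%E ->
  (forall z, ~ N z -> exists n, A n z) ->
  in_L2 h -> (forall n, approx D e (cut (A n) h)) -> approx D e h.
Proof.
move=> me mA dA mN N0 cA /in_L2P[mh sh] ah.
pose S n := [set z | exists2 m, (m < n)%N & A m z].
have Sn n : S n.+1 = S n `|` A n.
  apply/seteqP; split=> z.
    by move=> [m]; rewrite ltnS leq_eqVlt => /orP[/eqP -> Az|mn Az]; [right|left; exists m].
  by move=> [[m mn Az]|Az]; [exists m => //; exact: ltnW|exists n].
have aS n : approx D e (cut (S n) h).
  elim: n => [|n IH].
    rewrite (_ : cut _ h = fun=> 0); first exact: approx0.
    by apply/funext => z; rewrite cutE memNset // => -[].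
  rewrite (_ : cut _ h = fun z => cut (S n) h z + cut (A n) h z); first exact: approxD.
  apply/funext => z; rewrite !cutE Sn in_setU.
  case: (boolP (z \in S n)) => [/set_mem[m mn Am]|_] /=; last by rewrite add0r.
  rewrite memNset ?addr0 // => An; move: mn; rewrite (dA _ _ _ An Am); lia.
have mS n : cmeas (cut (S n) h) by have [] := aS n.
apply: approx_lim => // eps e0.
suff [n hn] : exists n, (sq (cut (~` N) (fun z => h z - cut (S n) h z)%R) < eps%:E)%E.
  exists (cut (S n) h) => //.
  by rewrite -(sq_off_null mN N0) //; exact: cmeasB.
apply: (sq_dominated (F := fun n => cut (~` N) (fun z => h z - cut (S n) h z))
  (G := fun z => csq (h z))) => //.
- by move=> n; apply: cmeas_cut; [exact: measurableC|exact: cmeasB].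
- apply/integrableP; split; first exact: measurable_csqE.
  rewrite (_ : integral _ _ _ = sq h) //; apply: eq_integral => z _ /=.
  by rewrite ger0_norm ?csq_ge0.
- move=> n z; rewrite !cutE; case: ifP => _; last by rewrite csq0 csq_ge0.
  by case: ifP => _; rewrite ?subrr ?subr0 // csq0 csq_ge0.
- move=> z; apply: cvg_near_cst; have [Nz|Nz] := pselect (N z).
    by apply: nearW => n; rewrite cutE memNset ?csq0 //=; exact/not_notP.
  have [m Am] := cA z Nz; exists m.+1 => // n /= mn.
  by rewrite !cutE [z \in S n]mem_set ?subrr ?csq0 ?if_same ?csq0 //; exists m.
Qed.

End ApproximationOnPieces.

(** * Coordinates dual to a lattice *)

Section DualCoordinates.
Variable R : realType.
Local Notation mR := (measurableTypeR R).
Local Notation area := (@area R).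
Local Notation C := R[i].
Implicit Types (L : O2 R) (x z xi eta zeta : R * R).

Variables u v : R * R.
Local Notation D := (u.1 * v.2 - u.2 * v.1).
Hypothesis D0 : D != 0.

(** Pairing with the lattice basis identifies the dual lattice with Z^2. *)
Definition pairing xi : R * R := lin4 u.1 u.2 v.1 v.2 xi.
Definition pairing_inv : R * R -> R * R := lin4 (v.2 / D) (- u.2 / D) (- v.1 / D) (u.1 / D).
Definition basis_coord x : R * R := ((x.1 * v.2 - x.2 * v.1) / D, (u.1 * x.2 - u.2 * x.1) / D).

Lemma pairingK xi : pairing_inv (pairing xi) = xi.
Proof. by apply: pair_ext; rewrite /pairing_inv /pairing /lin4 /=; field. Qed.
Lemma pairing_invK zeta : pairing (pairing_inv zeta) = zeta.
Proof. by apply: pair_ext; rewrite /pairing_inv /pairing /lin4 /=; field. Qed.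
Lemma pairingZ (t : R) xi : pairing (t *: xi) = t *: pairing xi.
Proof. by apply: pair_ext; rewrite /pairing /lin4 /= /GRing.scale /=; ring. Qed.

Lemma dot_basis_coord x xi : dot (basis_coord x) (pairing xi) = dot x xi.
Proof. by rewrite /dot /basis_coord /pairing /lin4 /=; field. Qed.

Lemma basis_coordD x z : basis_coord (x + z) = basis_coord x + basis_coord z.
Proof. by apply: pair_ext; rewrite /basis_coord /=; field. Qed.
Lemma basis_coordN x : basis_coord (- x) = - basis_coord x.
Proof. by apply: pair_ext; rewrite /basis_coord /=; field. Qed.
Lemma basis_coord_lattice k : basis_coord (lattice u v k) = emb R k.
Proof. by apply: pair_ext; rewrite /basis_coord /lattice /emb /= /GRing.scale /=; field. Qed.

Lemma wave_basis_coord x xi : wave (basis_coord x) (pairing xi) = wave x xi.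
Proof. by rewrite /wave dot_basis_coord. Qed.

Section ScaledIsometry.
Variables (a : R) (L : O2 R).
Hypothesis a0 : 0 < a.

(** The linear map by which the element of the wavelet system at scale [a] and
    with linear part [L] pulls back the standard piece: its spectrum is, up to
    a character, the indicator function of the inverse image of the Z^2-tile. *)
Definition dual_map eta : R * R := pairing (a^-1 *: ap (O2_inv L) eta).
Definition dual_map_inv zeta : R * R := a *: ap L (pairing_inv zeta).

Lemma dual_mapK eta : dual_map_inv (dual_map eta) = eta.
Proof.
rewrite /dual_map_inv /dual_map pairingK; have -> (t : R) z : ap L (t *: z) = t *: ap L z.
  by apply: pair_ext; rewrite /= /GRing.scale /=; ring.
by rewrite ap_Kinv scalerA mulfV ?scale1r // gt_eqF.
Qed.

Lemma dual_map_lin4 : exists p q r t : R, (forall eta, dual_map eta = lin4 p q r t eta) /\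
  `|p * t - q * r| = `|D| / a ^+ 2.
Proof.
pose M := O2_inv L; pose b := a^-1.
exists (b * (u.1 * M 0 0 + u.2 * M 1 0)), (b * (u.1 * M 0 1 + u.2 * M 1 1)),
  (b * (v.1 * M 0 0 + v.2 * M 1 0)), (b * (v.1 * M 0 1 + v.2 * M 1 1)); split.
  move=> eta; rewrite /dual_map -/M -/b; apply: pair_ext;
    by rewrite /pairing /ap /mx_point /lin4 /= /GRing.scale /=; ring.
have -> : b * (u.1 * M 0 0 + u.2 * M 1 0) * (b * (v.1 * M 0 1 + v.2 * M 1 1)) -
   b * (u.1 * M 0 1 + u.2 * M 1 1) * (b * (v.1 * M 0 0 + v.2 * M 1 0)) =
   D * (M 0 0 * M 1 1 - M 0 1 * M 1 0) * b ^+ 2 by ring.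
have d1 : `|M 0 0 * M 1 1 - M 0 1 * M 1 0| = 1.
  by apply/eqP; rewrite -(@eqrXn2 _ 2) // -normrX O2_det normr1 expr1n.
have b0 : 0 <= b by rewrite invr_ge0 ltW.
by rewrite 2!normrM d1 mulr1 normrX (ger0_norm b0) exprVn.
Qed.

Lemma dual_map_inv_lin4 : exists p q r t : R, (forall eta, dual_map_inv eta = lin4 p q r t eta) /\
  p * t - q * r != 0.
Proof.
pose M := L; pose w1 := (v.2 / D, - v.1 / D) : R * R; pose w2 := (- u.2 / D, u.1 / D) : R * R.
exists (a * (M 0 0 * w1.1 + M 0 1 * w1.2)), (a * (M 0 0 * w2.1 + M 0 1 * w2.2)),
  (a * (M 1 0 * w1.1 + M 1 1 * w1.2)), (a * (M 1 0 * w2.1 + M 1 1 * w2.2)); split.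
  move=> eta; rewrite /dual_map_inv; apply: pair_ext;
    by rewrite /pairing_inv /ap /mx_point /lin4 /= /GRing.scale /=; ring.
have -> : a * (M 0 0 * w1.1 + M 0 1 * w1.2) * (a * (M 1 0 * w2.1 + M 1 1 * w2.2)) -
   a * (M 0 0 * w2.1 + M 0 1 * w2.2) * (a * (M 1 0 * w1.1 + M 1 1 * w1.2)) =
   a ^+ 2 * (M 0 0 * M 1 1 - M 0 1 * M 1 0) * (w1.1 * w2.2 - w1.2 * w2.1) by ring.
have -> : w1.1 * w2.2 - w1.2 * w2.1 = D^-1 by rewrite /=; field.
have d0 : M 0 0 * M 1 1 - M 0 1 * M 1 0 != 0 by rewrite -sqrf_eq0 O2_det oner_eq0.
by rewrite (mulf_neq0 (mulf_neq0 _ d0)) ?invr_neq0 // expf_neq0 // (gt_eqF a0).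
Qed.

Lemma measurable_dual_map (S : set (R * R)) : measurable (S : set (mR * mR)) ->
  measurable (dual_map @^-1` S : set (mR * mR)).
Proof.
have [p [q [r [t [e _]]]]] := dual_map_lin4.
by rewrite (_ : dual_map = lin4 p q r t); [exact: measurable_lin4_preimage|apply/funext].
Qed.

Lemma det_dual_map_gt0 : 0 < `|D| / a ^+ 2.
Proof. by rewrite divr_gt0 ?normr_gt0 // exprn_gt0. Qed.

Lemma bbs_dual_map (f : R * R -> C) : bbs f -> bbs (fun eta => f (dual_map eta)).
Proof.
have [p [q [r [t [e n]]]]] := dual_map_lin4.
under eq_fun do rewrite e; apply: bbs_lin4.
by rewrite -normr_gt0 n det_dual_map_gt0.
Qed.

Lemma bbs_dual_map_inv (f : R * R -> C) : bbs f -> bbs (fun eta => f (dual_map_inv eta)).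
Proof.
by have [p [q [r [t [e n]]]]] := dual_map_inv_lin4; under eq_fun do rewrite e; exact: bbs_lin4.
Qed.

Lemma sq_dual_map (f : R * R -> C) : cmeas f ->
  sq (fun eta => f (dual_map eta)) = ((`|D| / a ^+ 2)^-1%:E * sq f)%E.
Proof.
have [p [q [r [t [e n]]]]] := dual_map_lin4; move=> mf.
under eq_fun do rewrite e; rewrite -n sq_lin4 //.
by rewrite -normr_gt0 n det_dual_map_gt0.
Qed.

Lemma cintegral_dual_map (f : R * R -> C) : cmeas f ->
  cintegral (fun eta => f (dual_map eta)) = ((`|D| / a ^+ 2)^-1)%:C * cintegral f.
Proof.
have [p [q [r [t [e n]]]]] := dual_map_lin4; move=> mf.
rewrite (_ : (fun eta => _) = fun z => f (lin4 p q r t z)); last by apply/funext => z; rewrite e.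
rewrite -n cintegral_lin4 //.
by rewrite -normr_gt0 n det_dual_map_gt0.
Qed.

End ScaledIsometry.
End DualCoordinates.

(** * The wavelet system *)

Lemma conj_phase (R : realType) (c : R) (p q : R[i]) : p * p^* = 1 ->
  c%:C * (p * q) * (c%:C * p)^* = (c * c)%:C * (q * 1^*).
Proof.
case: p q => a b [q1 q2] pp; have := congr1 (@complex.Re R) pp; rewrite cReM cReJ cImJ /= => n.
have {}n : a * a + b * b = 1 by rewrite -n; ring.
apply: Cext; rewrite ?cReM ?cImM ?cReJ ?cImJ /=.
  transitivity (c * c * q1 * (a * a + b * b)); first by ring.
  by rewrite n; ring.
transitivity (c * c * q2 * (a * a + b * b)); first by ring.
by rewrite n; ring.
Qed.

Section WaveletFamily.
Variable R : realType.
Local Notation mR := (measurableTypeR R).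
Local Notation area := (@area R).
Local Notation C := R[i].
Implicit Types (L M : O2 R) (x y z xi eta zeta : R * R).

Variables (u v : R * R) (G : set (motion R)) (d : nat).
Local Notation D := (u.1 * v.2 - u.2 * v.1).
Hypothesis D0 : D != 0.
Hypothesis d2 : (2 <= d)%N.
Hypotheses (G1 : G 1%g) (GM : forall g h, G g -> G h -> G (g * h)%g) (GV : forall g, G g -> G g^-1%g).
Hypothesis GT : forall x, G (translation x) <-> in_lattice u v x.

Lemma point_group1 : point_group G (O2_one R).
Proof. by exists 0. Qed.

Lemma point_groupM L M : point_group G L -> point_group G M -> point_group G (O2_mul L M).
Proof. by move=> [x Gx] [y Gy]; exists (trans (Motion x L * Motion y M)%g); exact: GM Gx Gy. Qed.

Lemma point_groupV L : point_group G L -> point_group G (O2_inv L).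
Proof. by move=> [x Gx]; exists (trans (Motion x L)^-1%g); exact: GV Gx. Qed.

Lemma same_linear_part x y L : G (Motion x L) -> G (Motion y L) -> in_lattice u v (x - y).
Proof.
move=> Gx Gy; apply/GT; have := GM (GV Gy) Gx; congr G; congr Motion => /=; last first.
  exact: O2_mulV.
by rewrite mx_pointN -mx_pointM mulVmx ?O2_unit // mx_point1 addrC.
Qed.

Lemma add_lattice x L k : G (Motion x L) -> G (Motion (x + lattice u v k) L).
Proof.
move=> Gx; have Gk : G (translation (lattice u v k)) by apply/GT; exists k.
have := GM Gx Gk; congr G; congr Motion => /=; last exact: O2_mulr1.
by rewrite invmx1 mx_point1.
Qed.

Variable W : set (R * R).
Hypotheses (mW : measurable (W : set (mR * mR))) (tW : tile W) (W_box : exists M : R, W `<=` box M).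

Local Notation sc j := (d%:R ^ j : R).
Local Notation T j L := (dual_map u v (sc j) L).

Lemma scale_gt0 (j : int) : 0 < sc j.
Proof. by apply: exprz_gt0; rewrite ltr0n; lia. Qed.

(** The function whose inverse Fourier transform is the element of the wavelet
    system with index [jg]; it lives on the piece of the plane belonging to
    the scale and to the linear part, and the translation part only
    contributes a character. *)
Definition wavelet_spectrum (jg : int * motion R) : R * R -> C := fun eta =>
  (Num.sqrt `|D| / sc jg.1)%:C *
  cut W (wave (- basis_coord u v (trans jg.2))) (T jg.1 (lin jg.2) eta).

Lemma bbs_cut_tile (f : R * R -> C) : cmeas f -> cbounded f -> bbs (cut W f).
Proof.
move=> mf bf; have [M WM] := W_box; split; first exact: cmeas_cut.
  by apply: cboundedM => //; exact: cbounded_indic.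
by exists M => z zM; rewrite cutE memNset // => /WM.
Qed.

Lemma bbs_cut_wave x : bbs (cut W (wave x)).
Proof. by apply: bbs_cut_tile; [exact: cmeas_wave|exact: cbounded_wave]. Qed.

Lemma bbs_wavelet_spectrum jg : bbs (wavelet_spectrum jg).
Proof.
apply: bbsZ; apply: (bbs_dual_map D0 _ (scale_gt0 _) (f := cut W _)).
exact: bbs_cut_wave.
Qed.

(** The function [wavelet] for an arbitrary lattice basis. *)
Definition lattice_wavelet : R * R -> C := fun z =>
  (Num.sqrt `|D|)%:C * inverse_fourier (fun xi => (\1_(pairing u v @^-1` W) xi : R)%:C) z.

(** Substitution in the integral of the inverse Fourier transform. *)
Lemma wavelet_orbit jg :
  dilation (sc jg.1) (act_fun jg.2 lattice_wavelet) = inverse_fourier (wavelet_spectrum jg).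
Proof.
case: jg => j [x L]; apply/funext => z; rewrite /dilation /act_fun /lattice_wavelet /=.
have a0 := scale_gt0 j; set a := sc j in a0 *.
pose q := a *: ap (O2_inv L) z.
have -> : mx_point (invmx L) (a *: z) = q.
  by apply: pair_ext; rewrite /q /= /GRing.scale /=; ring.
pose f zeta := cut W (wave (- basis_coord u v x)) zeta * wave q (pairing_inv u v zeta).
have fE xi : f (pairing u v xi) = (\1_(pairing u v @^-1` W) xi : R)%:C * wave (q - x) xi.
  transitivity ((\1_W (pairing u v xi) : R)%:C * wave (basis_coord u v (- x)) (pairing u v xi) *
    wave q xi); first by rewrite basis_coordN // /f pairingK.
  rewrite wave_basis_coord // waveDl -mulrA (mulrC (wave (- x) _)).
  by congr ((_)%:C * _); rewrite !indicE; congr (_%:R); apply/idP/idP => /set_mem h; exact/mem_set.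
have gE eta : wavelet_spectrum (j, Motion x L) eta * wave z eta =
    (Num.sqrt `|D| / a)%:C * f (T j L eta).
  rewrite /wavelet_spectrum /f /= -mulrA; congr (_ * (_ * _)).
  have dq : dot q (a^-1 *: ap (O2_inv L) eta) = dot z eta.
    by rewrite /q dotZl (dotC _ (_ *: _)) dotZl mulrA mulfV ?gt_eqF // mul1r dot_ap dotC.
  by rewrite /dual_map pairingK // /wave dq.
have bf : bbs f.
  apply: bbs_mul; first exact: bbs_cut_wave.
    by apply: (cmeas_comp (@measurable_lin4 _ _ _ _ _)); exact: cmeas_wave.
  by exists 1 => zeta; rewrite csq_wave.
have V0 : 0 < `|D| by rewrite normr_gt0.
have [mf _ _] := bf; have intf := bbs_cintegrable bf.
rewrite !inverse_fourierE (eq_cintegral gE).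
rewrite (cintegral_dual_map D0 _ a0 (f := fun zeta => (Num.sqrt `|D| / a)%:C * f zeta)); last first.
  by apply: cmeasM => //; exact: cmeas_cst.
rewrite cintegralZ // -(eq_cintegral fE) (cintegral_lin4 D0 mf) !mulrA.
congr (_ * _); rewrite -!rmorphM /=; congr (_%:C).
by field; rewrite !gt_eqF.
Qed.

Lemma in_L2_orbit jg : in_L2 (dilation (sc jg.1) (act_fun jg.2 lattice_wavelet)).
Proof. by rewrite wavelet_orbit; exact/in_L2_inverse_fourier/bbs_wavelet_spectrum. Qed.

Lemma sqrt_scale (a : R) : 0 < a -> Num.sqrt `|D| / a * (Num.sqrt `|D| / a) = `|D| / a ^+ 2.
Proof.
move=> a0; rewrite -[in RHS](@sqr_sqrtr _ `|D|) //; field; exact: lt0r_neq0.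
Qed.

(** Motions of [G] with the same linear part differ by a lattice translation,
    so that the spectra differ by a character with integer frequency on the
    tile. *)
Lemma inner_same_piece j x y L : G (Motion x L) -> G (Motion y L) ->
  inner (wavelet_spectrum (j, Motion x L)) (wavelet_spectrum (j, Motion y L)) = (x == y)%:R.
Proof.
move=> Gx Gy; have [k _ xy] := same_linear_part Gx Gy.
have a0 := scale_gt0 j; have c2 := sqrt_scale a0; set c := _ / _ in c2.
have V0 : 0 < `|D| / sc j ^+ 2 by apply: det_dual_map_gt0.
have e0 : (x == y) = (- k == 0).
  rewrite oppr_eq0 -(subr_eq0 x y) -xy; apply/eqP/eqP => [h|->]; last exact: lattice0.
  by apply: (@emb_inj R); rewrite -!(basis_coord_lattice D0) h lattice0.
have kE : - basis_coord u v x = - basis_coord u v y + emb R (- k).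
  by rewrite -(subrK y x) -xy basis_coordD // basis_coord_lattice // opprD addrC embN.
pose F zeta := (c * c)%:C * (tile_wave W (- k) zeta * (tile_wave W 0 zeta)^*).
have FE eta : wavelet_spectrum (j, Motion x L) eta * (wavelet_spectrum (j, Motion y L) eta)^* =
    F (T j L eta).
  rewrite /wavelet_spectrum /F /tile_wave /= -/c; set zeta := T j L eta.
  rewrite !cutE; case: ifP => _; last by rewrite !mulr0 mul0r !mulr0.
  rewrite kE waveDl emb0 wave0.
  exact/conj_phase/waveJ.
have mF : cmeas F.
  apply: cmeasM; first exact: cmeas_cst.
  by apply: cmeasM; [exact: cmeas_tile_wave|apply: cmeasJ; exact: cmeas_tile_wave].
rewrite /inner (eq_cintegral FE) (cintegral_dual_map D0 L a0 mF) cintegralZ; last first.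
  by apply: cintegrable_inner; exact: in_L2_tile_wave.
have := inner_tile_wave mW tW (- k) 0; rewrite /inner => ->.
by rewrite mulrA -rmorphM /= c2 mulVf ?gt_eqF // mul1r e0.
Qed.

Hypothesis separation : forall j L j' L' eta, point_group G L -> point_group G L' ->
  W (T j L eta) -> W (T j' L' eta) -> j = j' /\ L = L'.

(** Spectra at different scales or with different linear parts have disjoint
    supports. *)
Lemma inner_wavelet_spectrum jg jh : G jg.2 -> G jh.2 ->
  inner (wavelet_spectrum jg) (wavelet_spectrum jh) = (jg == jh)%:R.
Proof.
case: jg => j [x L]; case: jh => j' [y M] /= Gx Gy.
have [[jj LM]|ne] := pselect (j = j' /\ L = M).
  rewrite -jj -LM in Gy *; rewrite inner_same_piece //; congr ((nat_of_bool _)%:R).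
  by apply/idP/idP => [/eqP ->//|/eqP[->]].
have -> : ((j, Motion x L) == (j', Motion y M)) = false.
  by apply/eqP => -[e1 _ e2]; apply: ne.
apply: etrans (inner0l (wavelet_spectrum (j', Motion y M))); apply: eq_cintegral => eta.
rewrite mul0r /wavelet_spectrum /= !cutE.
case: (boolP (_ \in W)) => [/set_mem W1|_]; last by rewrite mulr0 mul0r.
case: (boolP (_ \in W)) => [/set_mem W2|_]; last by rewrite mulr0 conjC0 mulr0.
by case: ne; apply: separation W1 W2; [exists x|exists y].
Qed.

Local Notation family := [set jg : int * motion R | G jg.2].

(** On the piece of [j] and [L] the spectra are the exponentials of the tile,
    transported by a linear map and multiplied by the character of one element
    of [G] with linear part [L]. *)
Lemma approx_piece j L h : point_group G L -> bbs h ->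
  approx family wavelet_spectrum (cut (T j L @^-1` W) h).
Proof.
move=> [x Gx] bh; have a0 := scale_gt0 j; have V0 := det_dual_map_gt0 D0 a0.
have c2 := sqrt_scale a0; set c := _ / _ in c2.
have c0 : c != 0 by apply/eqP => e; move: V0; rewrite -c2 e mul0r ltxx.
pose f zeta := h (dual_map_inv u v (sc j) L zeta) * wave (basis_coord u v x) zeta.
have [mf bf _] : bbs f.
  by apply: bbs_mul; [exact: bbs_dual_map_inv|exact: cmeas_wave|exact: cbounded_wave].
have [mh _ _] := bh.
have mT := measurable_dual_map u v L a0 mW.
have mTc (q : R * R -> C) : cmeas q -> cmeas (fun eta => q (T j L eta)).
  have [p1 [p2 [p3 [p4 [e _]]]]] := dual_map_lin4 u v L a0 => mq.
  by under eq_fun do rewrite e; apply: (cmeas_comp (@measurable_lin4 _ _ _ _ _)).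
apply: (approx_map (m := fun k => (j, Motion (x - lattice u v k) L)) (c := c^-1%:C)
  (K := (`|D| / sc j ^+ 2)^-1) _ _ _ _ (approx_tile_wave mW tW mf bf)).
- by rewrite invr_ge0 ltW.
- exact: cmeas_cut.
- by move=> k _ /=; rewrite -latticeN; exact: add_lattice.
move=> l _; set r := fun z => cut W f z - lincomb (tile_wave W) l z.
have mr : cmeas r.
  by apply: cmeasB; [exact: cmeas_cut|apply: (@cmeas_lincomb _ _ setT) => // i _; exact: cmeas_tile_wave].
pose p := wave (- basis_coord u v x).
rewrite (_ : (fun z => _) = fun eta => p (T j L eta) * r (T j L eta)).
  apply: le_trans (_ : _ <= sq (fun eta => r (T j L eta)))%E _; last by rewrite sq_dual_map.
  rewrite -[leRHS]mul1e; apply: sq_mul_le => //.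
  - by apply: mTc; exact: cmeas_wave.
  - exact: mTc.
  - by move=> eta; rewrite csq_wave.
apply/funext => eta; rewrite /r mulrBr; congr (_ - _).
  rewrite !cutE (_ : (eta \in _) = (T j L eta \in W)); last first.
    by apply/idP/idP => /set_mem ?; exact/mem_set.
  case: ifP => _; last by rewrite mulr0.
  rewrite /f dual_mapK // mulrCA (mulrC (p _)) /p.
  by rewrite -waveDl addrN wave0 mulr1.
rewrite /lincomb big_map big_distrr /=; apply: eq_bigr => t _.
rewrite /wavelet_spectrum /= -/c /tile_wave !cutE; set zeta := T j L eta.
case: ifP => _; last by rewrite !mulr0.
rewrite basis_coordD // basis_coordN // basis_coord_lattice // opprD opprK waveDl.
rewrite -/p mulrA -(mulrA t.1) -rmorphM /= mulVf // mulr1.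
by rewrite mulrCA.
Qed.

Variables (s : seq (O2 R)) (N : set (R * R)).
Hypothesis finG : forall L, point_group G L <-> L \in s.
Hypotheses (mN : measurable (N : set (mR * mR))) (N0 : area N = 0%E).
Hypothesis cover : forall eta, ~ N eta -> exists j L, point_group G L /\ W (T j L eta).

(** The pieces cover the plane up to a null set. *)
Lemma approx_spectrum h : bbs h -> approx family wavelet_spectrum h.
Proof.
move=> bh; pose s' := undup s; pose o := O2_one R.
pose A n : set (R * R) := if (pickle_inv n : option (int * nat)) is Some p then
  if (p.2 < size s')%N then T p.1 (nth o s' p.2) @^-1` W else set0 else set0.
have in_s i : (i < size s')%N -> point_group G (nth o s' i).
  by move=> h'; apply/finG; rewrite -mem_undup; exact: mem_nth.
apply: (approx_pieces (A := A) _ _ _ mN N0 _ (bbs_in_L2 bh)).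
- by move=> i _; have [] := bbs_wavelet_spectrum i.
- move=> n; rewrite /A; case: pickle_inv => [p|]; last exact: measurable0.
  case: ifP => _; last exact: measurable0.
  by apply: measurable_dual_map => //; exact: scale_gt0.
- move=> n m z; rewrite /A.
  have := @pickle_invK (int * nat)%type n; have := @pickle_invK (int * nat)%type m.
  case: pickle_inv => [[j i]|] //= <-; case: pickle_inv => [[j' i']|] //= <-.
  case: ifP => //= hi' W1; case: ifP => //= hi W2.
  have [-> /eqP] := separation (in_s _ hi') (in_s _ hi) W1 W2.
  by rewrite nth_uniq ?undup_uniq // => /eqP ->.
- move=> z /cover[j [L [/finG Ls Wz]]]; exists (pickle (j, index L s')).
  have Ls' : L \in s' by rewrite mem_undup.
  by rewrite /A pickleK_inv /= index_mem Ls' nth_index.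
- move=> n; rewrite /A; case: pickle_inv => [p|]; last first.
    by rewrite (_ : cut _ h = fun=> 0); [exact: approx0|apply/funext => z; rewrite cutE memNset].
  case: ifP => [/in_s|_]; first by move=> PL; exact: approx_piece.
  by rewrite (_ : cut _ h = fun=> 0); [exact: approx0|apply/funext => z; rewrite cutE memNset].
Qed.

Lemma orthonormal_basis_orbit : orthonormal_basis family
  (fun jg => dilation (sc jg.1) (act_fun jg.2 lattice_wavelet)).
Proof.
split=> [jg _|jg jh Gg Gh|f lf eps e0]; first exact: in_L2_orbit.
  rewrite !wavelet_orbit inner_inverse_fourier2; [|exact: bbs_wavelet_spectrum..].
  exact: inner_wavelet_spectrum.
have bg jg : family jg -> bbs (wavelet_spectrum jg) by move=> _; exact: bbs_wavelet_spectrum.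
have [_ /(_ _ (exprn_gt0 2 e0))[l Dl hl]] := approx_inverse_fourier bg approx_spectrum lf.
exists (undup [seq t.2 | t <- l]), (fun i => \sum_(t <- l | t.2 == i) t.1); split.
  by move=> i; rewrite mem_undup => /mapP[t tl ->]; exact: Dl.
apply: norm2_lt => //; congr (_ < _)%E: hl; congr sq; apply/funext => z.
by rewrite lincomb_uniq; congr (_ - _); apply: eq_bigr => i _; rewrite wavelet_orbit.
Qed.

End WaveletFamily.

Section Existence.
Variable R : realType.
Local Notation mR := (measurableTypeR R).
Local Notation area := (@area R).

(** In the dual coordinates the translations of [G] become Z^2. The wavelet
    tile is chosen inside the image of the Dirichlet cone of a generic point:
    its dilates tile the cone, and the images of the cone under the point
    group tile the plane. *)
Lemma lattice_group_wavelet (u v : R * R) (G : set (motion R)) (d : nat) :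
  u.1 * v.2 - u.2 * v.1 != 0 -> (2 <= d)%N ->
  G 1%g -> (forall g h, G g -> G h -> G (g * h)%g) -> (forall g, G g -> G g^-1%g) ->
  (forall x, G (translation x) <-> in_lattice u v x) -> finite_set (point_group G) ->
  exists W : set (R * R), [/\ measurable (pairing u v @^-1` W : set (mR * mR)),
    (area (pairing u v @^-1` W) < +oo)%E &
    orthonormal_basis [set jg : int * motion R | G jg.2]
      (fun jg => dilation (d%:R ^ jg.1) (act_fun jg.2 (lattice_wavelet u v W)))].
Proof.
move=> D0 d2 G1 GM GV GT /finite_seqP[s Ps'].
have Ps L : point_group G L <-> L \in s by rewrite Ps'.
have P1 := point_group1 G1; have PM := point_groupM GM; have PV := point_groupV GV.
have [p [p0 gp]] := generic_point Ps.
have [eps e0 openY] := dirichlet_open Ps gp.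
pose Y := pairing_inv u v @^-1` dirichlet (point_group G) p.
pose D := u.1 * v.2 - u.2 * v.1.
pose K := `|v.2 / D| + `|u.2 / D| + `|v.1 / D| + `|u.1 / D| + 1.
have K0 : 0 < K by rewrite ltr_wpDl // !addr_ge0.
have d0 : 0 < d%:R :> R by rewrite ltr0n; lia.
have YP eta : Y (pairing u v eta) <-> dirichlet (point_group G) p eta.
  by rewrite /Y /= pairingK.
have mY : measurable (Y : set (mR * mR)).
  by apply: measurable_lin4_preimage; exact: measurable_dirichlet Ps _.
have YZ (t : R) z : 0 < t -> Y z -> Y (t *: z).
  by move=> t0; rewrite -[z](pairing_invK D0) -pairingZ !YP; exact: dirichletZ.
have pp0 : pairing u v p != 0.
  apply: contra p0 => /eqP h; rewrite -(pairingK D0 p) h; apply/eqP.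
  by apply: pair_ext; rewrite /pairing_inv /lin4 /= !mulr0 addr0.
have Yp q : `|q.1| <= eps / K -> `|q.2| <= eps / K -> Y (pairing u v p + q).
  move=> q1 q2; rewrite -[q](pairing_invK D0).
  have -> x y : pairing u v x + pairing u v y = pairing u v (x + y).
    by apply: pair_ext; rewrite /pairing /lin4 /=; ring.
  have eK : eps / K * K = eps by rewrite divfK // gt_eqF.
  have ek0 : 0 <= eps / K by rewrite divr_ge0 // ltW.
  have bd (a b : R) : `|a| + `|b| <= K -> `|a * q.1 + b * q.2| <= eps.
    move=> ab; apply: le_trans (ler_normD _ _) _; rewrite !normrM.
    apply: (@le_trans _ _ ((`|a| + `|b|) * (eps / K))).
      by rewrite mulrDl lerD // ler_wpM2l.
    by rewrite -[leRHS]eK mulrC ler_wpM2l.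
  have := normr_ge0 (v.2 / D); have := normr_ge0 (u.2 / D).
  have := normr_ge0 (v.1 / D); have := normr_ge0 (u.1 / D) => k1 k2 k3 k4.
  apply/YP/openY; rewrite /pairing_inv /lin4 -/D /=; apply: bd; rewrite mulNr normrN /K; lra.
have [W [mW tW [WY W_box] Wc Wp]] := wavelet_tile d2 mY YZ pp0 (divr_gt0 e0 K0) Yp.
have [N [mN N0 cN]] := @dirichlet_cover R _ _ Ps P1 PM PV p gp.
pose line := [set z : R * R | dot z (1, 0) = 0].
exists W; split.
- exact: measurable_lin4_preimage.
- by rewrite /pairing area_scaling_all // (area_tile mW tW) mule1 ltry.
apply: (@orthonormal_basis_orbit R u v G d D0 d2 GM GV GT W mW tW W_box _ s (N `|` line)) => //.
- move=> j L j' L' eta PL PL' W1 W2.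
  have in_cone i M : W (dual_map u v (d%:R ^ i) M eta) -> dirichlet (point_group G) p (ap (O2_inv M) eta).
    move=> /WY; rewrite /dual_map => /YP; have a0 : 0 < (d%:R ^ i : R) by exact: exprz_gt0.
    by move=> /(dirichletZ a0); rewrite scalerA mulfV ?scale1r // gt_eqF.
  have LL := dirichlet_disjoint PM PV PL PL' (in_cone _ _ W1) (in_cone _ _ W2).
  split=> //; apply/eqP; rewrite -subr_eq0; apply/eqP; apply: (Wp _ _ W1).
  rewrite -LL in W2; congr W: W2; rewrite /dual_map -pairingZ scalerA; congr (pairing u v (_ *: _)).
  by rewrite expfzDr ?gt_eqF // mulrAC mulfV ?mul1r ?expfz_neq0 ?gt_eqF // invr_expz.
- apply: measurableU => //; exact: measurable_line.
- rewrite null_set_setU //; first exact: measurable_line.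
  by apply: area_line; apply/eqP => -[/eqP]; rewrite oner_eq0.
- move=> eta Neta; have [|L PL YL] := cN eta; first by move=> h; apply: Neta; left.
  have eta0 : pairing u v (ap (O2_inv L) eta) != 0.
    apply/eqP => h; apply: Neta; right; rewrite /line /=.
    rewrite -(ap_Kinv L eta) -(pairingK D0 (ap _ eta)) h.
    by rewrite /dot /ap /mx_point /pairing_inv /lin4 /= !(mulr0, addr0, mul0r).
  have [j Wj] := Wc _ ((YP _).2 YL) eta0.
  exists (- j), L; split=> //; rewrite /dual_map -invr_expz invrK pairingZ.
  exact: Wj.
Qed.

End Existence.

Theorem theorem2 (R : realType) (w : wallpaper) (d : nat) (hd : (2 <= d)%N) :
  exists W : set (R * R), wavelet_set w d W.
Proof.
case eb : (lattice_basis R w) => [u v].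
have D0 := lattice_basis_indep eb.
have G1 : wallpaper_group w (1%g : motion R).
  by rewrite /wallpaper_group eb; exact: generated_one.
have GM (g h : motion R) : wallpaper_group w g -> wallpaper_group w h -> wallpaper_group w (g * h)%g.
  by rewrite /wallpaper_group eb; exact: generated_mul.
have GV (g : motion R) : wallpaper_group w g -> wallpaper_group w g^-1%g.
  by rewrite /wallpaper_group eb; exact: generated_inv.
have GT x := wallpaper_translation x eb.
have [W [mW aW bW]] := lattice_group_wavelet D0 hd G1 GM GV GT (finite_point_group R w).
exists (pairing u v @^-1` W); split=> //; move: bW.
by rewrite /lattice_wavelet /wavelet /covolume eb.
Qed.
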